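(* Let $$\mathcal H_1=2u_2^{-1}D_x+2D_xu_2^{-1}-u_3u_2^{-3/2}D_x^{-1}u_3u_2^{-3/2},$$ $$\mathcal H_2=u_1^4u_2^{-2}D_x+D_xu_1^4u_2^{-2}-8u_1D_x^{-1}u_1,$$ $$\mathcal H_3=u_1^{-4}D_x+D_xu_1^{-4}-4(u_3u_1^{-6}-3u_2^2u_1^{-7})D_x^{-1}u_1-4u_1D_x^{-1}(u_3u_1^{-6}-3u_2^2u_1^{-7}),$$ let $\Re_i=\mathcal H_iD_x$ for $i=1,2,3$, with adjoint $\Re_i^\star=D_x\mathcal H_i$, and let $$\xi_1=\delta_u\big(u_2^{1/2}\big),\qquad \xi_2=\delta_u\Big(\frac{u_1^6}{2u_2}\Big),\qquad \xi_3=\delta_u\Big(\frac{u_2^2}{2u_1^6}\Big).$$ Then all $\Re_i^{\star j}\xi_i$ ($i=1,2,3$; $j=0,1,2,\dots$) are closed $1$-forms, and for each fixed $i\in\{1,2,3\}$ all $\mathcal H_i\Re_i^{\star j}\xi_i$, $j=0,1,2,\dots$, commute.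
   Context: $u$ is a scalar dependent variable, $u_k=\partial_x^ku$, $D_x=\sum_{k\ge0}u_{k+1}\,\partial/\partial u_k$, with inverse $D_x^{-1}$ (a primitive in the ring of differential functions, integration constants being disregarded); functions act as multiplication operators, on a domain where denominators do not vanish and branches of fractional powers are fixed. Differential functions are smooth functions of finitely many $u_k$. The variational derivative is $\delta_ug=\sum_k(-D_x)^k\partial g/\partial u_k$. A (functional) $1$-form is represented by a differential function $\xi$; it is closed if $D_\xi=D_\xi^\star$, where $D_\xi=\sum_i\frac{\partial\xi}{\partial u_i}D_x^i$ is the Fréchet derivative and $\star$ the formal adjoint. In particular, the claim includes that the $\Re_i^{\star j}\xi_i$ are (local) differential functions. Two differential functions $P,Q$ commute if $[P,Q]=D_Q[P]-D_P[Q]=0$. *)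

(* Defs.v *)
(* MathComp with MathComp-Analysis. *)
From HB Require Import structures.
From mathcomp Require Import all_boot all_order all_algebra.
From mathcomp Require Import all_classical all_reals all_analysis.

Set Implicit Arguments.
Unset Strict Implicit.
Unset Printing Implicit Defensive.

Import Order.TTheory GRing.Theory Num.Theory.
Import numFieldNormedType.Exports.

Local Open Scope classical_set_scope.
Local Open Scope ring_scope.

(* A jet v lists the values v k of all the derivatives u_k, k = 0, 1, 2, ...
   Jets carry the product topology: a function of finitely many of the u_k is
   continuous for it exactly when it is continuous in these variables. *)
Notation jet R := {ptws nat -> R}.

Section DifferentialFunctions.
Context {R : realType}.
Implicit Types (U : set (jet R)) (f g : jet R -> R) (v : jet R).

Definition jet_domain U := open U /\ connected U.

(* The partial derivative of f with respect to u_k. *)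
Definition partial (k : nat) f : jet R -> R :=
  fun v => derive1 (fun t : R => f (dfwith v k t)) (v k).

Definition finite_order U f := exists n : nat, forall v w, U v -> U w ->
  (forall k, (k < n)%N -> v k = w k) -> f v = f w.

Definition smooth U f := forall (s : seq nat) v, U v ->
  {for v, continuous (foldr partial f s)} /\
  forall k, derivable (fun t : R => foldr partial f s (dfwith v k t)) (v k) 1.

(* Functions are total; only their values on U are meaningful, and equality of
   differential functions on U is {in U, f =1 g}. *)
Definition diff_function U f := finite_order U f /\ smooth U f.

(* For a differential function all but finitely many partial derivatives vanish,
   so the sums over all k in the following definitions have finite support. *)
Definition Dx f : jet R -> R :=
  fun v => \sum_(k \in [set: nat]) v k.+1 * partial k f v.

(* g is a value of D_x^{-1} f. *)
Definition primitive U f g := diff_function U g /\ {in U, Dx g =1 f}.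

Definition variational f : jet R -> R :=
  fun v => \sum_(k \in [set: nat]) iter k (fun h => - Dx h) (partial k f) v.

(* The differential operator \sum_k a_k D_x^k and its formal adjoint
   \sum_k (- D_x)^k \o a_k. *)
Definition diff_op (a : nat -> jet R -> R) g : jet R -> R :=
  fun v => \sum_(k \in [set: nat]) a k v * iter k Dx g v.

Definition diff_op_adj (a : nat -> jet R -> R) g : jet R -> R :=
  fun v => \sum_(k \in [set: nat]) iter k (fun h => - Dx h) (a k * g) v.

Definition frechet f := diff_op (partial^~ f).
Definition frechet_adj f := diff_op_adj (partial^~ f).

Definition closed_form U (xi : jet R -> R) := forall g, diff_function U g ->
  {in U, frechet xi g =1 frechet_adj xi g}.

Definition bracket (P Q : jet R -> R) := frechet Q P - frechet P Q.

Definition commuting U (P Q : jet R -> R) := {in U, bracket P Q =1 cst 0}.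

End DifferentialFunctions.

(* As D_x^{-1} is determined up to an integration constant only, an operator
   containing it is rendered as a set-valued map: H xi is the set of all
   functions obtained from xi by choosing primitives. *)
Section Operators.
Context {R : realType}.
Implicit Types (U : set (jet R)) (xi P : jet R -> R)
  (H : (jet R -> R) -> set (jet R -> R)).

(* s is a branch of u_2^{1/2} on U, so that u_2^{-3/2} is s^{-3}. *)
Definition sqrt_branch U (s : jet R -> R) :=
  diff_function U s /\ forall v, U v -> v 2%N != 0 /\ s v ^+ 2 = v 2%N.

Definition H1 U (s : jet R -> R) xi : set (jet R -> R) :=
  let a : jet R -> R := fun v => (v 2%N)^-1 in
  let b : jet R -> R := fun v => v 3%N * s v ^- 3 in
  [set P : jet R -> R | exists2 g, primitive U (b * xi) g &
    {in U, P =1 2 *: (a * Dx xi) + 2 *: Dx (a * xi) - b * g}].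

Definition H2 U xi : set (jet R -> R) :=
  let a : jet R -> R := fun v => v 1%N ^+ 4 * v 2%N ^- 2 in
  let u1 : jet R -> R := fun v => v 1%N in
  [set P : jet R -> R | exists2 g, primitive U (u1 * xi) g &
    {in U, P =1 a * Dx xi + Dx (a * xi) - 8 *: (u1 * g)}].

Definition H3 U xi : set (jet R -> R) :=
  let a : jet R -> R := fun v => v 1%N ^- 4 in
  let b : jet R -> R :=
    fun v => v 3%N * v 1%N ^- 6 - 3 * v 2%N ^+ 2 * v 1%N ^- 7 in
  let u1 : jet R -> R := fun v => v 1%N in
  [set P : jet R -> R | exists g h, [/\ primitive U (u1 * xi) g, primitive U (b * xi) h &
    {in U, P =1 a * Dx xi + Dx (a * xi) - 4 *: (b * g) - 4 *: (u1 * h)}]].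

(* Since H is skew-adjoint, the adjoint of H \o D_x is D_x \o H. *)
Definition Rstar U H xi : set (jet R -> R) :=
  [set zeta : jet R -> R | exists2 P, H xi P & {in U, zeta =1 Dx P}].

Fixpoint Rstar_iter U H (xi0 : jet R -> R) (j : nat) : set (jet R -> R) :=
  if j is i.+1 then \bigcup_(xi in Rstar_iter U H xi0 i) Rstar U H xi
  else [set xi : jet R -> R | {in U, xi =1 xi0}].

Definition xi1 (s : jet R -> R) := variational s.
Definition xi2 : jet R -> R :=
  variational (fun v : jet R => v 1%N ^+ 6 / (2 * v 2%N)).
Definition xi3 : jet R -> R :=
  variational (fun v : jet R => v 2%N ^+ 2 / (2 * v 1%N ^+ 6)).

(* Every choice of the integration constants made up to the j-th iterate can be
   continued, so that no iterate is ever undefined. *)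
Definition local_closed_forms U H (xi0 : jet R -> R) :=
  forall (j : nat) xi, Rstar_iter U H xi0 j xi ->
    [/\ diff_function U xi, closed_form U xi & H xi !=set0].

Definition commuting_flows U H (xi0 : jet R -> R) :=
  forall (j k : nat) xi zeta P Q,
    Rstar_iter U H xi0 j xi -> Rstar_iter U H xi0 k zeta ->
    H xi P -> H zeta Q -> commuting U P Q.

End Operators.

(* Main.v *)
(* Let [H] be one of the three operators, [H = 2 a D + D a - f D^-1 g - g D^-1 f].
   With [D] and [H] skew-adjoint, Lenard's argument shifts the indices in
   [int P_i D P_j] (P_i the flows, x_i+1 = D P_i the next form) towards each
   other, so all these expressions are total derivatives.  Since [f] and [g] lie
   in the span of the first flow and of an element of the kernel of the
   recursion ([0] or [u_1]), the primitives of [f x_i], [g x_i] exist: locality.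

   The operator [H] is Hamiltonian and compatible with [D]; both are trilinear
   identities modulo total derivatives.  They show that the defect of closedness
   of x_i+2, given that x_i and x_i+1 are closed, pairs to zero with the image of
   every differential operator E for which [D^-1 f D E] and [D^-1 g D E] are
   differential operators; such an E can be chosen with an injective adjoint.

   The Hamiltonian identity also makes the bracket of two flows [H] of a form
   that vanishes because all [x_i P_j] are total derivatives; what is left comes
   from integration constants and is a combination of [f] and [g].  Its degree
   under scaling of u differs from the degrees of f and g, so it is zero. *)
From Stdlib Require BinInt.
From HB Require Import structures.
Require Import Defs.
From mathcomp Require Import all_boot all_order all_algebra.
From mathcomp Require Import all_classical all_reals all_analysis.
From mathcomp Require Import ring lra zify ssrZ.
Import Order.TTheory GRing.Theory Num.Theory.
Import numFieldNormedType.Exports.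
Local Open Scope classical_set_scope.
Local Open Scope ring_scope.

Set Implicit Arguments.
Unset Strict Implicit.
Unset Printing Implicit Defensive.

(** * Jet algebras *)

(** Two obstacles shape the proof. The inverse of [D] is neither local nor single-valued, so it
    never occurs as a map: a form carries chosen primitives of f x and g x, and a change of the
    integration constants alters a flow only by multiples of f and g. Also, differential functions
    form a ring with zero divisors and without division. Each operator is therefore written with an
    inverse (u_2^(-1/2), u_2^-1 or u_1^-1) as an extra generator, its identities are checked by
    normalizing differential polynomials, and leading coefficients are cancelled as
    non-zero-divisors. For the first two operators f and g are proportional and a first-order E
    suffices; for the third they are independent and E has two factors. For the first and third
    operators the zero form has constant primitives, so f itself is a flow and the given form is a
    multiple of [D f]. For the second, f is a kernel element, the chain starts at the given form,
    and two explicit forms must be checked to be closed. Scaling also selects primitives: away from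
    degree zero, a homogeneous total derivative has a homogeneous primitive. *)

Record derivation (K : fieldType) (A : comPzRingType) (kcst : {rmorphism K -> A})
  := Derivation {
  der :> A -> A;
  derD : forall x y, der (x + y) = der x + der y;
  derM : forall x y, der (x * y) = der x * y + x * der y;
  der_cst : forall c, der (kcst c) = 0 }.

Section DerivationTheory.
Context {K : fieldType} {A : comPzRingType} {kcst : {rmorphism K -> A}}.
Implicit Types (d : derivation kcst) (x y : A).

Lemma der0 d : d 0 = 0.
Proof. by have := der_cst d 0; rewrite rmorph0. Qed.

Lemma der1 d : d 1 = 0.
Proof. by have := der_cst d 1; rewrite rmorph1. Qed.

Lemma der_nat d n : d n%:R = 0.
Proof. by have := der_cst d n%:R; rewrite rmorph_nat. Qed.

Lemma derN d x : d (- x) = - d x.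
Proof. by apply/eqP; rewrite -subr_eq0 opprK -derD addNr der0. Qed.

Lemma derB d x y : d (x - y) = d x - d y.
Proof. by rewrite derD derN. Qed.

Lemma derX d x n : d (x ^+ n.+1) = n.+1%:R * x ^+ n * d x.
Proof.
elim: n => [|n IHn]; first by rewrite expr1 expr0 mulr1 mul1r.
rewrite exprS derM IHn [in RHS]mulrS [x ^+ n.+1]exprS.
by move: n.+1%:R => m; ring.
Qed.

Lemma der_sum d (I : Type) (r : seq I) (P : pred I) (F : I -> A) :
  d (\sum_(i <- r | P i) F i) = \sum_(i <- r | P i) d (F i).
Proof. exact: (big_morph d (derD d) (der0 d)). Qed.

Definition derE := (derD, derN, derM, derX, der_cst, der0, der1, der_nat).

Definition derE_of d :=
  (derD d, derN d, derM d, derX d, der_cst d, der0 d, der1 d, der_nat d).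

End DerivationTheory.

(* An algebraic model of the differential functions on a jet domain, with
   coordinates [jv k], partial derivatives [pd k] and total derivative [Dt].
   The evaluations [at_pt] separate elements; they let identities with
   denominators be checked in the field [K]. *)
Record jetAlgebra (K : fieldType) := JetAlgebra {
  jcar :> comPzRingType;
  kcst : {rmorphism K -> jcar};
  pt : Type;
  at_pt : pt -> {rmorphism jcar -> K};
  at_pt_cst : forall t c, at_pt t (kcst c) = c;
  at_pt_inj : forall x y, (forall t, at_pt t x = at_pt t y) -> x = y;
  pd : nat -> derivation kcst;
  pdC : forall i j x, pd i (pd j x) = pd j (pd i x);
  pd_fin : forall x, exists n, forall k, (n <= k)%N -> pd k x = 0;
  jv : nat -> jcar;
  pd_jv : forall i j, pd i (jv j) = (i == j)%:R;
  Dt : derivation kcst;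
  DtE : forall x n, (forall k, (n <= k)%N -> pd k x = 0) ->
    Dt x = \sum_(k < n) jv k.+1 * pd k x;
  Dt_ker : forall x, Dt x = 0 -> exists c, x = kcst c }.

Arguments kcst {K _}.
Arguments pd {K _}.
Arguments jv {K _}.
Arguments Dt {K _}.

Section Evolution.
Context {K : fieldType} {A : jetAlgebra K}.
Implicit Types (x y z : A) (X Y Z : A) (n k : nat) (c : K).

Local Notation D := (@Dt K A).

Definition jord x : nat := projT1 (cid (pd_fin x)).

Lemma jordP x k : (jord x <= k)%N -> pd k x = 0.
Proof. exact: (projT2 (cid (pd_fin x))). Qed.

(** The evolutionary vector field with characteristic X, that is, the Frechet derivative of x in the
    direction X. The bound [jord x] is an arbitrary choice; by [evE] any other bound gives the same
    value. *)
Definition ev X x := \sum_(k < jord x) iter k D X * pd k x.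

Lemma sum_pd_widen (F : nat -> A) m n :
  (forall k, (m <= k)%N -> F k = 0) -> (forall k, (n <= k)%N -> F k = 0) ->
  \sum_(k < m) F k = \sum_(k < n) F k.
Proof.
wlog le_mn : m n / (m <= n)%N.
  by move=> IH; case/orP: (leq_total m n) => h h1 h2; [|symmetry]; apply: IH.
move=> h _; rewrite -(big_mkord xpredT) -[RHS](big_mkord xpredT).
rewrite [RHS](@big_cat_nat _ _ _ m) //= [X in _ + X]big_nat_cond.
by rewrite [X in _ + X]big1 ?addr0 // => i /andP[/andP[mi _] _]; rewrite h.
Qed.

Lemma evE X x n : (forall k, (n <= k)%N -> pd k x = 0) ->
  ev X x = \sum_(k < n) iter k D X * pd k x.
Proof.
move=> h; apply: (sum_pd_widen (F := fun k => iter k D X * pd k x)) => k hk.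
  by rewrite jordP // mulr0.
by rewrite h // mulr0.
Qed.

Lemma pd_bound (s : seq A) :
  exists n, forall x k, x \in s -> (n <= k)%N -> pd k x = 0.
Proof.
exists (\max_(x <- s) jord x) => x k xs le_k.
by apply: jordP; apply: leq_trans le_k; apply: leq_bigmax_seq.
Qed.

Lemma evD X x y : ev X (x + y) = ev X x + ev X y.
Proof.
have [n hn] := pd_bound [:: x; y].
have hx k : (n <= k)%N -> pd k x = 0 by apply: hn; rewrite inE eqxx.
have hy k : (n <= k)%N -> pd k y = 0 by apply: hn; rewrite !inE eqxx orbT.
rewrite (evE X hx) (evE X hy) (evE X (n := n)); last first.
  by move=> k hk; rewrite derD hx // hy // addr0.
by rewrite -big_split; apply: eq_bigr => k _; rewrite derD mulrDr.
Qed.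

Lemma evM X x y : ev X (x * y) = ev X x * y + x * ev X y.
Proof.
have [n hn] := pd_bound [:: x; y].
have hx k : (n <= k)%N -> pd k x = 0 by apply: hn; rewrite inE eqxx.
have hy k : (n <= k)%N -> pd k y = 0 by apply: hn; rewrite !inE eqxx orbT.
rewrite (evE X hx) (evE X hy) (evE X (n := n)); last first.
  by move=> k hk; rewrite derM hx // hy // mulr0 mul0r addr0.
rewrite mulr_suml mulr_sumr -big_split; apply: eq_bigr => k _.
by rewrite derM /=; ring.
Qed.

Lemma ev_cst X c : ev X (kcst c) = 0.
Proof. by rewrite (evE X (n := 0)) ?big_ord0 // => k _; rewrite der_cst. Qed.

Definition evo X : derivation kcst :=
  Derivation (evD X) (evM X) (ev_cst X).

Lemma ev_jv X k : evo X (jv k) = iter k D X.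
Proof.
rewrite /= (evE X (n := k.+1)); last first.
  by move=> i ki; rewrite pd_jv gtn_eqF.
rewrite big_ord_recr /= pd_jv eqxx mulr1 big1 ?add0r // => i _.
by rewrite pd_jv ltn_eqF ?mulr0.
Qed.

Lemma iterDD n X Y : iter n D (X + Y) = iter n D X + iter n D Y.
Proof. by elim: n => //= n ->; rewrite derD. Qed.

Lemma iterDZ n c X : iter n D (kcst c * X) = kcst c * iter n D X.
Proof. by elim: n => //= n ->; rewrite derM der_cst mul0r add0r. Qed.

Lemma evDl X Y x : evo (X + Y) x = evo X x + evo Y x.
Proof.
by rewrite /= /ev -big_split; apply: eq_bigr => k _; rewrite iterDD mulrDl.
Qed.

Lemma evZl c X x : evo (kcst c * X) x = kcst c * evo X x.
Proof.
by rewrite /= /ev mulr_sumr; apply: eq_bigr => k _; rewrite iterDZ mulrA.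
Qed.

Lemma ev0l x : evo 0 x = 0.
Proof. by have := evZl 0 0 x; rewrite rmorph0 !mul0r. Qed.

Lemma iter_jv n k : iter n D (jv k) = jv (n + k) :> A.
Proof.
have Djv j : D (jv j) = jv j.+1.
  rewrite (DtE (n := j.+1)); last by move=> i ki; rewrite pd_jv gtn_eqF.
  rewrite big_ord_recr /= pd_jv eqxx mulr1 big1 ?add0r // => i _.
  by rewrite pd_jv ltn_eqF ?mulr0.
by elim: n => //= n ->; rewrite Djv.
Qed.

Lemma ev_jv1 x : evo (jv 1) x = D x.
Proof.
rewrite /= (DtE (n := jord x)); last exact: jordP.
by apply: eq_bigr => k _; rewrite iter_jv addn1.
Qed.

Lemma pd0_D x : pd 0 (D x) = D (pd 0 x).
Proof.
have [n hn] := pd_bound [:: x].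
have hx k : (n <= k)%N -> pd k x = 0 by apply: hn; rewrite inE.
rewrite (DtE hx) (DtE (n := n)); last by move=> k hk; rewrite pdC hx // der0.
rewrite der_sum; apply: eq_bigr => k _.
by rewrite derM pd_jv mul0r add0r pdC.
Qed.

Lemma pdS_D x k : pd k.+1 (D x) = pd k x + D (pd k.+1 x).
Proof.
have [n hn] := pd_bound [:: x].
have hx j : (n + k.+1 <= j)%N -> pd j x = 0.
  by move=> h; apply: hn; rewrite ?inE // (leq_trans _ h) ?leq_addr.
rewrite (DtE hx) (DtE (n := n + k.+1)); last first.
  by move=> j hj; rewrite pdC hx // der0.
rewrite der_sum.
under eq_bigr do rewrite derM pd_jv pdC.
rewrite big_split; congr (_ + _).
have kn : (k < n + k.+1)%N by rewrite addnS ltnS leq_addl.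
rewrite (bigD1 (Ordinal kn)) //= eqxx mul1r big1 ?addr0 // => i.
rewrite -val_eqE /= eq_sym eqSS => /negPf ->; exact: mul0r.
Qed.

Lemma pdS_D_top k x : pd k.+1 x = 0 -> pd k.+1 (D x) = pd k x.
Proof. by move=> hx; rewrite pdS_D hx der0 addr0. Qed.

(** By [pdS_D] the commutator of the (k+1)-st partial derivative with [D] is the k-th one; these
    extra terms are those in which [D] falls on an iterated derivative of X. *)
Lemma ev_D X x : evo X (D x) = D (evo X x).
Proof.
have [n hn] := pd_bound [:: x].
have hx k : (n <= k)%N -> pd k x = 0 by apply: hn; rewrite inE.
have hDx k : (n.+1 <= k)%N -> pd k (D x) = 0.
  by case: k => // k hk; rewrite pdS_D !hx ?der0 ?addr0 // ltnW.
have hx' k : (n.+1 <= k)%N -> pd k x = 0 by move=> /ltnW/hx.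
rewrite /= (evE X hDx) (evE X hx') der_sum.
under [RHS]eq_bigr do rewrite derM.
rewrite big_split big_ord_recl [in RHS]big_ord_recr /= hx // mulr0 addr0.
rewrite pd0_D [X in _ = _ + X]big_ord_recl /= addrCA; congr (_ + _).
rewrite -big_split; apply: eq_bigr => k _.
by rewrite pdS_D mulrDr.
Qed.

Lemma ev_iterD X n x : evo X (iter n D x) = iter n D (evo X x).
Proof. by elim: n => // n /= <-; rewrite -ev_D. Qed.

(** The second-order parts of the two composites are double sums that agree because partial
    derivatives commute; only the first-order parts survive. *)
Lemma ev_comm X Y x :
  evo X (evo Y x) - evo Y (evo X x) = evo (evo X Y - evo Y X) x.
Proof.
have [n hn] := pd_bound [:: x].
have hx k : (n <= k)%N -> pd k x = 0 by apply: hn; rewrite inE.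
have main Z W : evo Z (evo W x) = evo (evo Z W) x +
    \sum_(i < n) \sum_(j < n) iter i D W * (iter j D Z * pd j (pd i x)).
  rewrite /= (evE W hx) (evE (ev Z W) hx) [ev Z (\sum__ _)](der_sum (evo Z)).
  rewrite -big_split; apply: eq_bigr => i _ /=.
  rewrite evM [ev Z (iter i D W)]ev_iterD; congr (_ + _).
  rewrite -mulr_sumr -(evE Z (n := n)) // => k hk.
  by rewrite pdC hx // der0.
have -> : evo X (evo Y x) = evo (evo X Y - evo Y X + evo Y X) x +
    \sum_(i < n) \sum_(j < n) iter i D X * (iter j D Y * pd j (pd i x)).
  rewrite subrK main; congr (_ + _); rewrite exchange_big /=.
  by apply: eq_bigr => i _; apply: eq_bigr => j _; rewrite pdC mulrCA.
by rewrite (main Y X) evDl; ring.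
Qed.

End Evolution.

(** * Normalization of differential polynomials *)

(* Reflective normalization of differential polynomials.  The variable [(i, k)]
   stands for the k-th derivative of the i-th entry of an environment, [rules]
   lists known derivatives of variables, and [invs] lists pairs of mutually
   inverse variables. *)
Inductive dexpr :=
| DVar of nat & nat
| DNat of nat
| DAdd of dexpr & dexpr
| DMul of dexpr & dexpr
| DOpp of dexpr
| DExp of dexpr & nat
| DDer of dexpr.

Definition dmono := seq (nat * nat).
Definition dpoly := seq (BinNums.Z * dmono).

Section Normalization.
Variable invs : seq ((nat * nat) * (nat * nat)).

Fixpoint partner (v : nat * nat) (s : seq ((nat * nat) * (nat * nat))) :=
  if s is (a, b) :: s' then
    if v == a then Some b else if v == b then Some a else partner v s'
  else None.

Fixpoint insort (v : nat * nat) (m : dmono) : dmono :=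
  if m is w :: m' then
    if (v.1 < w.1)%N || ((v.1 == w.1) && (v.2 <= w.2)%N) then v :: m
    else w :: insort v m'
  else [:: v].

Definition mono_insert v m :=
  if partner v invs is Some w then
    if w \in m then rem w m else insort v m
  else insort v m.

Definition mono_mul (m1 m2 : dmono) : dmono := foldr mono_insert m2 m1.

Fixpoint poly_insert (c : BinNums.Z) (m : dmono) (p : dpoly) : dpoly :=
  if p is (c', m') :: p' then
    if m == m' then
      let e := BinInt.Z.add c c' in if BinInt.Z.eqb e BinNums.Z0 then p' else (e, m) :: p'
    else (c', m') :: poly_insert c m p'
  else if BinInt.Z.eqb c BinNums.Z0 then [::] else [:: (c, m)].

Definition poly_add (p q : dpoly) : dpoly :=
  foldr (fun t r => poly_insert t.1 t.2 r) q p.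

Definition poly_scale c m (p : dpoly) : dpoly :=
  foldr (fun t r => poly_insert (BinInt.Z.mul c t.1) (mono_mul m t.2) r) [::] p.

Definition poly_mul (p q : dpoly) : dpoly :=
  foldr (fun t r => poly_add (poly_scale t.1 t.2 q) r) [::] p.

Definition poly_exp (p : dpoly) n := iter n (poly_mul p) [:: (BinNums.Zpos BinNums.xH, [::])].

Arguments poly_add : simpl never.
Arguments poly_scale : simpl never.
Arguments poly_mul : simpl never.

Section Derivative.
Variable dv : nat * nat -> dpoly.

Fixpoint mono_der (m : dmono) : dpoly :=
  if m is v :: m' then
    poly_add (poly_mul (dv v) [:: (BinNums.Zpos BinNums.xH, m')])
             (poly_mul [:: (BinNums.Zpos BinNums.xH, [:: v])] (mono_der m'))
  else [::].

Definition poly_der (p : dpoly) : dpoly :=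
  foldr (fun t r => poly_add (poly_scale t.1 [::] (mono_der t.2)) r) [::] p.

Fixpoint normalize (e : dexpr) : dpoly :=
  match e with
  | DVar i k => [:: (BinNums.Zpos BinNums.xH, [:: (i, k)])]
  | DNat n => [:: (BinInt.Z.of_nat n, [::])]
  | DAdd a b => poly_add (normalize a) (normalize b)
  | DMul a b => poly_mul (normalize a) (normalize b)
  | DOpp a => poly_scale (BinNums.Zneg BinNums.xH) [::] (normalize a)
  | DExp a n => poly_exp (normalize a) n
  | DDer a => poly_der (normalize a)
  end.

End Derivative.

Definition free_der (v : nat * nat) : dpoly := [:: (BinNums.Zpos BinNums.xH, [:: (v.1, v.2.+1)])].

(** Right-hand sides are normalized with [free_der]: no rule is applied inside a rule, so the
    recursion is structural, and rules should be given in reduced form. *)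
Fixpoint rule_der (rules : seq ((nat * nat) * dexpr)) (v : nat * nat) : dpoly :=
  if rules is (w, e) :: rules' then
    if v == w then normalize free_der e else rule_der rules' v
  else free_der v.

Context {K : fieldType} {A : comPzRingType} {kcst : {rmorphism K -> A}}.
Variables (D : derivation kcst) (env : seq A).

Definition var_eval (v : nat * nat) : A := iter v.2 D (nth 0 env v.1).

Fixpoint dexpr_eval (e : dexpr) : A :=
  match e with
  | DVar i k => var_eval (i, k)
  | DNat n => n%:R
  | DAdd a b => dexpr_eval a + dexpr_eval b
  | DMul a b => dexpr_eval a * dexpr_eval b
  | DOpp a => - dexpr_eval a
  | DExp a n => dexpr_eval a ^+ n
  | DDer a => D (dexpr_eval a)
  end.

Fixpoint invs_valid (s : seq ((nat * nat) * (nat * nat))) : Prop :=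
  if s is (a, b) :: s' then var_eval a * var_eval b = 1 /\ invs_valid s' else True.

Fixpoint rules_valid (s : seq ((nat * nat) * dexpr)) : Prop :=
  if s is (v, e) :: s' then D (var_eval v) = dexpr_eval e /\ rules_valid s' else True.

Hypothesis invsP : invs_valid invs.

Definition coef_eval (c : BinNums.Z) : A := (int_of_Z c)%:~R.

Definition mono_eval (m : dmono) : A := \prod_(v <- m) var_eval v.

Definition poly_eval (p : dpoly) : A := \sum_(t <- p) coef_eval t.1 * mono_eval t.2.

Lemma coef_evalD b c : coef_eval (BinInt.Z.add b c) = coef_eval b + coef_eval c.
Proof. by rewrite /coef_eval -[BinInt.Z.add b c]/(b + c) !rmorphD. Qed.

Lemma coef_evalM b c : coef_eval (BinInt.Z.mul b c) = coef_eval b * coef_eval c.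
Proof. by rewrite /coef_eval -[BinInt.Z.mul b c]/(b * c) !rmorphM. Qed.

Lemma insort_eval v m : mono_eval (insort v m) = var_eval v * mono_eval m.
Proof.
elim: m => [|w m IHm] /=; first by rewrite /mono_eval big_cons.
case: ifP => _; first by rewrite /mono_eval big_cons.
by rewrite /mono_eval big_cons -/(mono_eval _) IHm big_cons mulrCA.
Qed.

Lemma mono_insert_eval v m : mono_eval (mono_insert v m) = var_eval v * mono_eval m.
Proof.
have pP w : partner v invs = Some w -> var_eval v * var_eval w = 1.
  elim: invs invsP => //= [[a b] s] IHs [ab /IHs h].
  by case: eqP => [-> [<-]//|_]; case: eqP => [-> [<-]|_ //]; rewrite mulrC.
rewrite /mono_insert; case: partner pP => [w /(_ w erefl) vw|_].
  case: ifP => wm; last exact: insort_eval.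
  by rewrite [in RHS]/mono_eval (big_rem w) //= mulrA vw mul1r.
exact: insort_eval.
Qed.

Lemma mono_mul_eval m1 m2 : mono_eval (mono_mul m1 m2) = mono_eval m1 * mono_eval m2.
Proof.
elim: m1 => [|v m IHm] /=; first by rewrite /mono_eval big_nil mul1r.
by rewrite mono_insert_eval IHm [mono_eval (v :: m)]/mono_eval big_cons mulrA.
Qed.

Lemma poly_eval_cons c m p : poly_eval ((c, m) :: p) = coef_eval c * mono_eval m + poly_eval p.
Proof. by rewrite /poly_eval big_cons. Qed.

Lemma poly_eval0 : poly_eval [::] = 0.
Proof. by rewrite /poly_eval big_nil. Qed.

Lemma poly_insert_eval c m p :
  poly_eval (poly_insert c m p) = coef_eval c * mono_eval m + poly_eval p.
Proof.
elim: p => [|[c' m'] p IHp] /=.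
  case: BinInt.Z.eqb_spec => [->|_]; last by rewrite poly_eval_cons.
  by rewrite /coef_eval rmorph0 mul0r add0r.
case: eqP => [->|_]; last by rewrite !poly_eval_cons IHp addrCA.
rewrite poly_eval_cons addrA -mulrDl -coef_evalD.
case: BinInt.Z.eqb_spec => [->|_]; last by rewrite poly_eval_cons.
by rewrite /coef_eval rmorph0 mul0r add0r.
Qed.

Lemma poly_add_eval p q : poly_eval (poly_add p q) = poly_eval p + poly_eval q.
Proof.
elim: p => [|[c m] p IHp]; first by rewrite poly_eval0 add0r.
by rewrite /poly_add /= -/(poly_add _ _) poly_insert_eval IHp poly_eval_cons addrA.
Qed.

Lemma poly_scale_eval c m p :
  poly_eval (poly_scale c m p) = coef_eval c * mono_eval m * poly_eval p.
Proof.
elim: p => [|[c' m'] p IHp]; first by rewrite poly_eval0 mulr0.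
rewrite /poly_scale /= -/(poly_scale _ _ _) poly_insert_eval IHp poly_eval_cons.
rewrite coef_evalM mono_mul_eval.
by ring.
Qed.

Lemma poly_mul_eval p q : poly_eval (poly_mul p q) = poly_eval p * poly_eval q.
Proof.
elim: p => [|[c m] p IHp]; first by rewrite poly_eval0 mul0r.
by rewrite /poly_mul /= -/(poly_mul _ _) poly_add_eval poly_scale_eval IHp poly_eval_cons mulrDl.
Qed.

Lemma mono_eval0 : mono_eval [::] = 1.
Proof. by rewrite /mono_eval big_nil. Qed.

Lemma coef_eval1 : coef_eval (BinNums.Zpos BinNums.xH) = 1.
Proof. by []. Qed.

Lemma coef_evalN1 : coef_eval (BinNums.Zneg BinNums.xH) = -1.
Proof. by []. Qed.

Lemma coef_eval_nat n : coef_eval (BinInt.Z.of_nat n) = n%:R.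
Proof.
rewrite /coef_eval; have -> : int_of_Z (BinInt.Z.of_nat n) = n%:Z by lia.
by rewrite -pmulrn.
Qed.

Lemma D_coef c : D (coef_eval c) = 0.
Proof. by rewrite /coef_eval -(rmorph_int kcst) der_cst. Qed.

Lemma poly_der_eval dv : (forall v, poly_eval (dv v) = D (var_eval v)) ->
  forall p, poly_eval (poly_der dv p) = D (poly_eval p).
Proof.
move=> dvP; have mP m : poly_eval (mono_der dv m) = D (mono_eval m).
  elim: m => [|v m IHm] /=; first by rewrite poly_eval0 mono_eval0 der1.
  rewrite poly_add_eval !poly_mul_eval !poly_eval_cons !poly_eval0 !coef_eval1.
  by rewrite IHm dvP /mono_eval !big_cons big_nil derM; ring.
elim=> [|[c m] p IHp] /=; first by rewrite poly_eval0 der0.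
rewrite poly_add_eval poly_scale_eval IHp poly_eval_cons derD derM D_coef mP mono_eval0.
by ring.
Qed.

Lemma normalizeP dv : (forall v, poly_eval (dv v) = D (var_eval v)) ->
  forall e, poly_eval (normalize dv e) = dexpr_eval e.
Proof.
move=> dvP; elim=> [i k|n|a IHa b IHb|a IHa b IHb|a IHa|a IHa n|a IHa] /=.
- by rewrite poly_eval_cons poly_eval0 /mono_eval big_cons big_nil coef_eval1; ring.
- by rewrite poly_eval_cons poly_eval0 mono_eval0 coef_eval_nat; ring.
- by rewrite poly_add_eval IHa IHb.
- by rewrite poly_mul_eval IHa IHb.
- by rewrite poly_scale_eval IHa mono_eval0 coef_evalN1; ring.
- elim: n => [|n IHn] /=.
    by rewrite poly_eval_cons poly_eval0 mono_eval0 coef_eval1 expr0; ring.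
  by rewrite exprS -IHn poly_mul_eval IHa.
- by rewrite poly_der_eval // IHa.
Qed.

Lemma diff_poly_eq rules e1 e2 : rules_valid rules ->
  normalize (rule_der rules) (DAdd e1 (DOpp e2)) = [::] -> dexpr_eval e1 = dexpr_eval e2.
Proof.
move=> rP h; apply/eqP; rewrite -subr_eq0 -[_ - _]/(dexpr_eval (DAdd e1 (DOpp e2))).
rewrite -(@normalizeP (rule_der rules)) ?h ?poly_eval0 // => v {h}.
have fP w : poly_eval (free_der w) = D (var_eval w).
  by rewrite poly_eval_cons poly_eval0 /mono_eval big_cons big_nil coef_eval1 /=;
    rewrite /var_eval /=; ring.
elim: rules rP => [_|[w e] rules IHr /= [wE /IHr h]] //=.
by case: eqP => // ->; rewrite normalizeP.
Qed.

End Normalization.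

Ltac dp_index x env :=
  lazymatch env with
  | x :: _ => constr:(O)
  | _ :: ?env' => let n := dp_index x env' in constr:(S n)
  end.

Ltac dp_reify D env t :=
  lazymatch t with
  | @GRing.add _ ?a ?b =>
      let a' := dp_reify D env a in let b' := dp_reify D env b in constr:(DAdd a' b')
  | @GRing.mul _ ?a ?b =>
      let a' := dp_reify D env a in let b' := dp_reify D env b in constr:(DMul a' b')
  | @GRing.opp _ ?a => let a' := dp_reify D env a in constr:(DOpp a')
  | @GRing.exp _ ?a ?n => let a' := dp_reify D env a in constr:(DExp a' n)
  | @GRing.natmul _ (@GRing.one _) ?n => constr:(DNat n)
  | @GRing.one _ => constr:(DNat 1)
  | @GRing.zero _ => constr:(DNat 0)
  | @der _ _ _ _ ?a => let a' := dp_reify D env a in constr:(DDer a')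
  | _ => let i := dp_index t env in constr:(DVar i 0)
  end.

Ltac dp_var e :=
  lazymatch e with
  | DVar ?i ?k => constr:((i, k))
  | DDer ?e' => lazymatch dp_var e' with (?i, ?k) => constr:((i, S k)) end
  end.

Ltac dp_rules D env hs :=
  lazymatch hs with
  | (?hs', ?h) =>
    let rs := dp_rules D env hs' in
    lazymatch type of h with
    | @der _ _ _ _ ?x = ?y =>
      let v := dp_reify D env x in let v := dp_var v in
      let e := dp_reify D env y in constr:((v, e) :: rs)
    end
  | tt => constr:(@nil ((nat * nat) * dexpr))
  end.

Ltac dp_invs D env hs :=
  lazymatch hs with
  | (?hs', ?h) =>
    let rs := dp_invs D env hs' in
    lazymatch type of h with
    | @GRing.mul _ ?x ?y = _ =>
      let v := dp_reify D env x in let v := dp_var v in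
      let w := dp_reify D env y in let w := dp_var w in constr:((v, w) :: rs)
    end
  | tt => constr:(@nil ((nat * nat) * (nat * nat)))
  end.

Ltac dp_conj hs :=
  lazymatch hs with
  | (?hs', ?h) => let p := dp_conj hs' in constr:(conj h p)
  | tt => constr:(I)
  end.

(* [diff_ring D env invs rules] proves by computation an identity between
   differential polynomials in the entries of [env]; [rules] and [invs] are
   tuples [(tt, h1, ..., hn)] of hypotheses [D x = e], respectively [x * y = 1]. *)
Ltac diff_ring D env invs rules :=
  lazymatch goal with
  | |- ?l = ?r =>
    let l' := dp_reify D env l in let r' := dp_reify D env r in
    let rs := dp_rules D env rules in let ivs := dp_invs D env invs in
    let pr := dp_conj rules in let pi := dp_conj invs in
    let envl := env in
    refine (@diff_poly_eq ivs _ _ _ D envl pi rs l' r' pr _);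
    vm_compute; reflexivity
  end.

(** * Exact and closed forms *)

Section Exactness.
Context {K : numFieldType} {A : jetAlgebra K}.
Implicit Types (x y z X Y Z m : A) (n k : nat) (c : K) (E F : A -> A).

Local Notation D := (@Dt K A).

Definition exact_form x := exists w, x = D w.

Lemma exact_D w : exact_form (D w). Proof. by exists w. Qed.

Lemma exact0 : exact_form 0. Proof. by exists 0; rewrite der0. Qed.

Lemma exactD x y : exact_form x -> exact_form y -> exact_form (x + y).
Proof. by move=> [v ->] [w ->]; exists (v + w); rewrite derD. Qed.

Lemma exactN x : exact_form x -> exact_form (- x).
Proof. by move=> [w ->]; exists (- w); rewrite derN. Qed.

Lemma exactB x y : exact_form x -> exact_form y -> exact_form (x - y).
Proof. by move=> hx hy; apply: exactD => //; apply: exactN. Qed.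

Lemma exactZ c x : exact_form x -> exact_form (kcst c * x).
Proof.
by move=> [w ->]; exists (kcst c * w); rewrite derM der_cst mul0r add0r.
Qed.

Lemma halfK x : kcst 2^-1 * (2 * x) = x.
Proof.
by rewrite mulrA -(rmorph_nat kcst) -rmorphM mulVf ?pnatr_eq0 // rmorph1 mul1r.
Qed.

Lemma exact_double x : exact_form (2 * x) -> exact_form x.
Proof. by move=> /(exactZ 2^-1); rewrite halfK. Qed.

Lemma exact_sum n (F : 'I_n -> A) :
  (forall i, exact_form (F i)) -> exact_form (\sum_(i < n) F i).
Proof.
by move=> h; elim/big_ind: _ => //; [exact: exact0|exact: exactD].
Qed.

Lemma exact_ev X x : exact_form x -> exact_form (evo X x).
Proof. by move=> [w ->]; exists (evo X w); rewrite ev_D. Qed.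

Definition negD x := - D x.

(** The adjoint of the Frechet derivative of x, applied to Y; for Y = 1 it is the variational
    derivative of x. *)
Definition adj x Y := \sum_(k < jord x) iter k negD (pd k x * Y).

Lemma adjE x Y n : (forall k, (n <= k)%N -> pd k x = 0) ->
  adj x Y = \sum_(k < n) iter k negD (pd k x * Y).
Proof.
have it0 k : iter k negD 0 = 0 by elim: k => //= k ->; rewrite /negD der0 oppr0.
move=> h; apply: (sum_pd_widen (F := fun k => iter k negD (pd k x * Y))) => k hk.
  by rewrite jordP // mul0r it0.
by rewrite h // mul0r it0.
Qed.

Lemma iter_by_parts k z X :
  exact_form (z * iter k D X - X * iter k negD z).
Proof.
elim: k z X => [|k IHk] z X; first by rewrite mulrC subrr; exact: exact0.
have := exactD (IHk (negD z) X) (exact_D (z * iter k D X)).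
by congr exact_form; rewrite derM -iterSr -iterS [negD z * _]mulNr; ring.
Qed.

Lemma ev_by_parts x X Y : exact_form (Y * evo X x - X * adj x Y).
Proof.
rewrite /= /ev /adj !mulr_sumr -sumrB; apply: exact_sum => k.
have := iter_by_parts k (pd k x * Y) X.
by congr exact_form; ring.
Qed.

(** Zero divisors may exist, but nilpotents do not, since the evaluations into the field separate
    elements. *)
Lemma square_eq0 x : x * x = 0 -> x = 0.
Proof.
move=> xx0; apply: (@at_pt_inj _ A) => t; rewrite rmorph0.
by have /eqP := congr1 (at_pt t) xx0; rewrite rmorphM rmorph0 mulf_eq0 orbb => /eqP.
Qed.

(** One test function is enough. If Z is independent of u_k for k >= n and u_(n+1)^2 Z = D W, a
    downward induction shows that W is independent of u_k for k > n. Then D W is affine in u_(n+1),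
    while the second derivative of the left side in u_(n+1) is 2 Z. *)
Lemma exact_nondegenerate Z : (forall q, exact_form (q * Z)) -> Z = 0.
Proof.
move=> h; have [n hn] := pd_bound [:: Z].
have hZ k : (n <= k)%N -> pd k Z = 0 by apply: hn; rewrite inE.
have [W hW] := h (jv n.+1 ^+ 2).
have WE k : (n < k)%N -> pd k W = 0.
  have [m hm] := pd_bound [:: W].
  have hW0 j : (m <= j)%N -> pd j W = 0 by apply: hm; rewrite inE.
  move=> nk; case: (leqP m k) => [|km]; first exact: hW0.
  have [d dE] : exists d, (k + d)%N = m by exists (m - k)%N; rewrite subnKC // ltnW.
  elim: d k nk km dE => [|d IHd] k nk km dE; first by rewrite addn0 in dE; rewrite hW0 // dE.
  have pk : pd k.+1 W = 0.
    case: (ltnP k.+1 m) => [lt_km|]; last exact: hW0.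
    by apply: (IHd k.+1) => //; [rewrite (ltn_trans nk)|rewrite addSnnS].
  have := congr1 (pd k.+1) hW; rewrite pdS_D pk der0 addr0 derM derX pd_jv.
  rewrite (hZ k.+1); last by rewrite (leq_trans (ltnW nk)).
  by rewrite eqSS gtn_eqF // !mulr0 mul0r addr0 => <-.
have := congr1 (pd n.+1) hW; rewrite pdS_D (WE n.+1) // der0 addr0 derM derX pd_jv eqxx.
rewrite (hZ n.+1) // mulr0 addr0 => /(congr1 (pd n.+1)).
rewrite pdC (WE n.+1) // der0 !(derE, pd_jv) eqxx (hZ n.+1) // => E.
have E2 : 2%:R * Z = 0 by rewrite -[RHS]E /=; ring.
by rewrite -[Z]halfK E2 mulr0.
Qed.

Definition is_closed x := forall X, evo X x = adj x X.

(** Integration by parts and nondegeneracy turn self-adjointness into a bilinear condition modulo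
    total derivatives, in which no adjoint has to be computed. *)
Lemma is_closedP x :
  is_closed x <-> forall X Y, exact_form (Y * evo X x - X * evo Y x).
Proof.
split=> [h X Y|h X].
  by rewrite (h Y); exact: ev_by_parts.
apply/eqP; rewrite -subr_eq0; apply/eqP; apply: exact_nondegenerate => Y.
have := exactD (h X Y) (ev_by_parts x Y X).
by congr exact_form; ring.
Qed.

(** The order is less than n, so that [diffop 0] contains the zero operator only. *)
Definition diffop n E := exists b : nat -> A,
  forall X, E X = \sum_(i < n) b i * iter i D X.

Lemma diffop0 n : diffop n (fun=> 0).
Proof. by exists (fun=> 0) => X; rewrite big1 // => i _; rewrite mul0r. Qed.

Lemma diffopD n E F : diffop n E -> diffop n F -> diffop n (fun X => E X + F X).
Proof.
move=> [b hb] [d hd]; exists (fun i => b i + d i) => X.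
by rewrite hb hd -big_split; apply: eq_bigr => i _; rewrite mulrDl.
Qed.

Lemma diffopM n E m : diffop n E -> diffop n (fun X => m * E X).
Proof.
move=> [b hb]; exists (fun i => m * b i) => X.
by rewrite hb mulr_sumr; apply: eq_bigr => i _; rewrite mulrA.
Qed.

Lemma eq_diffop n E F : E =1 F -> diffop n E -> diffop n F.
Proof. by move=> EF [b hb]; exists b => X; rewrite -EF. Qed.

Lemma diffop_widen n k E : (n <= k)%N -> diffop n E -> diffop k E.
Proof.
move=> nk [b hb]; exists (fun i => if (i < n)%N then b i else 0) => X.
rewrite hb -(subnKC nk) big_split_ord /= [X in _ + X]big1 ?addr0.
  by apply: eq_bigr => i _; rewrite ltn_ord.
by move=> i _; rewrite ltnNge leq_addr mul0r.
Qed.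

Lemma diffop_iter k : diffop k.+1 (iter k D).
Proof.
exists (fun i => (i == k)%:R) => X.
rewrite big_ord_recr /= eqxx mul1r big1 ?add0r // => i _.
by rewrite ltn_eqF ?mul0r.
Qed.

Lemma diffop_sum n k (F : nat -> A -> A) : (forall i, (i < n)%N -> diffop k (F i)) ->
  diffop k (fun X => \sum_(i < n) F i X).
Proof.
elim: n => [|n IHn] h.
  by apply: eq_diffop (diffop0 k) => X; rewrite big_ord0.
apply: (eq_diffop (E := fun X => \sum_(i < n) F i X + F n X)) => [X|].
  by rewrite big_ord_recr.
by apply: diffopD; [apply: IHn => i /ltnW; apply: h|apply: h].
Qed.

Lemma diffop_Dt n E : diffop n E -> diffop n.+1 (fun X => D (E X)).
Proof.
move=> [b hb].
apply: (eq_diffop (E := fun X => \sum_(i < n) (D (b i) * iter i D X + b i * iter i.+1 D X))).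
  by move=> X; rewrite hb der_sum; apply: eq_bigr => i _; rewrite derM.
apply: (diffop_sum (F := fun i X => D (b i) * iter i D X + b i * iter i.+1 D X)) => i lt_in.
apply: diffopD; apply: diffopM; last exact: diffop_widen (diffop_iter i.+1).
by apply: diffop_widen (diffop_iter i); rewrite ltnS ltnW.
Qed.

Lemma diffop_iterDt k n E : diffop n E -> diffop (k + n) (fun X => iter k D (E X)).
Proof. by move=> hE; elim: k => //= k; exact: diffop_Dt. Qed.

Lemma diffop_comp n k E F :
  diffop n E -> diffop k.+1 F -> diffop (n + k) (fun X => E (F X)).
Proof.
move=> [b hb] hF.
apply: (eq_diffop (E := fun X => \sum_(i < n) b i * iter i D (F X))) => // .
apply: (diffop_sum (F := fun i X => b i * iter i D (F X))) => i lt_in.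
apply: diffopM; apply: diffop_widen (diffop_iterDt i hF).
by rewrite addnS -addSn leq_add2r.
Qed.

Definition leading n m E := diffop n (fun X => E X - m * iter n D X).

Lemma leading_diffop n m E : leading n m E -> diffop n.+1 E.
Proof.
move=> h.
apply: (eq_diffop (E := fun X => (E X - m * iter n D X) + m * iter n D X)).
  by move=> X; rewrite subrK.
apply: diffopD; first exact: diffop_widen h.
by apply: diffopM; exact: diffop_iter.
Qed.

Lemma leading_iter k n m E : leading n m E -> leading (k + n) m (fun X => iter k D (E X)).
Proof.
elim: k => // k IHk hE; have := diffop_Dt (IHk hE) => h.
apply: (eq_diffop (E := fun X =>
  D (iter k D (E X) - m * iter (k + n) D X) + D m * iter (k + n) D X)).
  by move=> X; rewrite /= derB derM; ring.
by apply: diffopD => //; apply: diffopM; exact: diffop_iter.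
Qed.

Lemma leading_comp n k m m' E F :
  leading n m E -> leading k m' F -> leading (n + k) (m * m') (fun X => E (F X)).
Proof.
move=> hE hF.
apply: (eq_diffop (E := fun X => (E (F X) - m * iter n D (F X)) +
   m * (iter n D (F X) - m' * iter (n + k) D X))); first by move=> X; ring.
apply: diffopD; first exact: (diffop_comp hE (leading_diffop hF)).
by apply: diffopM; exact: leading_iter.
Qed.

(** Apply E to u_N with N beyond the order of all coefficients: the derivative of the result in
    u_(n+N) isolates m. *)
Lemma leading_eq0 n m E : leading n m E -> (forall X, E X = 0) -> m = 0.
Proof.
move=> [b hb] E0; have [N hN] := pd_bound (m :: [seq b i | i <- iota 0 n]).
have := hb (jv N); rewrite E0 sub0r => /(congr1 (pd (n + N))).
rewrite derN derM iter_jv pd_jv eqxx mulr1 (hN m) ?inE ?eqxx ?leq_addl //.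
rewrite mul0r add0r der_sum big1 => [/eqP|i _]; first by rewrite oppr_eq0 => /eqP.
rewrite derM iter_jv pd_jv eqn_add2r gtn_eqF // mulr0 addr0 (hN (b i)) ?leq_addl ?mul0r //.
by rewrite inE map_f ?orbT // mem_iota /=.
Qed.

Definition nonzerodiv m := forall x, m * x = 0 -> x = 0.

Lemma nonzerodivM m m' : nonzerodiv m -> nonzerodiv m' -> nonzerodiv (m * m').
Proof. by move=> h h' x; rewrite -mulrA => /h/h'. Qed.

Lemma nonzerodivN m : nonzerodiv m -> nonzerodiv (- m).
Proof. by move=> h x; rewrite mulNr => /eqP; rewrite oppr_eq0 => /eqP/h. Qed.

Lemma nonzerodiv_unit m m' : m * m' = 1 -> nonzerodiv m.
Proof. by move=> h x mx0; rewrite -[x]mul1r -h mulrAC mx0 mul0r. Qed.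

(** Differentiating m x = 0 and multiplying by x leaves [pd k m] times x^2; there are no
    nilpotents. *)
Lemma nonzerodiv_pd k m : nonzerodiv (pd k m) -> nonzerodiv m.
Proof.
move=> h x mx0; apply/square_eq0/h.
have := congr1 (pd k) mx0; rewrite derM der0 => /(congr1 (fun y => y * x)).
by rewrite mulrDl mul0r [m * _ * x]mulrAC mx0 mul0r addr0 mulrA.
Qed.

(** Let N be the Frechet derivative of x minus its adjoint. The hypotheses give E' N E = 0. The
    leading coefficient of this operator is that of N times m' and m, which can be cancelled, so the
    order of N can be lowered until N vanishes. *)
Lemma closed_test x k k' m m' E E' :
  leading k m E -> nonzerodiv m -> leading k' m' E' -> nonzerodiv m' ->
  (forall q Z, exact_form (E q * Z - q * E' Z)) ->
  (forall q r, exact_form (E q * evo (E r) x - E r * evo (E q) x)) ->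
  is_closed x.
Proof.
move=> lE nm lE' nm' EE' h.
pose N X := evo X x - adj x X.
have ENE0 r : E' (N (E r)) = 0.
  apply: exact_nondegenerate => q.
  have := exactB (exactD (h q r) (ev_by_parts x (E q) (E r))) (EE' q (N (E r))).
  by congr exact_form; rewrite /N; ring.
have opN : diffop (jord x) N.
  have opneg i z : diffop i.+1 (fun X => iter i negD (z * X)).
    elim: i => [|i IHi] /=; first by apply: diffopM; exact: (diffop_iter 0).
    apply: (eq_diffop (E := fun X => -1 * D (iter i negD (z * X)))).
      by move=> X; rewrite mulN1r.
    by apply: diffopM; exact: diffop_Dt.
  apply: (eq_diffop (E := fun X => \sum_(i < jord x)
      (pd i x * iter i D X + -1 * iter i negD (pd i x * X)))).
    move=> X; rewrite /N /= /ev /adj -sumrB; apply: eq_bigr => i _.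
    by ring.
  apply: (diffop_sum (F := fun i X =>
      pd i x * iter i D X + -1 * iter i negD (pd i x * X))) => i lt_ix.
  apply: diffopD; apply: diffopM.
    by apply: diffop_widen (diffop_iter i).
  by apply: diffop_widen (opneg i _).
suff N0 n : diffop n N -> forall X, N X = 0.
  by move=> X; apply/eqP; rewrite -subr_eq0; apply/eqP; apply: N0 opN X.
elim: n => [[b hb] X|n IHn [b hb]]; first by rewrite hb big_ord0.
have lN : leading n (b n) N.
  exists b => X; rewrite hb big_ord_recr /=; ring.
have bn0 : b n = 0.
  have /nm' := leading_eq0 (leading_comp lE' (leading_comp lN lE)) ENE0.
  by rewrite mulrC => /nm.
apply: IHn; move: lN; rewrite bn0; apply: eq_diffop => X; ring.
Qed.

(* [fun q => m * D q + 2 * D m * q] is chosen so that m times it is D (m^2 q). *)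
Definition conj_op m X := m * D X + 2 * D m * X.
Definition conj_op_adj m X := D m * X - m * D X.

Lemma leading_conj_op m : leading 1 m (conj_op m).
Proof.
by exists (fun=> 2 * D m) => X; rewrite big_ord1 /conj_op /=; ring.
Qed.

Lemma leading_conj_op_adj m : leading 1 (- m) (conj_op_adj m).
Proof.
by exists (fun=> D m) => X; rewrite big_ord1 /conj_op_adj /=; ring.
Qed.

Lemma conj_op_by_parts m q Z :
  exact_form (conj_op m q * Z - q * conj_op_adj m Z).
Proof.
by exists (m * q * Z); rewrite !derM /conj_op /conj_op_adj; ring.
Qed.

Lemma conj_opE m q : m * conj_op m q = D (m ^+ 2 * q).
Proof. by rewrite !derE /conj_op; ring. Qed.

End Exactness.

(** * Hamiltonian operators and the Lenard scheme *)

Section HamiltonianOperator.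
Context {K : numFieldType} {A : jetAlgebra K}.
Variables a f g : A.
Implicit Types (x y z X Y Z : A).

Local Notation D := (@Dt K A).

(** The primitives are data of the argument, which makes [Hop] a function: all choices of
    integration constants become choices of covectors over the same form. *)
Record covector := Covector {
  cx : A;
  cpf : A;
  cpg : A;
  cpfE : D cpf = f * cx;
  cpgE : D cpg = g * cx }.

Implicit Types c d e : covector.

(* The operator [2 a D + D a - f D^-1 g - g D^-1 f]. *)
Definition Hop c := 2 * a * D (cx c) + D a * cx c - f * cpg c - g * cpf c.

(* Modulo total derivatives, [d] times the variation of the operator along X,
   applied to [c]. *)
Definition trilin X c d :=
  evo X a * (D (cx c) * cx d - cx c * D (cx d))
  - evo X f * (cpg c * cx d - cpg d * cx c)
  - evo X g * (cpf c * cx d - cpf d * cx c).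

(** The part of the variation of [Hop c] in which only the coefficients a, f, g of the operator
    vary; see [ev_Hop]. *)
Definition var_op X c :=
  2 * evo X a * D (cx c) + D (evo X a) * cx c - evo X f * cpg c - evo X g * cpf c.

(* The condition that the operator is Hamiltonian, written so that the bracket
   of two flows [Hop c], [Hop d] is visibly [Hop] of a form [k]: [k] represents
   [trilin _ c d], and [kf], [kg] are the potentials that it should have. *)
Definition hamiltonian := forall c d, exists k kf kg : A,
  [/\ forall X, exact_form (X * k - trilin X c d),
      D kf = evo (Hop c) f * cx d - evo (Hop d) f * cx c - f * k,
      D kg = evo (Hop c) g * cx d - evo (Hop d) g * cx c - g * k
    & var_op (Hop c) d - var_op (Hop d) c = 2 * a * D k + D a * k + f * kg + g * kf].

Definition compatible := forall X Y Z c d e,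
  cx c = D X -> cx d = D Y -> cx e = D Z ->
  exact_form (trilin X d e + trilin Y e c + trilin Z c d).

(** All three operators have coefficients whose variations have this shape. After one integration by
    parts of the terms with kf and kg, the cyclic sum consists of determinants in the columns X, Y,
    Z with a repeated row. *)
Lemma compatible_second_order (a1 a2 kf lf kg lg : A) :
  (forall X, evo X a = a1 * D X + a2 * D (D X)) ->
  (forall X, evo X f = D (kf * D (D X)) + lf * D X) ->
  (forall X, evo X g = D (kg * D (D X)) + lg * D X) ->
  compatible.
Proof.
move=> ea ef eg X Y Z [xi p q pE qE] [eta p' q' pE' qE'] [zeta p2 q2 pE2 qE2] /=.
move=> hx hy hz; rewrite hx in pE qE *; rewrite hy in pE' qE' *.
rewrite hz in pE2 qE2 *; rewrite /trilin !ea !ef !eg /=.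
exists (- (kf * (D (D X) * (q' * D Z - q2 * D Y) + D (D Y) * (q2 * D X - q * D Z)
     + D (D Z) * (q * D Y - q' * D X)))
  - kg * (D (D X) * (p' * D Z - p2 * D Y) + D (D Y) * (p2 * D X - p * D Z)
     + D (D Z) * (p * D Y - p' * D X))).
by rewrite !derE pE qE pE' qE' pE2 qE2; ring.
Qed.

Lemma trilinC X c d : trilin X c d = - trilin X d c.
Proof. by rewrite /trilin; ring. Qed.

Lemma Hop_skew c d : exact_form (cx c * Hop d + cx d * Hop c).
Proof.
exists (2 * a * cx c * cx d - cpf c * cpg d - cpg c * cpf d).
by rewrite /Hop !derE !cpfE !cpgE; ring.
Qed.

Lemma exact_form_Hop c : exact_form (cx c * Hop c).
Proof.
by apply: exact_double; have := Hop_skew c c; congr exact_form; ring.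
Qed.

Lemma ev_Hop X c : evo X (Hop c) = 2 * a * D (evo X (cx c)) + D a * evo X (cx c)
  - f * evo X (cpg c) - g * evo X (cpf c) + var_op X c.
Proof. by rewrite /Hop !derE !ev_D /var_op; ring. Qed.

Lemma D_ev_cpf X c : D (evo X (cpf c)) = evo X f * cx c + f * evo X (cx c).
Proof. by rewrite -ev_D cpfE derM. Qed.

Lemma D_ev_cpg X c : D (evo X (cpg c)) = evo X g * cx c + g * evo X (cx c).
Proof. by rewrite -ev_D cpgE derM. Qed.

(** Up to variations of f and g, [evo X (cpf d)] and [evo X (cpg d)] are primitives for the form
    [evo X (cx d)]. Hence the operator can be moved onto c by parts, and only the variation of its
    coefficients remains. *)
Lemma Hop_variation X c d :
  exact_form (cx c * evo X (Hop d) + Hop c * evo X (cx d) - trilin X d c).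
Proof.
exists (2 * a * cx c * evo X (cx d) + evo X a * cx d * cx c - cpf c * evo X (cpg d)
  - cpg c * evo X (cpf d)).
rewrite ev_Hop !derE !cpfE !cpgE !D_ev_cpf !D_ev_cpg /Hop /var_op /trilin.
by ring.
Qed.

Hypothesis ham : hamiltonian.

(** The Jacobi identity in trilinear form. By parts, the first two terms pair e with the difference
    of the two [var_op], up to terms in [cpf e] and [cpg e] absorbed by kf and kg; skewness moves
    the operator from k to e, and the third term cancels the result. *)
Lemma hamiltonian_cyclic c d e :
  exact_form (trilin (Hop c) d e + trilin (Hop d) e c + trilin (Hop e) c d).
Proof.
have [k [kf [kg [kE kfE kgE vE]]]] := ham c d.
suff h : exact_form (trilin (Hop c) d e + trilin (Hop d) e c + Hop e * k).
  by have := exactB h (kE (Hop e)); congr exact_form; ring.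
exists (2 * a * cx e * k + cpf e * kg + cpg e * kf
  - evo (Hop c) a * cx d * cx e + evo (Hop d) a * cx c * cx e).
transitivity (cx e * (var_op (Hop c) d - var_op (Hop d) c)
    + cpg e * (D kf + f * k) + cpf e * (D kg + g * k) + Hop e * k
    - D (evo (Hop c) a * cx d * cx e) + D (evo (Hop d) a * cx c * cx e)).
  by rewrite kfE kgE /var_op /trilin !derM; move: (Hop c) (Hop d) => P Q; ring.
by rewrite vE !derE cpfE cpgE /Hop; ring.
Qed.

Lemma Hop_bracket c d :
  is_closed (cx c) -> is_closed (cx d) -> exact_form (cx c * Hop d) ->
  exists al be, evo (Hop c) (Hop d) - evo (Hop d) (Hop c)
    = kcst al * f + kcst be * g.
Proof.
move=> cc cd ex; have [k [kf [kg [kE kfE kgE vE]]]] := ham c d.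
(* Tested against any Y: closedness of both forms is combined with the variation along Y of the
   exact density [cx c * Hop d]. *)
have evE : evo (Hop c) (cx d) = evo (Hop d) (cx c) - k.
  apply/eqP; rewrite -subr_eq0; apply/eqP; apply: exact_nondegenerate => Y.
  have e1 := (is_closedP _).1 cd (Hop c) Y.
  have e2 := (is_closedP _).1 cc (Hop d) Y.
  have e3 := exactB (Hop_variation Y c d) (exact_ev Y ex).
  have := exactD (exactD (exactB e1 e2) (kE Y)) e3.
  by congr exact_form; rewrite derM [trilin Y d c]trilinC; ring.
have [al alE] : exists al, evo (Hop c) (cpf d) - evo (Hop d) (cpf c) - kf = kcst al.
  by apply: Dt_ker; rewrite !derE !D_ev_cpf evE kfE; ring.
have [be beE] : exists be, evo (Hop c) (cpg d) - evo (Hop d) (cpg c) - kg = kcst be.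
  by apply: Dt_ker; rewrite !derE !D_ev_cpg evE kgE; ring.
exists (- be), (- al); rewrite !ev_Hop evE !rmorphN -alE -beE.
transitivity (- (2 * a * D k + D a * k) + (var_op (Hop c) d - var_op (Hop d) c)
  - f * (evo (Hop c) (cpg d) - evo (Hop d) (cpg c))
  - g * (evo (Hop c) (cpf d) - evo (Hop d) (cpf c))); last by rewrite vE; ring.
by rewrite derB; ring.
Qed.

(* Pairing with the tests q, r turns the defect of closedness of [D (Hop d)]
   into [compatible] and [hamiltonian_cyclic]; no [D^-1] beyond the potentials
   bundled in the covectors is needed. *)
Lemma closed_step (comp : compatible) c d k k' m m' E E' :
  leading k m E -> nonzerodiv m -> leading k' m' E' -> nonzerodiv m' ->
  (forall q Z, exact_form (E q * Z - q * E' Z)) ->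
  (forall q, exists e, cx e = D (E q)) ->
  is_closed (cx c) -> cx d = D (Hop c) -> is_closed (cx d) ->
  is_closed (D (Hop d)).
Proof.
move=> lE nm lE' nm' EE' potE cc dE cd.
apply: (closed_test lE nm lE' nm' EE') => q r.
have [ey hy] := potE q; have [ex hx] := potE r.
move: (E q) (E r) hy hx => Y X hy hx.
have f1 := exact_D (Y * evo X (Hop d)).
have f2 := exact_D (X * evo Y (Hop d)).
have a1 := Hop_variation X ey d.
have a2 := Hop_variation Y ex d.
have b1 := (is_closedP _).1 cd X (Hop ey).
have b2 := (is_closedP _).1 cd Y (Hop ex).
have g1 := exact_D (X * evo (Hop ey) (Hop c)).
have g2 := exact_D (Y * evo (Hop ex) (Hop c)).
have h1 := Hop_variation (Hop ey) ex c.
have h2 := Hop_variation (Hop ex) ey c.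
have k1 := (is_closedP _).1 cc (Hop ey) (Hop ex).
have t1 := hamiltonian_cyclic c ex ey.
have t2 := comp X Y (Hop c) ex ey d hx hy dE.
rewrite dE !ev_D in b1 b2; rewrite dE !ev_D hx hy in a1 a2.
rewrite hx in h1; rewrite hy in h2; rewrite !derM in f1 f2 g1 g2.
rewrite !ev_D.
have s1 := exactB f1 f2; have s2 := exactB a1 a2; have s3 := exactB b1 b2.
have s4 := exactB g1 g2; have s5 := exactB h1 h2.
have := exactD (exactD (exactB s1 s2) (exactD s3 s4))
  (exactD (exactB k1 s5) (exactB t2 t1)).
congr exact_form.
rewrite (trilinC _ d ey) (trilinC _ c ey).
ring.
Qed.

End HamiltonianOperator.

(* [S] and [F] contain all the forms and flows generated from [x0], whatever
   integration constants are chosen. *)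
Definition lenard_property (K : numFieldType) (A : jetAlgebra K)
    (Op : A -> A -> Prop) (x0 : A) :=
  exists S F : A -> Prop, [/\ S x0,
    forall x, S x -> is_closed x /\ exists y, Op x y,
    forall x y, S x -> Op x y -> F y,
    forall y, F y -> S (Dt y)
  & forall x y, F x -> F y -> evo x y = evo y x].

(** * The graded Lenard chain and its closure under integration constants *)

Section LenardScheme.
Context {K : numFieldType} {A : jetAlgebra K}.
Variables a f g : A.
Implicit Types (x y X Y : A) (r s : K) (n i j : nat).

Local Notation D := (@Dt K A).
Local Notation covector := (covector f g).
Local Notation Hop := (@Hop K A a f g).
Implicit Types c d : covector.

(* [evo (jv 0)] is the infinitesimal scaling of u. *)
Definition homog r x := evo (jv 0) x = kcst r * x.

Lemma homogM r s x y : homog r x -> homog s y -> homog (r + s) (x * y).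
Proof. by rewrite /homog derM rmorphD => -> ->; ring. Qed.

Lemma homogD r x y : homog r x -> homog r y -> homog r (x + y).
Proof. by rewrite /homog derD => -> ->; ring. Qed.

Lemma homogB r x y : homog r x -> homog r y -> homog r (x - y).
Proof. by rewrite /homog derB => -> ->; ring. Qed.

Lemma homog0 r : homog r 0.
Proof. by rewrite /homog der0 mulr0. Qed.

Lemma homog_const r : homog 0 (kcst r).
Proof. by rewrite /homog der_cst rmorph0 mul0r. Qed.

Lemma homogZ r s x : homog r x -> homog r (kcst s * x).
Proof. by rewrite /homog => h; rewrite derM der_cst h; ring. Qed.

Lemma homog_Dt r x : homog r x -> homog r (D x).
Proof. by rewrite /homog ev_D => ->; rewrite derM der_cst mul0r add0r. Qed.

Lemma homog_jv k : homog 1 (jv k : A).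
Proof. by rewrite /homog ev_jv iter_jv addn0 rmorph1 mul1r. Qed.

Lemma homogX r n x : homog r x -> homog (n%:R * r) (x ^+ n).
Proof.
move=> hx; elim: n => [|n IHn].
  by rewrite mul0r expr0 -(rmorph1 kcst); exact: homog_const.
by rewrite exprS -natr1 mulrDl mul1r addrC; exact: homogM.
Qed.

Lemma homogMn r n x : homog r x -> homog r (n%:R * x).
Proof. by rewrite -(rmorph_nat kcst); exact: homogZ. Qed.

Lemma homogN r x : homog r x -> homog r (- x).
Proof. by rewrite -[- x]add0r; apply: homogB; exact: homog0. Qed.

(** The scaling field has characteristic u_0, of degree 1; its bracket with x is therefore (r - 1)
    x, whence the shift by one. *)
Lemma homog_ev r s x y : homog r x -> homog s y -> homog (r + s - 1) (evo x y).
Proof.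
rewrite /homog => hx hy; have := ev_comm (jv 0) x y.
rewrite hx hy derM der_cst mul0r add0r.
have -> : evo x (jv 0) = x by rewrite ev_jv.
have -> : kcst r * x - x = kcst (r - 1) * x by rewrite rmorphB rmorph1; ring.
rewrite evZl => /eqP; rewrite subr_eq => /eqP ->.
by rewrite !rmorphB !rmorphD rmorph1; ring.
Qed.

Lemma homog_eq r s x : r = s -> homog r x -> homog s x.
Proof. by move=> ->. Qed.

Lemma cst_eq0 r x : r != 0 -> kcst r * x = 0 -> x = 0.
Proof.
move=> r0 /(congr1 (fun y => kcst r^-1 * y)).
by rewrite mulr0 mulrA -rmorphM mulVf // rmorph1 mul1r.
Qed.

Variables (da df dg : K).
Hypotheses (ha : homog da a) (hf : homog df f) (hg : homog dg g).
Hypothesis daE : da = df + dg.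

Definition homog_cov r c :=
  [/\ homog r (cx c), homog (r + df) (cpf c) & homog (r + dg) (cpg c)].

Lemma homog_Hop r c : homog_cov r c -> homog (r + da) (Hop c).
Proof.
move=> [hx hp hq]; rewrite /Hop /homog !derE ha hf hg hx hp hq.
rewrite !(ev_D, ha, hx) !derE daE !rmorphD; ring.
Qed.

(** For any primitive x, scaling applied to x differs from r x by a constant s, which is absorbed by
    adding s / r to x. *)
Lemma homog_primitive r x y : r != 0 -> homog r y -> D x = y ->
  exists2 z, D z = y & homog r z.
Proof.
move=> r0 hy xy; have [s sE] : exists s, evo (jv 0) x - kcst r * x = kcst s.
  apply: Dt_ker; rewrite derB derM der_cst mul0r add0r -ev_D xy hy; ring.
exists (x + kcst (s / r)); first by rewrite derD der_cst addr0.
move/eqP: sE; rewrite subr_eq /homog derD der_cst addr0 => /eqP ->.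
by rewrite mulrDr -rmorphM mulrC [r * _]mulrC mulfVK // addrC [x * _]mulrC.
Qed.

Variables (c0 : covector) (d0 : K).
Hypothesis hc0 : homog_cov d0 c0.

Definition deg n := d0 + n%:R * da.

(** Homogeneity of the potentials fixes the integration constants and keeps track of the degrees on
    which the commutation argument rests. *)
Definition chain_next n c d := cx d = D (Hop c) /\ homog_cov (deg n.+1) d.

(** A next covector is picked classically when there is one; [chainP] shows that the default [c0] is
    never taken. *)
Fixpoint chain n : covector :=
  if n is m.+1 then
    if pselect (exists d, chain_next m (chain m) d) is left h
    then projT1 (cid h) else c0
  else c0.

Definition flow n := Hop (chain n).

Variables (e : A) (ce : covector).
Hypotheses (ceE : cx ce = D e) (Hce : Hop ce = 0) (eE : e = 0 \/ e = jv 1).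

Variables fa fb ga gb : K.
Hypothesis fE : f = kcst fa * flow 0 + kcst fb * e.
Hypothesis gE : g = kcst ga * flow 0 + kcst gb * e.

Hypothesis deg_f : forall n, deg n.+1 + df != 0.
Hypothesis deg_g : forall n, deg n.+1 + dg != 0.

Lemma chain_nextP n : (exists d, chain_next n (chain n) d) ->
  chain_next n (chain n) (chain n.+1).
Proof. by rewrite /=; case: pselect => // h _; case: (cid h). Qed.

(* Lenard's shift: [D] and [Hop] are skew, so the indices of a pairing can be
   moved towards each other. *)
Lemma exact_flow_le n : (forall i, (i < n)%N -> chain_next i (chain i) (chain i.+1)) ->
  forall i j, (i <= j)%N -> (j <= n)%N -> exact_form (flow i * D (flow j)).
Proof.
move=> hn i j le_ij; have [k] := ubnP (j - i); elim: k i j le_ij => // k IHk i j.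
rewrite leq_eqVlt => /orP[/eqP <- _ _|lt_ij lt_k le_jn].
  by apply: exact_double; exists (flow i * flow i); rewrite derM; ring.
have lt_in : (i < n)%N by exact: leq_trans lt_ij le_jn.
have [ciE _] := hn i lt_in; have := exact_D (flow i * flow j); rewrite derM -ciE => e1.
have e2 := Hop_skew a (chain i.+1) (chain j).
suff e3 : exact_form (cx (chain j) * flow i.+1).
  by have := exactD (exactB e1 e2) e3; congr exact_form; rewrite /flow; ring.
case: j lt_ij lt_k le_jn {e1 e2} => // j lt_ij lt_k le_jn.
have [-> _] := hn j le_jn; rewrite mulrC.
move: lt_ij; rewrite ltnS leq_eqVlt => /orP[/eqP eij|lt_ij].
  rewrite -eij; have [<- _] := hn i lt_in; rewrite mulrC; exact: exact_form_Hop.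
apply: IHk => //; last exact: ltnW.
by lia.
Qed.

(** By parts, e against [D (flow n)] becomes [cx ce] against the n-th flow, and by skewness the n-th
    form against [Hop ce], which is zero. *)
Lemma exact_extra_flow n : exact_form (e * D (flow n)).
Proof.
have := exactB (exact_D (e * flow n)) (Hop_skew a ce (chain n)).
by congr exact_form; rewrite derM Hce ceE /flow; ring.
Qed.

Lemma chainP n : chain_next n (chain n) (chain n.+1).
Proof.
(* Strong induction: shifting the indices of a pairing uses all earlier links of the chain. *)
suff h k i : (i < k)%N -> chain_next i (chain i) (chain i.+1) by apply: (h n.+1).
elim: k i => // k IHk i; rewrite ltnS leq_eqVlt => /orP[/eqP ->|]; last exact: IHk.
have ex0 : exact_form (flow 0 * D (flow k)) by exact: (exact_flow_le IHk).
have hflow : homog (deg k.+1) (D (flow k)).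
  have hk : homog_cov (deg k) (chain k).
    case: k IHk {ex0} => [|k] IHk; last by have [] := IHk k (ltnSn k).
    by rewrite /deg mul0r addr0.
  apply/homog_Dt/(homog_eq _ (homog_Hop hk)).
  by rewrite /deg -[k.+1%:R]natr1; ring.
have exs r s : exact_form ((kcst r * flow 0 + kcst s * e) * D (flow k)).
  have := exactD (exactZ r ex0) (exactZ s (exact_extra_flow k)).
  by congr exact_form; ring.
have [p pE] := exs fa fb; have [q qE] := exs ga gb.
rewrite -fE in pE; rewrite -gE in qE.
have hfd : homog (deg k.+1 + df) (f * D (flow k)).
  by rewrite addrC; exact: homogM.
have hgd : homog (deg k.+1 + dg) (g * D (flow k)).
  by rewrite addrC; exact: homogM.
have [p' p'E hp] := homog_primitive (deg_f k) hfd (esym pE).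
have [q' q'E hq] := homog_primitive (deg_g k) hgd (esym qE).
by apply: chain_nextP; exists (Covector p'E q'E).
Qed.

Lemma cx_chainS n : cx (chain n.+1) = D (flow n).
Proof. by case: (chainP n). Qed.

Lemma homog_chain n : homog_cov (deg n) (chain n).
Proof.
by case: n => [|n]; [rewrite /deg mul0r addr0|case: (chainP n)].
Qed.

Lemma homog_flow n : homog (deg n.+1) (flow n).
Proof.
apply: homog_eq (homog_Hop (homog_chain n)).
by rewrite /deg -[n.+1%:R]natr1; ring.
Qed.

Lemma exact_flow i j : exact_form (flow i * D (flow j)).
Proof.
have h i' j' : (i' <= j')%N -> exact_form (flow i' * D (flow j')).
  by move=> le; apply: (@exact_flow_le j') => // k _; exact: chainP.
case: (leqP i j) => [/h//|/ltnW/h e1].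
have := exactB (exact_D (flow i * flow j)) e1.
by congr exact_form; rewrite derM; ring.
Qed.

Lemma exact_chain_flow i j : exact_form (cx (chain i) * flow j).
Proof.
case: i => [|i]; last by rewrite cx_chainS mulrC; exact: exact_flow.
case: j => [|j]; first exact: exact_form_Hop.
have := exactB (Hop_skew a (chain 0) (chain j.+1)) (exact_flow 0 j).
by congr exact_form; rewrite cx_chainS /flow; ring.
Qed.

Hypotheses (ham : hamiltonian a f g) (comp : compatible a f g).
Variables (k k' : nat) (m m' : A) (E E' : A -> A).
Hypotheses (lE : leading k m E) (nm : nonzerodiv m)
  (lE' : leading k' m' E') (nm' : nonzerodiv m').
Hypothesis EE' : forall q Z, exact_form (E q * Z - q * E' Z).
Hypothesis potE : forall q, exists d, cx d = D (E q).
Hypotheses (closed0 : is_closed (cx c0)) (closed1 : is_closed (D (flow 0))).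
Hypothesis deg_fe : forall i j, deg i.+1 + deg j.+1 - 1 != df.
Hypothesis deg_ge : forall i j, deg i.+1 + deg j.+1 - 1 != dg.

Lemma closed_chain n : is_closed (cx (chain n)).
Proof.
(* [closed_step] needs two consecutive closed forms, so the induction carries a pair. *)
suff [] : is_closed (cx (chain n)) /\ is_closed (cx (chain n.+1)) by [].
elim: n => [|n [cn cSn]]; first by rewrite cx_chainS.
split=> //; rewrite cx_chainS /flow.
exact: (closed_step ham comp lE nm lE' nm' EE' potE cn (cx_chainS n) cSn).
Qed.

(** With L the scaling field, (L - df)(L - dg) kills the span of f and g, but multiplies an element
    of degree r by (r - df)(r - dg). The argument covers df = dg and dependent f, g. *)
Lemma homog_span_eq0 r al be : r != df -> r != dg ->
  homog r (kcst al * f + kcst be * g) -> kcst al * f + kcst be * g = 0.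
Proof.
rewrite -(subr_eq0 r df) -(subr_eq0 r dg) => rf rg; rewrite /homog => h.
have E1 : evo (jv 0) (kcst al * f + kcst be * g)
    = kcst al * kcst df * f + kcst be * kcst dg * g.
  by rewrite !derE hf hg; ring.
have E2 : kcst r * (kcst r * (kcst al * f + kcst be * g))
    = kcst al * kcst df ^+ 2 * f + kcst be * kcst dg ^+ 2 * g.
  have := congr1 (evo (jv 0)) E1; rewrite h derM der_cst mul0r add0r h => ->.
  by rewrite !derE hf hg; ring.
rewrite h in E1; apply/(cst_eq0 rf)/(cst_eq0 rg); rewrite !rmorphB.
transitivity (kcst r * (kcst r * (kcst al * f + kcst be * g))
  - (kcst df + kcst dg) * (kcst r * (kcst al * f + kcst be * g))
  + kcst df * kcst dg * (kcst al * f + kcst be * g)); first by ring.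
by rewrite E2 E1; ring.
Qed.

Lemma flow_bracket i j : evo (flow i) (flow j) = evo (flow j) (flow i).
Proof.
apply/eqP; rewrite -subr_eq0; apply/eqP.
have [al [be h]] := Hop_bracket ham (closed_chain i) (closed_chain j) (exact_chain_flow i j).
rewrite [LHS]h; apply: (homog_span_eq0 (deg_fe i j) (deg_ge i j)).
rewrite -h; apply: homogB; first exact: homog_ev (homog_flow i) (homog_flow j).
by rewrite [deg i.+1 + _]addrC; exact: homog_ev (homog_flow j) (homog_flow i).
Qed.

Lemma extra_bracket x : evo e x = evo x e.
Proof.
case: eE => ->; first by rewrite ev0l der0.
by rewrite ev_jv1 ev_jv.
Qed.

Lemma closed_extra : is_closed (D e).
Proof.
apply/is_closedP => X Y; case: eE => ->.
  by rewrite der0 !der0 !mulr0 subrr; exact: exact0.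
exists (Y * D X - X * D Y); rewrite !ev_D !ev_jv /= !derE; ring.
Qed.

(* The form is recorded together with its flow for some choice of the
   integration constants. *)
Inductive in_scheme : A -> A -> Prop :=
| in_scheme0 : in_scheme 0 0
| in_scheme_chain x y r n : in_scheme x y ->
    in_scheme (x + kcst r * cx (chain n)) (y + kcst r * flow n)
| in_scheme_extra x y r : in_scheme x y -> in_scheme (x + kcst r * D e) y.

Inductive flow_span : A -> Prop :=
| flow_span0 : flow_span 0
| flow_span_flow x r n : flow_span x -> flow_span (x + kcst r * flow n)
| flow_span_extra x r : flow_span x -> flow_span (x + kcst r * e).

(** A relation, since covectors over the same x may have different values. *)
Definition op_image x y := exists2 c, cx c = x & y = Hop c.

Lemma flow_spanD x y : flow_span x -> flow_span y -> flow_span (x + y).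
Proof.
move=> hx; elim=> [|z r n _ h|z r _ h]; first by rewrite addr0.
  by rewrite addrA; exact: flow_span_flow.
by rewrite addrA; exact: flow_span_extra.
Qed.

Lemma flow_spanZ r x : flow_span x -> flow_span (kcst r * x).
Proof.
elim=> [|z s n _ h|z s _ h]; first by rewrite mulr0; exact: flow_span0.
  by rewrite mulrDr mulrA -rmorphM; exact: flow_span_flow.
by rewrite mulrDr mulrA -rmorphM; exact: flow_span_extra.
Qed.

Lemma flow_span_fg r s : flow_span (kcst r * f + kcst s * g).
Proof.
have h p q : flow_span (kcst p * flow 0 + kcst q * e).
  by apply/flow_span_extra; rewrite -[kcst p * _]add0r; exact/flow_span_flow/flow_span0.
by rewrite {1}fE {1}gE; apply: flow_spanD; apply: flow_spanZ.
Qed.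

Lemma scheme_Dt y : flow_span y -> exists y', in_scheme (D y) y'.
Proof.
elim=> [|x r n _ [z hz]|x r _ [z hz]].
- by exists 0; rewrite der0; exact: in_scheme0.
- by exists (z + kcst r * flow n.+1); rewrite derD derM der_cst mul0r add0r -cx_chainS;
    exact: in_scheme_chain.
- by exists z; rewrite derD derM der_cst mul0r add0r; exact: in_scheme_extra.
Qed.

Lemma scheme_flow x y : in_scheme x y -> flow_span y.
Proof.
by elim=> // [|u v r n _ h]; [exact: flow_span0|exact: flow_span_flow].
Qed.

Lemma op_imageDZ x y r c : op_image x y -> op_image (x + kcst r * cx c) (y + kcst r * Hop c).
Proof.
move=> [d <- ->].
have pE : D (cpf d + kcst r * cpf c) = f * (cx d + kcst r * cx c).
  by rewrite !derE !cpfE; ring.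
have qE : D (cpg d + kcst r * cpg c) = g * (cx d + kcst r * cx c).
  by rewrite !derE !cpgE; ring.
by exists (Covector pE qE) => //; rewrite /Hop !derE /=; ring.
Qed.

Lemma scheme_image x y : in_scheme x y -> op_image x y.
Proof.
elim=> [|u v r n _ h|u v r _ h].
- have z h : D 0 = h * 0 :> A by rewrite der0 mulr0.
  by exists (Covector (z f) (z g)) => //; rewrite /Hop /= der0; ring.
- exact: op_imageDZ.
- by rewrite -ceE -[v]addr0 -(mulr0 (kcst r)) -Hce; exact: op_imageDZ.
Qed.

Lemma op_image_span x y z : in_scheme x y -> op_image x z -> flow_span z.
Proof.
move=> hxy [c cxE ->]; have [d dxE yE] := scheme_image hxy.
have [r rE] : exists r, cpf c - cpf d = kcst r.
  by apply: Dt_ker; rewrite derB !cpfE cxE dxE subrr.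
have [s sE] : exists s, cpg c - cpg d = kcst s.
  by apply: Dt_ker; rewrite derB !cpgE cxE dxE subrr.
have -> : Hop c = y + (kcst (- s) * f + kcst (- r) * g).
  by rewrite yE /Hop cxE dxE !rmorphN -rE -sE; ring.
exact: flow_spanD (scheme_flow hxy) (flow_span_fg _ _).
Qed.

Lemma is_closedDZ x y r : is_closed x -> is_closed y -> is_closed (x + kcst r * y).
Proof.
move=> /is_closedP hx /is_closedP hy; apply/is_closedP => X Y.
have := exactD (hx X Y) (exactZ r (hy X Y)).
by congr exact_form; rewrite !derE; ring.
Qed.

Lemma scheme_closed x y : in_scheme x y -> is_closed x.
Proof.
elim=> [|u v r n _ h|u v r _ h].
- by apply/is_closedP => X Y; rewrite !der0 !mulr0 subrr; exact: exact0.
- exact: is_closedDZ h (closed_chain n).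
- exact: is_closedDZ h closed_extra.
Qed.

Lemma flow_span_commute x y : flow_span x -> flow_span y -> evo x y = evo y x.
Proof.
move=> hx; elim=> [|u r n _ h|u r _ h]; first by rewrite der0 ev0l.
  rewrite derD derM der_cst mul0r add0r evDl evZl h; congr (_ + _ * _).
  elim: hx => [|v s i _ h'|v s _ h']; first by rewrite der0 ev0l.
    by rewrite derD derM der_cst mul0r add0r evDl evZl h' flow_bracket.
  by rewrite derD derM der_cst mul0r add0r evDl evZl h' extra_bracket.
by rewrite derD derM der_cst mul0r add0r evDl evZl h -extra_bracket.
Qed.

(** The second alternative is for chains that start at the zero form with a nonzero constant
    potential: the given form is then the next one, up to a factor. *)
Lemma lenard_scheme x0 :
  x0 = cx c0 \/ (exists r, x0 = kcst r * D (Hop c0)) -> lenard_property op_image x0.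
Proof.
move=> x0E; exists (fun x => exists y, in_scheme x y), flow_span; split.
- have h r n : in_scheme (kcst r * cx (chain n)) (kcst r * flow n).
    by rewrite -[X in in_scheme X]add0r -[X in in_scheme _ X]add0r;
      exact/in_scheme_chain/in_scheme0.
  case: x0E => [->|[r ->]]; last by exists (kcst r * flow 1);
    rewrite -[Hop c0]/(flow 0) -cx_chainS.
  by exists (flow 0); have := h 1 0%N; rewrite rmorph1 !mul1r.
- by move=> x [y hxy]; split; [exact: scheme_closed hxy|exists y; exact: scheme_image].
- by move=> x y [z hxz]; exact: op_image_span hxz.
- exact: scheme_Dt.
- exact: flow_span_commute.
Qed.

End LenardScheme.

(** * The three operators *)

Definition pt_morph := (rmorphD, rmorphB, rmorphN, rmorphM, rmorphXn, rmorph_nat,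
  rmorph1, rmorph0, at_pt_cst).

(** Write E for the value of [conj_op]. Then f D E = D (f E) - (D f) E, and (D f) E is itself a
    total derivative by [conj_opE]. *)
Lemma conj_op_potential (K : numFieldType) (A : jetAlgebra K) (f q : A) :
  Dt (f * conj_op (Dt f) q - Dt f ^+ 2 * q) = f * Dt (conj_op (Dt f) q).
Proof. by rewrite derB -conj_opE derM; ring. Qed.

Lemma closed0 (K : numFieldType) (A : jetAlgebra K) : is_closed (0 : A).
Proof. by apply/is_closedP => X Y; rewrite !der0 !mulr0 subrr; exact: exact0. Qed.

Lemma exact_congr (K : numFieldType) (A : jetAlgebra K) (x y w : A) :
  Dt w = y -> y = x -> exact_form x.
Proof. by move=> <- <-; exact: exact_D. Qed.

(** * The first operator, with s = u_2^(-1/2) *)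

Section DymHierarchy.
Context {K : numFieldType} {A : jetAlgebra K}.
Variables (u2r s : A).
Hypotheses (u2rE : u2r ^+ 2 = jv 2) (sE : s * u2r = 1).
Implicit Types X Y Z : A.

Local Notation D := (@Dt K A).
Local Notation half := (kcst 2^-1 : A).

(** These are 2 u_2^-1, u_3 u_2^(-3/2) and half of the latter: the single integral term is split
    evenly into f D^-1 g and g D^-1 f. *)
Let a : A := 2 * s ^+ 2.
Let f : A := - (2 * D s).
Let g : A := - D s.

Lemma two_halfE x : 2 * half * x = x :> A.
Proof. by rewrite mulrAC mulrC halfK. Qed.

Lemma der_dym (d : derivation (@kcst K A)) : d s = - (half * s ^+ 3 * d (jv 2)).
Proof.
(* Division is available only after evaluation at a point. *)
rewrite -u2rE derX expr1; apply: (@at_pt_inj _ A) => t.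
have := congr1 (at_pt t) sE; have := congr1 (at_pt t \o d) sE.
rewrite /= derM der1 !pt_morph.
move: (at_pt t u2r) (at_pt t s) (at_pt t (d u2r)) (at_pt t (d s)) => u v du dv h1 h2.
have u0 : u != 0 by apply: contra_eq_neq h2 => ->; rewrite mulr0 eq_sym oner_neq0.
have vE : v = u^-1 by rewrite -[v](mulfK u0) h2 mul1r.
have -> : dv = - (v * du) / u.
  by rewrite -[dv](mulfK u0); congr (_ / u); apply/eqP; rewrite -addr_eq0 h1.
by rewrite vE; field.
Qed.

Lemma ev_dym X : evo X s = - (half * s ^+ 3 * D (D X)).
Proof. by rewrite der_dym ev_jv. Qed.

Lemma ev_dym_a X : evo X a = 0 * D X + - (2 * s ^+ 4) * D (D X).
Proof. by rewrite /a !derE ev_dym -[X in _ = X]two_halfE; ring. Qed.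

Lemma ev_dym_f X : evo X f = D (s ^+ 3 * D (D X)) + 0 * D X.
Proof. by rewrite -[RHS]two_halfE /f !derE ev_D ev_dym !derE; ring. Qed.

Lemma ev_dym_g X : evo X g = D (half * s ^+ 3 * D (D X)) + 0 * D X.
Proof. by rewrite /g !derE ev_D ev_dym !derE; ring. Qed.

Section DymIdentities.
Variables x y p q : A.
Hypotheses (pE : D p = - (2 * D s * x)) (qE : D q = - (2 * D s * y)).

(** As f and g are proportional, both potentials enter through one combination r, a primitive of f
    z. *)
Definition dym_op z r := 4 * s ^+ 2 * D z + 4 * s * D s * z + 2 * D s * r.

(* [D (D dym_form0)] and [dym_pot] are the [k] and [kf] of [hamiltonian]. *)
Definition dym_form0 :=
  - (2 * s ^+ 4 * (D x * y - x * D y)) + s ^+ 3 * (p * D y - q * D x).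

Definition dym_pot :=
  4 * s ^+ 5 * (y * D (D (D x)) - x * D (D (D y)) + D x * D (D y) - D y * D (D x))
  + 16 * s ^+ 4 * D s * (y * D (D x) - x * D (D y))
  + 20 * s ^+ 4 * D (D s) * (y * D x - x * D y)
  + 2 * s ^+ 3 * (D (D (D s)) * (p * y - q * x) - D (D s) * (p * D y - q * D x)
      + D s * (p * D (D y) - q * D (D x)))
  + 6 * s ^+ 2 * D s ^+ 2 * (p * D y - q * D x).

Lemma D_dym_pot : D dym_pot =
  D (s ^+ 3 * D (D (dym_op x p))) * y - D (s ^+ 3 * D (D (dym_op y q))) * x
  + 2 * D s * D (D dym_form0).
Proof.
rewrite /dym_op /dym_pot /dym_form0.
diff_ring (@Dt K A) [:: s; x; y; p; q] tt (tt, pE, qE).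
Qed.

Lemma dym_var_op :
  (- (4 * s ^+ 4 * D (D (dym_op x p)) * D y) - D (2 * s ^+ 4 * D (D (dym_op x p))) * y
   - D (s ^+ 3 * D (D (dym_op x p))) * q)
  - (- (4 * s ^+ 4 * D (D (dym_op y q)) * D x) - D (2 * s ^+ 4 * D (D (dym_op y q))) * x
   - D (s ^+ 3 * D (D (dym_op y q))) * p)
  = 4 * s ^+ 2 * D (D (D dym_form0)) + 4 * s * D s * D (D dym_form0)
    - 2 * D s * dym_pot.
Proof.
rewrite /dym_op /dym_pot /dym_form0.
diff_ring (@Dt K A) [:: s; x; y; p; q] tt (tt, pE, qE).
Qed.

Lemma D_dym_form X : D (X * D dym_form0 - D X * dym_form0
    + s ^+ 3 * D (D X) * (p * y - q * x))
  = X * D (D dym_form0) + 2 * s ^+ 4 * D (D X) * (D x * y - x * D y)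
    + D (s ^+ 3 * D (D X)) * (p * y - q * x).
Proof.
rewrite /dym_form0.
diff_ring (@Dt K A) [:: s; x; y; p; q; X] tt (tt, pE, qE).
Qed.

End DymIdentities.

Lemma dym_hamiltonian : hamiltonian a f g.
Proof.
move=> c d.
have hf : half * f = g by rewrite /f /g -[RHS]two_halfE; ring.
have hfM x : g * x = half * f * x by rewrite hf.
have potE (e : covector f g) : D (half * cpf e + cpg e) = - (2 * D s * cx e).
  by rewrite !derE cpfE cpgE hfM -[RHS]two_halfE /f; ring.
have opE (e : covector f g) : Hop a e = dym_op (cx e) (half * cpf e + cpg e).
  by rewrite /Hop /a /f /g /dym_op !derE -{1}[cpf e]two_halfE; ring.
have fg X : evo X g = half * evo X f by rewrite ev_dym_g ev_dym_f !derE; ring.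
have hv := dym_var_op (potE c) (potE d).
have hk := D_dym_pot (potE c) (potE d).
have hX X := D_dym_form (potE c) (potE d) X.
move: (dym_pot _ _ _ _) (dym_form0 _ _ _ _) hv hk hX => kf k0 hv hk hX.
have kfE : D kf = evo (Hop a c) f * cx d - evo (Hop a d) f * cx c - f * D (D k0).
  by rewrite hk !ev_dym_f !opE /f; ring.
exists (D (D k0)), kf, (half * kf); split=> //.
- move=> X; apply: (exact_congr (hX X)).
  by rewrite /trilin fg ev_dym_a ev_dym_f; ring.
- by rewrite derM der_cst mul0r add0r kfE !fg hfM; ring.
- rewrite -!opE in hv; move: (Hop a c) (Hop a d) hv => P Q hv.
  rewrite /var_op !fg !ev_dym_a !ev_dym_f.
  transitivity (4 * s ^+ 2 * D (D (D k0)) + 4 * s * D s * D (D k0) - 2 * D s * kf).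
    by rewrite -hv !derE; ring.
  by rewrite hfM /a /f !derE -[kf in LHS]two_halfE; ring.
Qed.

(** The derivative of D f in u_4 is u_2^(-3/2), which is a unit. *)
Lemma nonzerodiv_dym : nonzerodiv (D f).
Proof.
have pds (k : nat) : k != 2%N -> pd k s = 0.
  by move=> k2; rewrite der_dym pd_jv (negPf k2) mulr0 oppr0.
apply: (@nonzerodiv_pd _ _ 4); apply: (@nonzerodiv_unit _ _ _ (u2r ^+ 3)).
rewrite /f !derE !pdS_D (pds 3) // (pds 4) // !der0 !addr0 (der_dym (pd 2)) pd_jv eqxx !der0 /=.
have e3 : s ^+ 3 * u2r ^+ 3 = 1 by rewrite -exprMn sE expr1n.
by rewrite -[RHS]e3 -[RHS]two_halfE; ring.
Qed.

Lemma homog_dym : homog (- 2^-1) s.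
Proof.
rewrite /homog der_dym ev_jv iter_jv addn0 -u2rE rmorphN.
have e2 : s ^+ 2 * u2r ^+ 2 = 1 by rewrite -exprMn sE expr1n.
by rewrite -[s in RHS]mul1r -e2; ring.
Qed.

Lemma dym_scheme :
  lenard_property (op_image a f g) (half * D (D s)).
Proof.
have z0 h : D 0 = h * 0 :> A by rewrite der0 mulr0.
(* The zero form has constants as potentials; with 0 and -1 the operator takes it to f. *)
have z1 : D (kcst (-1)) = g * 0 by rewrite der_cst mulr0.
pose c0 := Covector (z0 f) z1; pose ce := Covector (z0 f) (z0 g).
have hDs := homog_Dt homog_dym.
have ha : homog (-1) a.
  have -> : -1 = 0 + (- 2^-1 + - 2^-1) :> K by field.
  apply: homogM; first by rewrite -(rmorph_nat kcst); exact: homog_const.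
  exact: homogM homog_dym homog_dym.
have hg : homog (- 2^-1) g.
  have -> : g = kcst (-1) * D s by rewrite rmorphN rmorph1 mulN1r.
  exact: homogZ.
have hf : homog (- 2^-1) f.
  have -> : f = kcst (- 2) * D s by rewrite rmorphN rmorph_nat mulNr.
  exact: homogZ.
(* The zero form has every degree; 1/2 is forced by the constant potential, which has degree 0 = 1/2
   + dg. *)
have hc0 : homog_cov (- 2^-1) (- 2^-1) 2^-1 c0.
  by split; [exact: homog0|exact: homog0|rewrite subrr; exact: homog_const].
have flow0 : flow a (-1) (- 2^-1) (- 2^-1) c0 2^-1 0 = f.
  by rewrite /flow /Hop /= !derE rmorphN rmorph1; ring.
have hce : Hop a ce = 0 by rewrite /Hop /= der0; ring.
have fE : f = kcst 1 * flow a (-1) (- 2^-1) (- 2^-1) c0 2^-1 0 + kcst 0 * 0.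
  by rewrite flow0 rmorph1; ring.
have gE : g = kcst 2^-1 * flow a (-1) (- 2^-1) (- 2^-1) c0 2^-1 0 + kcst 0 * 0.
  by rewrite flow0 /f /g -[LHS]two_halfE; ring.
have hdeg n : deg (-1) 2^-1 n.+1 + - 2^-1 != 0 :> K.
  have -> : deg (-1) 2^-1 n.+1 + - 2^-1 = - n.+1%:R :> K by rewrite /deg; ring.
  by rewrite oppr_eq0 pnatr_eq0.
have hdeg2 i j : deg (-1) 2^-1 i.+1 + deg (-1) 2^-1 j.+1 - 1 != - 2^-1 :> K.
  rewrite -subr_eq0 /deg; set x := (X in X != 0).
  have -> : x = - ((2 * (i + j) + 3)%:R / 2) by rewrite /x natrD natrM natrD -!natr1; field.
  by rewrite oppr_eq0 mulf_neq0 ?invr_eq0 ?pnatr_eq0 // addn3.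
have pot q : exists d : covector f g, cx d = D (conj_op (D f) q).
  have h := conj_op_potential f q.
  have h' : D (half * (f * conj_op (D f) q - D f ^+ 2 * q)) = g * D (conj_op (D f) q).
    by rewrite derM h der_cst mul0r add0r mulrA; congr (_ * _);
      rewrite /f /g -[RHS]two_halfE; ring.
  by exists (Covector h h').
have cl : is_closed (D f).
  apply/is_closedP => X Y; rewrite !ev_D !ev_dym_f !mul0r !addr0.
  exists (Y * D (s ^+ 3 * D (D X)) - D Y * (s ^+ 3 * D (D X))
    - (X * D (s ^+ 3 * D (D Y)) - D X * (s ^+ 3 * D (D Y)))).
  diff_ring (@Dt K A) [:: s; X; Y] tt tt.
have ceE : cx ce = D 0 by rewrite der0.
have daE : -1 = - 2^-1 + - 2^-1 :> K by field.
have cl1 : is_closed (D (flow a (-1) (- 2^-1) (- 2^-1) c0 2^-1 0)) by rewrite flow0.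
apply: (lenard_scheme ha hf hg daE hc0 ceE hce (or_introl erefl) fE gE
  hdeg hdeg dym_hamiltonian (compatible_second_order ev_dym_a ev_dym_f ev_dym_g)
  (leading_conj_op _) nonzerodiv_dym (leading_conj_op_adj _)
  (nonzerodivN nonzerodiv_dym) (conj_op_by_parts _) pot (@closed0 K A) cl1 hdeg2 hdeg2).
(* The first flow is f = -2 D s, and the form to be reached is 1/2 D (D s) = -1/4 D f. *)
right; exists (- (2^-1 * 2^-1)).
rewrite -[Hop a c0]/(flow a (-1) (- 2^-1) (- 2^-1) c0 2^-1 0) flow0 /f !derE.
by rewrite rmorphN rmorphM -[LHS]two_halfE; ring.
Qed.

End DymHierarchy.

(** * The second operator, with v = u_2^-1 *)

Section SecondHierarchy.
Context {K : numFieldType} {A : jetAlgebra K}.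
Variable v : A.
Hypothesis vE : v * jv 2 = 1.
Implicit Types X Y Z : A.

Local Notation D := (@Dt K A).
Local Notation w := (jv 1 : A).

(** With these, f D^-1 g + g D^-1 f = 8 u_1 D^-1 u_1. *)
Let a : A := w ^+ 4 * v ^+ 2.
Let f : A := w.
Let g : A := 4 * w.

Lemma D_jv1 : D w = jv 2.
Proof. exact: (iter_jv 1 1). Qed.

Lemma vDw : v * D w = 1.
Proof. by rewrite D_jv1. Qed.

Lemma der_second (d : derivation (@kcst K A)) : d v = - (v ^+ 2 * d (jv 2)).
Proof.
have := congr1 d vE; rewrite derM der1 => h.
have -> : d v = v * (d v * jv 2 + v * d (jv 2)) - v ^+ 2 * d (jv 2).
  by rewrite -[LHS]mul1r -{1}vE; ring.
by rewrite h; ring.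
Qed.

Lemma ev_second X : evo X v = - (v ^+ 2 * D (D X)).
Proof. by rewrite der_second ev_jv. Qed.

Lemma ev_w X : evo X w = D X.
Proof. exact: ev_jv. Qed.

(** As a rewriting rule it eliminates the derivatives of w of order at least two in favour of those
    of v; D w itself is the inverse of v. *)
Lemma DDw : D (D w) = - (D v * D w ^+ 2).
Proof.
rewrite (der_second D) -D_jv1 -[LHS]mul1r -(expr1n _ 2) -vDw; ring.
Qed.

Lemma ev_second_a X :
  evo X a = 4 * w ^+ 3 * v ^+ 2 * D X + - (2 * w ^+ 4 * v ^+ 3) * D (D X).
Proof. by rewrite /a !derE ev_second ev_w; ring. Qed.

Lemma ev_second_f X : evo X f = D (0 * D (D X)) + 1 * D X.
Proof. by rewrite /f ev_w !derE; ring. Qed.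

Lemma ev_second_g X : evo X g = D (0 * D (D X)) + 4 * D X.
Proof. by rewrite /g !derE ev_w; ring. Qed.

Section SecondIdentities.
Variables x y p q : A.
Hypotheses (pE : D p = 8 * w * x) (qE : D q = 8 * w * y).

Definition second_op z r :=
  2 * (w ^+ 4 * v ^+ 2) * D z + D (w ^+ 4 * v ^+ 2) * z - w * r.

(* [second_form] and [second_pot] are the [k] and [kf] of [hamiltonian]. *)
Definition second_form :=
  - D (4 * w ^+ 3 * v ^+ 2 * (D x * y - x * D y))
  - D (D (2 * w ^+ 4 * v ^+ 3 * (D x * y - x * D y))) + D (p * y - q * x).

Definition second_pot :=
  2 * w ^+ 5 * v ^+ 3 * (D (D x) * y - x * D (D y))
  + (12 * w ^+ 4 * v ^+ 2 + 6 * w ^+ 5 * v ^+ 2 * D v) * (D x * y - x * D y)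
  - w * (p * y - q * x).

Lemma D_second_pot :
  D second_pot = D (second_op x p) * y - D (second_op y q) * x - w * second_form.
Proof.
rewrite /second_op /second_pot /second_form.
diff_ring (@Dt K A) [:: w; v; x; y; p; q] (tt, vDw) (tt, DDw, pE, qE).
Qed.

Definition second_ev_a X :=
  4 * w ^+ 3 * v ^+ 2 * D X - 2 * w ^+ 4 * v ^+ 3 * D (D X).

Lemma second_var_op :
  2 * second_ev_a (second_op x p) * D y + D (second_ev_a (second_op x p)) * y
  - D (second_op x p) * q
  - (2 * second_ev_a (second_op y q) * D x + D (second_ev_a (second_op y q)) * x
     - D (second_op y q) * p)
  = 2 * (w ^+ 4 * v ^+ 2) * D second_form + D (w ^+ 4 * v ^+ 2) * second_form
    + 8 * w * second_pot.
Proof.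
rewrite /second_ev_a /second_op /second_pot /second_form.
diff_ring (@Dt K A) [:: w; v; x; y; p; q] (tt, vDw) (tt, DDw, pE, qE).
Qed.

Lemma D_second_form X : D (- (X * (4 * w ^+ 3 * v ^+ 2 * (D x * y - x * D y)))
    - X * D (2 * w ^+ 4 * v ^+ 3 * (D x * y - x * D y))
    + D X * (2 * w ^+ 4 * v ^+ 3 * (D x * y - x * D y)) + X * (p * y - q * x))
  = X * second_form - second_ev_a X * (D x * y - x * D y) + D X * (p * y - q * x).
Proof.
rewrite /second_ev_a /second_form.
diff_ring (@Dt K A) [:: w; v; x; y; p; q; X] (tt, vDw) (tt, DDw, pE, qE).
Qed.

End SecondIdentities.

Lemma second_hamiltonian : hamiltonian a f g.
Proof.
move=> c d.
have potE (e : covector f g) : D (4 * cpf e + cpg e) = 8 * w * cx e.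
  by rewrite !derE cpfE cpgE /f /g; ring.
have opE (e : covector f g) : Hop a e = second_op (cx e) (4 * cpf e + cpg e).
  by rewrite /Hop /a /f /g /second_op; ring.
have hv := second_var_op (potE c) (potE d).
have hk := D_second_pot (potE c) (potE d).
have hX X := D_second_form (potE c) (potE d) X.
have eg X : evo X g = 4 * D X by rewrite ev_second_g mul0r der0 add0r.
have ef X : evo X f = D X by rewrite ev_second_f mul0r der0 add0r mul1r.
have ea X : evo X a = second_ev_a X by rewrite ev_second_a /second_ev_a; ring.
move: (second_pot _ _ _ _) (second_form _ _ _ _) hv hk hX => kf k hv hk hX.
exists k, kf, (4 * kf); split=> //.
- move=> X; apply: (exact_congr (hX X)).
  by rewrite /trilin eg ef ea; ring.
- by rewrite hk !ef !opE /f; ring.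
- by rewrite derM der_nat mul0r add0r hk !eg !opE /g; ring.
- rewrite -!opE in hv; move: (Hop a c) (Hop a d) hv => P Q hv.
  rewrite /var_op !ef !eg !ea.
  transitivity (2 * (w ^+ 4 * v ^+ 2) * D k + D (w ^+ 4 * v ^+ 2) * k + 8 * w * kf).
    by rewrite -hv; ring.
  by rewrite /a /f /g; ring.
Qed.

(** A primitive of [xi2]. For the density h = u_1^6 / (2 u_2) it is D (dh/du_2) - dh/du_1. *)
Definition second_density_flow := - (w ^+ 6 * v * D v + 6 * w ^+ 5 * v).

Definition second_density_pot := - (w ^+ 7 * v * D v + 5 * w ^+ 6 * v).

Lemma D_second_density_pot : D second_density_pot = w * D second_density_flow.
Proof.
rewrite /second_density_pot /second_density_flow.
diff_ring (@Dt K A) [:: w; v] (tt, vDw) (tt, DDw).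
Qed.

(** The first flow in normal form, ready for the variation taken in [closed_second_flow1]. The
    second argument is the combined potential, a primitive of 8 w x. *)
Lemma second_op_flowE :
  second_op (D second_density_flow) (8 * second_density_pot) =
  - (220 * v * D v * w ^+ 8 + 40 * v * D v ^+ 2 * w ^+ 9 + 2 * v * D v ^+ 3 * w ^+ 10
     + 320 * v * w ^+ 7 + 8 * v ^+ 2 * D v * D (D v) * w ^+ 10
     + 40 * v ^+ 2 * D (D v) * w ^+ 9 + 2 * v ^+ 3 * D (D (D v)) * w ^+ 10).
Proof.
rewrite /second_op /second_density_pot /second_density_flow.
diff_ring (@Dt K A) [:: w; v] (tt, vDw) (tt, DDw).
Qed.

Lemma closed_second_flow : is_closed (D second_density_flow).
Proof.
apply/is_closedP => X Y; rewrite !ev_D /second_density_flow.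
exists (Y * evo X (- (w ^+ 6 * v * D v + 6 * w ^+ 5 * v))
  - X * evo Y (- (w ^+ 6 * v * D v + 6 * w ^+ 5 * v))
  + w ^+ 6 * v ^+ 3 * (D X * D (D Y) - D (D X) * D Y)).
rewrite !(derE_of (evo X), derE_of (evo Y), ev_D, ev_second, ev_w).
diff_ring (@Dt K A) [:: w; v; X; Y] (tt, vDw) (tt, DDw).
Qed.

(** After one integration by parts the remainder is antisymmetric in X and Y, and its primitive is
    sought among the expressions D^i X D^j Y - D^j X D^i Y. The factor 2 w^10 v^5 is the coefficient
    of D^5 X in [evo X P]. *)
Lemma closed_second_flow1 :
  is_closed (D (second_op (D second_density_flow) (8 * second_density_pot))).
Proof.
rewrite second_op_flowE; set P := (X in D X); apply/is_closedP => X Y; rewrite !ev_D.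
exists (Y * evo X P - X * evo Y P
  + (60 * w ^+ 9 * v ^+ 3 * D v + 10 * w ^+ 10 * v ^+ 3 * D v ^+ 2
     + 40 * w ^+ 8 * v ^+ 3 + 10 * w ^+ 10 * v ^+ 4 * D (D v))
    * (D X * D (D Y) - D (D X) * D Y)
  + (10 * w ^+ 10 * v ^+ 4 * D v + 20 * w ^+ 9 * v ^+ 4)
    * (D X * D (D (D Y)) - D (D (D X)) * D Y)
  + 2 * w ^+ 10 * v ^+ 5 * (D X * D (D (D (D Y))) - D (D (D (D X))) * D Y
    - D (D X) * D (D (D Y)) + D (D (D X)) * D (D Y))).
rewrite /P !(derE_of (evo X), derE_of (evo Y), ev_D, ev_second, ev_w).
diff_ring (@Dt K A) [:: w; v; X; Y] (tt, vDw) (tt, DDw).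
Qed.

Lemma homog_second : homog (-1) v.
Proof.
rewrite /homog der_second ev_jv iter_jv addn0 rmorphN rmorph1.
by rewrite expr2 -mulrA vE mulr1 mulN1r.
Qed.

Lemma second_scheme :
  lenard_property (op_image a f g) (D second_density_flow).
Proof.
have fpE : D second_density_pot = f * D second_density_flow.
  exact: D_second_density_pot.
have gpE : D (4 * second_density_pot) = g * D second_density_flow.
  by rewrite derM der_nat mul0r add0r fpE mulrA.
pose c0 := Covector fpE gpE.
(* The kernel element: on the form D u_1 with these potentials the operator vanishes. *)
have feE : D (kcst 2^-1 * w ^+ 2) = f * D w.
  by rewrite derM der_cst mul0r add0r derX expr1 -mulrA halfK.
have geE : D (2 * w ^+ 2) = g * D w by rewrite !derE /g; ring.
pose ce := Covector feE geE.
have hw : homog 1 w := homog_jv 1; have hv := homog_second; have hDv := homog_Dt hv.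
have ha : homog 2 a.
  apply: (homog_eq _ (homogM (homogX 4 hw) (homogX 2 hv))); ring.
have hg : homog 1 g by exact: homogMn.
have hF : homog 4 second_density_flow.
  apply/homogN/homogD.
    by apply: (homog_eq _ (homogM (homogM (homogX 6 hw) hv) hDv)); ring.
  by apply: (homog_eq _ (homogM (homogMn 6 (homogX 5 hw)) hv)); ring.
have hp : homog (4 + 1) second_density_pot.
  apply/homogN/homogD.
    by apply: (homog_eq _ (homogM (homogM (homogX 7 hw) hv) hDv)); ring.
  by apply: (homog_eq _ (homogM (homogMn 5 (homogX 6 hw)) hv)); ring.
have hc0 : homog_cov 1 1 4 c0.
  by split; [exact: homog_Dt|exact: hp|exact: homogMn].
have opE : Hop a c0 = second_op (D second_density_flow) (8 * second_density_pot).
  by rewrite /Hop /second_op /a /f /g /=; ring.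
have hce : Hop a ce = 0.
  have hw2 : 4 * w * (kcst 2^-1 * w ^+ 2) = 2 * w * w ^+ 2 :> A.
    by rewrite -[RHS]two_halfE; ring.
  rewrite /Hop /a /f /g /= hw2.
  diff_ring (@Dt K A) [:: w; v] (tt, vDw) (tt, DDw).
have fE : f = kcst 0 * flow a 2 1 1 c0 4 0 + kcst 1 * w.
  by rewrite rmorph0 rmorph1 mul0r add0r mul1r.
have gE : g = kcst 0 * flow a 2 1 1 c0 4 0 + kcst 4 * w.
  by rewrite rmorph0 rmorph_nat mul0r add0r.
have hdeg n : deg 2 4 n.+1 + 1 != 0 :> K.
  have -> : deg 2 4 n.+1 + 1 = (2 * n + 7)%:R :> K.
    by rewrite /deg natrD natrM -natr1; ring.
  by rewrite pnatr_eq0 addn_eq0 andbF.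
have hdeg2 i j : deg 2 4 i.+1 + deg 2 4 j.+1 - 1 != 1 :> K.
  rewrite -subr_eq0 /deg; set x := (X in X != 0).
  have -> : x = (2 * (i + j) + 10)%:R.
    by rewrite /x natrD natrM natrD -!natr1; ring.
  by rewrite pnatr_eq0 addn_eq0 andbF.
have pot q : exists d : covector f g, cx d = D (conj_op (D f) q).
  have h := conj_op_potential f q.
  have h' : D (4 * (f * conj_op (D f) q - D f ^+ 2 * q)) = g * D (conj_op (D f) q).
    by rewrite derM h der_nat mul0r add0r mulrA.
  by exists (Covector h h').
have cl1 : is_closed (D (flow a 2 1 1 c0 4 0)).
  rewrite /flow [Hop _ _]opE; exact: closed_second_flow1.
have nz : nonzerodiv (D f) by apply: (@nonzerodiv_unit _ _ _ v); rewrite mulrC vDw.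
apply: (lenard_scheme ha hw hg _ hc0 (erefl : cx ce = D w) hce (or_intror erefl) fE gE
  hdeg hdeg second_hamiltonian
  (compatible_second_order ev_second_a ev_second_f ev_second_g)
  (leading_conj_op _) nz (leading_conj_op_adj _)
  (nonzerodivN nz) (conj_op_by_parts _) pot closed_second_flow cl1 hdeg2 hdeg2).
  by ring.
by left.
Qed.

End SecondHierarchy.

(** Let r' = [conj_op h r] and E = [conj_op (D w) r']. Then (D f) E = D (D f D w r') + h r', because
    h is the Wronskian of D f and D w, and h r' = D (h^2 r) by [conj_opE]. So the composite makes
    D^-1 f D local as well as D^-1 w D. *)
Lemma conj_op_potential2 (K : numFieldType) (A : jetAlgebra K) (f w r : A)
    (h := Dt f * Dt (Dt w) - Dt (Dt f) * Dt w) :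
  Dt (f * conj_op (Dt w) (conj_op h r) - Dt f * (Dt w * conj_op h r) - h ^+ 2 * r)
  = f * Dt (conj_op (Dt w) (conj_op h r)).
Proof.
rewrite /h /conj_op; diff_ring (@Dt K A) [:: f; w; r] tt tt.
Qed.

(** * The third operator, with t = u_1^-1 *)

Section ThirdHierarchy.
Context {K : numFieldType} {A : jetAlgebra K}.
Variable t : A.
Hypothesis tw : t * jv 1 = 1.
Implicit Types X Y Z : A.

Local Notation D := (@Dt K A).
Local Notation w := (jv 1 : A).

Let a : A := t ^+ 4.
(** This is u_3 u_1^-6 - 3 u_2^2 u_1^-7 ([third_bE]), expressed by t alone so that normalization
    meets no powers of u_2 and u_3. *)
Definition third_b := - (t ^+ 3 * D t ^+ 2 + t ^+ 4 * D (D t)).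
Let f : A := third_b.
Let g : A := 4 * w.

Lemma der_third (d : derivation (@kcst K A)) : d t = - (t ^+ 2 * d w).
Proof.
have := congr1 d tw; rewrite derM der1 => h.
have -> : d t = t * (d t * w + t * d w) - t ^+ 2 * d w.
  by rewrite -[LHS]mul1r -{1}tw; ring.
by rewrite h; ring.
Qed.

Lemma ev_third X : evo X t = - (t ^+ 2 * D X).
Proof. by rewrite der_third ev_jv. Qed.

Lemma D_third_w : D w = - (D t * w ^+ 2).
Proof. by rewrite (der_third D) -[LHS]mul1r -(expr1n _ 2) -tw; ring. Qed.

Lemma ev_third_a X : evo X a = - (4 * t ^+ 5) * D X + 0 * D (D X).
Proof. by rewrite /a !derE ev_third; ring. Qed.

Definition third_l := 9 * t ^+ 4 * D t ^+ 2 + 6 * t ^+ 5 * D (D t).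

Lemma ev_third_f X : evo X f = D (t ^+ 6 * D (D X)) + third_l * D X.
Proof.
rewrite /f /third_b !(derE_of (evo X), ev_D, ev_third) /third_l.
diff_ring (@Dt K A) [:: t; X] tt tt.
Qed.

Lemma ev_third_g X : evo X g = D (0 * D (D X)) + 4 * D X.
Proof. by rewrite /g !derE ev_jv /=; ring. Qed.

Section ThirdIdentities.
Variables x y p q p' q' : A.
Hypotheses (pE : D p = - (t ^+ 3 * D t ^+ 2 + t ^+ 4 * D (D t)) * x)
  (qE : D q = 4 * w * x)
  (pE' : D p' = - (t ^+ 3 * D t ^+ 2 + t ^+ 4 * D (D t)) * y)
  (qE' : D q' = 4 * w * y).

Definition third_op z r r' :=
  2 * t ^+ 4 * D z + D (t ^+ 4) * z - third_b * r' - 4 * w * r.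

(* [third_form], [third_pot_f] and [third_pot_g] are the [k], [kf] and [kg] of
   [hamiltonian]. *)
Definition third_form :=
  D (4 * t ^+ 5 * (D x * y - x * D y)) + D (D (t ^+ 6 * D (q * y - q' * x)))
  + D (third_l * (q * y - q' * x)) + 4 * D (p * y - p' * x).

Definition third_ev_f Z := D (t ^+ 6 * D (D Z)) + third_l * D Z.

Definition third_pot_f :=
  4 * third_b * (p' * x - p * y)
  + (15 * t ^+ 7 * D t ^+ 4 + 42 * t ^+ 8 * D t ^+ 2 * D (D t)
     + 10 * t ^+ 9 * D t * D (D (D t)) + 12 * t ^+ 9 * D (D t) ^+ 2
     + t ^+ 10 * D (D (D (D t)))) * (q * y - q' * x)
  + (3 * t ^+ 8 * D t ^+ 3 - t ^+ 10 * D (D (D t))) * (q * D y - q' * D x)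
  + (t ^+ 9 * D t ^+ 2 + t ^+ 10 * D (D t)) * (q * D (D y) - q' * D (D x))
  + (74 * t ^+ 8 * D t ^+ 2 + 36 * t ^+ 9 * D (D t)) * (D x * y - x * D y)
  + 20 * t ^+ 9 * D t * (D (D x) * y - x * D (D y))
  + 2 * t ^+ 10 * (D (D (D x)) * y - x * D (D (D y)) + D x * D (D y) - D (D x) * D y).

Definition third_pot_g :=
  16 * w * (p' * x - p * y)
  - (44 * t ^+ 3 * D t ^+ 2 + 20 * t ^+ 4 * D (D t)) * (q * y - q' * x)
  - 28 * t ^+ 4 * D t * (q * D y - q' * D x)
  - 4 * t ^+ 5 * (q * D (D y) - q' * D (D x))
  + 8 * t ^+ 4 * (D x * y - x * D y).

Lemma D_third_pot_f : D third_pot_f =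
  third_ev_f (third_op x p q) * y - third_ev_f (third_op y p' q') * x
  - third_b * third_form.
Proof.
rewrite /third_ev_f /third_op /third_pot_f /third_form /third_l /third_b.
diff_ring (@Dt K A) [:: t; w; x; y; p; q; p'; q'] (tt, tw)
  (tt, D_third_w, pE, qE, pE', qE').
Qed.

Lemma D_third_pot_g : D third_pot_g =
  4 * D (third_op x p q) * y - 4 * D (third_op y p' q') * x - 4 * w * third_form.
Proof.
rewrite /third_op /third_pot_g /third_form /third_l /third_b.
diff_ring (@Dt K A) [:: t; w; x; y; p; q; p'; q'] (tt, tw)
  (tt, D_third_w, pE, qE, pE', qE').
Qed.

Lemma third_var_op :
  - (8 * t ^+ 5 * D (third_op x p q) * D y) - D (4 * t ^+ 5 * D (third_op x p q)) * y
  - third_ev_f (third_op x p q) * q' - 4 * D (third_op x p q) * p'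
  - (- (8 * t ^+ 5 * D (third_op y p' q') * D x)
     - D (4 * t ^+ 5 * D (third_op y p' q')) * x
     - third_ev_f (third_op y p' q') * q - 4 * D (third_op y p' q') * p)
  = 2 * t ^+ 4 * D third_form + D (t ^+ 4) * third_form
    + third_b * third_pot_g + 4 * w * third_pot_f.
Proof.
rewrite /third_ev_f /third_op /third_pot_f /third_pot_g /third_form /third_l /third_b.
diff_ring (@Dt K A) [:: t; w; x; y; p; q; p'; q'] (tt, tw)
  (tt, D_third_w, pE, qE, pE', qE').
Qed.

Lemma D_third_form X : D (X * (4 * t ^+ 5 * (D x * y - x * D y))
    + X * D (t ^+ 6 * D (q * y - q' * x)) - D X * (t ^+ 6 * D (q * y - q' * x))
    + t ^+ 6 * D (D X) * (q * y - q' * x) + X * third_l * (q * y - q' * x)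
    + 4 * X * (p * y - p' * x))
  = X * third_form + 4 * t ^+ 5 * D X * (D x * y - x * D y)
    + third_ev_f X * (q * y - q' * x) + 4 * D X * (p * y - p' * x).
Proof.
rewrite /third_ev_f /third_form /third_l.
diff_ring (@Dt K A) [:: t; w; x; y; p; q; p'; q'; X] (tt, tw)
  (tt, D_third_w, pE, qE, pE', qE').
Qed.

End ThirdIdentities.

Lemma third_hamiltonian : hamiltonian a f g.
Proof.
move=> c d.
have opE (e : covector f g) : Hop a e = third_op (cx e) (cpf e) (cpg e) by [].
have hv := third_var_op (cpfE c) (cpgE c) (cpfE d) (cpgE d).
have hkf := D_third_pot_f (cpfE c) (cpgE c) (cpfE d) (cpgE d).
have hkg := D_third_pot_g (cpfE c) (cpgE c) (cpfE d) (cpgE d).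
have hX X := D_third_form (cpfE c) (cpgE c) (cpfE d) (cpgE d) X.
have eg X : evo X g = 4 * D X by rewrite ev_third_g mul0r der0 add0r.
have ef X : evo X f = third_ev_f X by rewrite ev_third_f.
have ea X : evo X a = - (4 * t ^+ 5 * D X) by rewrite ev_third_a; ring.
move: (third_pot_f _ _ _ _ _ _) (third_pot_g _ _ _ _ _ _) (third_form _ _ _ _ _ _)
  hv hkf hkg hX => kf kg k hv hkf hkg hX.
rewrite -!opE in hv hkf hkg.
exists k, kf, kg; split=> //.
- by move=> X; apply: (exact_congr (hX X)); rewrite /trilin eg ef ea; ring.
- by rewrite hkf !ef.
- by rewrite hkg !eg /g; ring.
- move: (Hop a c) (Hop a d) hv => P Q hv.
  rewrite /var_op !ef !eg !ea.
  transitivity (2 * t ^+ 4 * D k + D (t ^+ 4) * k + third_b * kg + 4 * w * kf).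
    by rewrite -hv !derN; ring.
  by rewrite /a /f /g; ring.
Qed.

Let h : A := D f * D (D w) - D (D f) * D w.

(** Only u_1 is invertible here: u_2 may vanish somewhere, so it is cancelled through its derivative
    in u_2 rather than as a unit. *)
Lemma nonzerodiv_third_w : nonzerodiv (D w).
Proof.
apply: (@nonzerodiv_pd _ _ 2); apply: (@nonzerodiv_unit _ _ _ 1).
by rewrite -[D w]/(iter 1 D w) iter_jv pd_jv mulr1.
Qed.

(** The derivative of h in u_5 comes from D (D f) alone and equals - u_1^-6 u_2. *)
Lemma nonzerodiv_third : nonzerodiv h.
Proof.
have pdt (k : nat) : k != 1%N -> pd k t = 0.
  by move=> k1; rewrite der_third pd_jv (negPf k1) mulr0 oppr0.
have pdt1 : pd 1 t = - t ^+ 2 by rewrite der_third pd_jv mulr1.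
have pdDt k : pd k.+3 (D t) = 0 by rewrite pdS_D_top ?pdt.
have pdDt2 : pd 2 (D t) = - t ^+ 2 by rewrite pdS_D_top ?pdt1 ?pdt.
have pdDDt k : pd k.+4 (D (D t)) = 0 by rewrite pdS_D_top ?pdDt.
have pdDDt3 : pd 3 (D (D t)) = - t ^+ 2 by rewrite pdS_D_top ?pdDt2 ?pdDt.
have pdf k : pd k.+4 f = 0.
  by rewrite /f /third_b !(derE_of (pd k.+4)) pdt // pdDt pdDDt; ring.
have pdf3 : pd 3 f = t ^+ 6.
  by rewrite /f /third_b !(derE_of (pd 3)) pdt // pdDt pdDDt3; ring.
have pdDf k : pd k.+4.+1 (D f) = 0 by rewrite pdS_D_top ?pdf.
have pdDDf : pd 5 (D (D f)) = t ^+ 6 by rewrite !pdS_D_top ?pdf3 ?pdf ?pdDf.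
apply: (@nonzerodiv_pd _ _ 5).
have -> : pd 5 h = - (t ^+ 6) * D w.
  rewrite /h !(derE_of (pd 5)) pdDf pdDDf -[D (D w)]/(iter 2 D w) -[D w]/(iter 1 D w).
  by rewrite !iter_jv !pd_jv /=; ring.
apply: nonzerodivM nonzerodiv_third_w; apply: nonzerodivN.
by apply: (@nonzerodiv_unit _ _ _ (w ^+ 6)); rewrite -exprMn tw expr1n.
Qed.

Lemma homog_third : homog (-1) t.
Proof.
rewrite /homog der_third ev_jv iter_jv addn0 rmorphN rmorph1.
by rewrite expr2 -mulrA tw mulr1 mulN1r.
Qed.

Lemma closed_third : is_closed (D f).
Proof.
apply/is_closedP => X Y; rewrite !ev_D !ev_third_f.
exists (Y * (D (t ^+ 6 * D (D X)) + third_l * D X)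
  - X * (D (t ^+ 6 * D (D Y)) + third_l * D Y)
  - t ^+ 6 * (D Y * D (D X) - D X * D (D Y))).
rewrite /third_l; diff_ring (@Dt K A) [:: t; X; Y] tt tt.
Qed.

Lemma third_scheme : lenard_property (op_image a f g) (D f).
Proof.
have z0 r : D 0 = r * 0 :> A by rewrite der0 mulr0.
(* Again the potentials 0 and -1 over the zero form make f the first flow. *)
have z1 : D (kcst (-1)) = g * 0 by rewrite der_cst mulr0.
pose c0 := Covector (z0 f) z1.
have hw : homog 1 w := homog_jv 1; have ht := homog_third.
have ha : homog (- 4) a by apply: (homog_eq _ (homogX 4 ht)); ring.
have hg : homog 1 g by exact: homogMn.
have hf : homog (- 5) f.
  apply/homogN/homogD.
    by apply: (homog_eq _ (homogM (homogX 3 ht) (homogX 2 (homog_Dt ht)))); ring.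
  by apply: (homog_eq _ (homogM (homogX 4 ht) (homog_Dt (homog_Dt ht)))); ring.
have hc0 : homog_cov (- 5) 1 (- 1) c0.
  by split; [exact: homog0|exact: homog0|rewrite addNr; exact: homog_const].
have flow0 : flow a (- 4) (- 5) 1 c0 (- 1) 0 = f.
  by rewrite /flow /Hop /= der0 rmorphN rmorph1; ring.
(* The potential of f D u_1 is u_2^2 / (2 u_1^6), the density of [xi3]. *)
have feE : D (kcst 2^-1 * (t ^+ 2 * D t ^+ 2)) = f * D w.
  rewrite derM der_cst mul0r add0r -[RHS](halfK); congr (_ * _); rewrite /f /third_b.
  diff_ring (@Dt K A) [:: t; w] (tt, tw) (tt, D_third_w).
have geE : D (2 * w ^+ 2) = g * D w by rewrite !derE /g; ring.
pose ce := Covector feE geE.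
have hce : Hop a ce = 0.
  have hw2 : 4 * w * (kcst 2^-1 * (t ^+ 2 * D t ^+ 2)) = 2 * w * (t ^+ 2 * D t ^+ 2) :> A.
    by rewrite -[RHS]two_halfE; ring.
  rewrite /Hop /a /f /g /= hw2 /third_b.
  diff_ring (@Dt K A) [:: t; w] (tt, tw) (tt, D_third_w).
have fE : f = kcst 1 * flow a (- 4) (- 5) 1 c0 (- 1) 0 + kcst 0 * w.
  by rewrite flow0 rmorph0 rmorph1 mul0r addr0 mul1r.
have gE : g = kcst 0 * flow a (- 4) (- 5) 1 c0 (- 1) 0 + kcst 4 * w.
  by rewrite rmorph0 rmorph_nat mul0r add0r.
have hdegf n : deg (- 4) (- 1) n.+1 + - 5 != 0 :> K.
  have -> : deg (- 4) (- 1) n.+1 + - 5 = - (4 * n + 10)%:R :> K.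
    by rewrite /deg natrD natrM -natr1; ring.
  by rewrite oppr_eq0 pnatr_eq0 addn_eq0 andbF.
have hdegg n : deg (- 4) (- 1) n.+1 + 1 != 0 :> K.
  have -> : deg (- 4) (- 1) n.+1 + 1 = - (4 * n + 4)%:R :> K.
    by rewrite /deg natrD natrM -natr1; ring.
  by rewrite oppr_eq0 pnatr_eq0 addn_eq0 andbF.
have hdeg2f i j : deg (- 4) (- 1) i.+1 + deg (- 4) (- 1) j.+1 - 1 != - 5 :> K.
  rewrite -subr_eq0 /deg; set x := (X in X != 0).
  have -> : x = - (4 * (i + j) + 6)%:R.
    by rewrite /x natrD natrM natrD -!natr1; ring.
  by rewrite oppr_eq0 pnatr_eq0 addn_eq0 andbF.
have hdeg2g i j : deg (- 4) (- 1) i.+1 + deg (- 4) (- 1) j.+1 - 1 != 1 :> K.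
  rewrite -subr_eq0 /deg; set x := (X in X != 0).
  have -> : x = - (4 * (i + j) + 12)%:R.
    by rewrite /x natrD natrM natrD -!natr1; ring.
  by rewrite oppr_eq0 pnatr_eq0 addn_eq0 andbF.
(* One factor for each of the two independent functions w and f. *)
pose E q := conj_op (D w) (conj_op h q).
pose E' Z := conj_op_adj h (conj_op_adj (D w) Z).
have EE' q Z : exact_form (E q * Z - q * E' Z).
  have := exactD (conj_op_by_parts (D w) (conj_op h q) Z)
    (conj_op_by_parts h q (conj_op_adj (D w) Z)).
  by congr exact_form; rewrite /E /E'; ring.
have pot q : exists d : covector f g, cx d = D (E q).
  have h2 : D (4 * (w * E q - D w ^+ 2 * conj_op h q)) = g * D (E q).
    by rewrite derM der_nat mul0r add0r conj_op_potential mulrA.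
  by exists (Covector (conj_op_potential2 f w q) h2).
have cl1 : is_closed (D (flow a (- 4) (- 5) 1 c0 (- 1) 0)).
  by rewrite flow0; exact: closed_third.
have nw := nonzerodiv_third_w; have nh := nonzerodiv_third.
apply: (lenard_scheme ha hf hg _ hc0 (erefl : cx ce = D w) hce (or_intror erefl) fE gE
  hdegf hdegg third_hamiltonian
  (compatible_second_order ev_third_a ev_third_f ev_third_g)
  (leading_comp (leading_conj_op _) (leading_conj_op _) : leading _ _ E)
  (nonzerodivM nw nh)
  (leading_comp (leading_conj_op_adj _) (leading_conj_op_adj _) : leading _ _ E')
  (nonzerodivM (nonzerodivN nh) (nonzerodivN nw))
  EE' pot (@closed0 K A) cl1 hdeg2f hdeg2g); first by ring.
right; exists 1; rewrite rmorph1 mul1r; congr (D _); exact: (esym flow0).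
Qed.

End ThirdHierarchy.

(** * The initial forms, and the potentials as they occur in the operators *)

Section Densities.
Context {K : numFieldType} {A : jetAlgebra K}.
Implicit Types x : A.

Local Notation D := (@Dt K A).
Local Notation half := (kcst 2^-1 : A).

Lemma adj1_order3 x : (forall k, (3 <= k)%N -> pd k x = 0) ->
  adj x 1 = pd 0 x - D (pd 1 x) + D (D (pd 2 x)).
Proof.
move=> h; rewrite (adjE 1 h) !big_ord_recl big_ord0 /= !mulr1 /negD derN opprK.
by rewrite addr0 addrA.
Qed.

Lemma pd_jv_order3 (i k : nat) : (i < 3)%N -> (3 <= k)%N -> pd k (jv i) = 0 :> A.
Proof. by move=> i3 k3; rewrite pd_jv gtn_eqF // (leq_trans i3). Qed.

Lemma dym_density (u2r s : A) : u2r ^+ 2 = jv 2 -> s * u2r = 1 ->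
  adj u2r 1 = half * D (D s).
Proof.
move=> u2rE sE.
have du (d : derivation (@kcst K A)) : d u2r = half * s * d (jv 2).
  by rewrite -[LHS]mul1r -sE -u2rE derX expr1 -[LHS]halfK; ring.
rewrite adj1_order3 => [|k k3]; last by rewrite du pd_jv_order3 // mulr0.
rewrite !du !pd_jv /= !mulr0 der0 subrr add0r mulr1 derM der_cst mul0r add0r.
by rewrite derM der_cst mul0r add0r.
Qed.

Lemma second_density (v : A) : v * jv 2 = 1 ->
  adj (half * jv 1 ^+ 6 * v) 1 = D (second_density_flow v).
Proof.
move=> vE; have vw := vDw vE; have DDw1 := DDw vE.
have pdE k : pd k (half * jv 1 ^+ 6 * v) =
    3 * jv 1 ^+ 5 * v * pd k (jv 1) - half * jv 1 ^+ 6 * v ^+ 2 * pd k (jv 2).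
  rewrite !(derM, derX, der_cst, der_second vE) -[3 * _ * _ * _]halfK; ring.
rewrite adj1_order3 => [|k k3]; last by rewrite pdE !pd_jv_order3 // !mulr0 subrr.
rewrite !pdE !pd_jv /= !mulr0 !subrr !mulr1 sub0r subr0 -derN -derD; congr (D _).
have -> : half * jv 1 ^+ 6 * v ^+ 2 = half * (jv 1 ^+ 6 * v ^+ 2) by ring.
rewrite sub0r derN derM der_cst mul0r add0r.
have -> : D (jv 1 ^+ 6 * v ^+ 2) = 2 * (3 * jv 1 ^+ 5 * v + jv 1 ^+ 6 * v * D v).
  diff_ring (@Dt K A) [:: jv 1; v] (tt, vw) (tt, DDw1).
by rewrite halfK /second_density_flow; ring.
Qed.

Lemma third_density (t : A) : t * jv 1 = 1 ->
  adj (half * jv 2 ^+ 2 * t ^+ 6) 1 = D (third_b t).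
Proof.
move=> tw.
have pdE k : pd k (half * jv 2 ^+ 2 * t ^+ 6) =
    jv 2 * t ^+ 6 * pd k (jv 2) - 3 * jv 2 ^+ 2 * t ^+ 7 * pd k (jv 1).
  rewrite !(derM, derX, der_cst, der_third tw) -[X in X - _]halfK -[X in _ - X]halfK; ring.
rewrite adj1_order3 => [|k k3]; last by rewrite pdE !pd_jv_order3 // !mulr0 subrr.
rewrite !pdE !pd_jv /= !mulr0 !subrr !mulr1 sub0r !subr0 sub0r derN opprK addrC -derD; congr (D _).
have -> : jv 2 = D (jv 1) :> A by exact: esym (iter_jv 1 1).
rewrite /third_b; diff_ring (@Dt K A) [:: jv 1; t] (tt, tw) (tt, D_third_w tw).
Qed.

(** [cpf e] and twice [cpg e] are primitives of the same function, with possibly different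
    constants; the operator sees only their mean. *)
Lemma dym_covector (s : A) (e : covector (- (2 * D s)) (- D s)) :
  D (half * cpf e + cpg e) = - (2 * D s) * cx e.
Proof.
by rewrite derD derM der_cst mul0r add0r cpfE cpgE -[- D s * _]halfK -[RHS]halfK; ring.
Qed.

Lemma dym_HopE (s : A) (e : covector (- (2 * D s)) (- D s)) :
  Hop (2 * s ^+ 2) e = 2 * (2 * s ^+ 2 * D (cx e) + D (s ^+ 2) * cx e)
    - - (2 * D s) * (half * cpf e + cpg e).
Proof. by rewrite /Hop !derE -[- D s * cpf e]halfK; ring. Qed.

Lemma quarterK x : half * (half * (4 * x)) = x.
Proof. by rewrite -[RHS]halfK -[2 * x]halfK; ring. Qed.

(** Again a mean of two primitives of one function: [cpf e] and a quarter of [cpg e]. *)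
Lemma second_covector (w : A) (e : covector w (4 * w)) :
  D (half * (cpf e + half * (half * cpg e))) = w * cx e.
Proof.
rewrite !(derM, derD, der_cst) cpfE cpgE !mul0r !add0r -mulrA quarterK.
by rewrite -[RHS]halfK; ring.
Qed.

Lemma second_HopE (a w : A) (e : covector w (4 * w)) :
  Hop a e = 2 * a * D (cx e) + D a * cx e
    - 8 * (w * (half * (cpf e + half * (half * cpg e)))).
Proof.
by rewrite /Hop -[w * cpg e]quarterK -[X in _ - X = _]halfK -[X in _ - X - _]halfK; ring.
Qed.

Lemma third_bE (t : A) : t * jv 1 = 1 ->
  third_b t = jv 3 * t ^+ 6 - 3 * jv 2 ^+ 2 * t ^+ 7.
Proof.
move=> tw; have -> : jv 3 = D (D (jv 1)) :> A by exact: esym (iter_jv 2 1).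
have -> : jv 2 = D (jv 1) :> A by exact: esym (iter_jv 1 1).
rewrite /third_b; diff_ring (@Dt K A) [:: jv 1; t] (tt, tw) (tt, D_third_w tw).
Qed.

Lemma third_covector (f w : A) (e : covector f (4 * w)) :
  D (half * (half * cpg e)) = w * cx e.
Proof. by rewrite !(derM, der_cst) cpgE !mul0r !add0r -mulrA quarterK. Qed.

Lemma third_HopE (a f w : A) (e : covector f (4 * w)) :
  Hop a e = 2 * a * D (cx e) + D a * cx e
    - 4 * (f * (half * (half * cpg e))) - 4 * (w * cpf e).
Proof. by rewrite /Hop -[f * cpg e]quarterK; ring. Qed.

End Densities.

(** * Calculus on jets *)

Section JetTopology.
Context {R : realType}.
Implicit Types (U : set (jet R)) (v w : jet R) (f g : jet R -> R) (k n : nat) (t : R).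

Definition jet_upd v k t : jet R := dfwith v k t.

Lemma jet_upd_in v k t : jet_upd v k t k = t.
Proof. exact: dfwith_in. Qed.

Lemma jet_upd_out v k t i : k != i -> jet_upd v k t i = v i.
Proof. exact: dfwith_out. Qed.

Lemma jet_upd_id v k : jet_upd v k (v k) = v.
Proof.
by apply/funext => i; rewrite /jet_upd; case: (dfwithP (v : forall i, (fun=> R) i)).
Qed.

Lemma jet_updK v k s t : jet_upd (jet_upd v k s) k t = jet_upd v k t.
Proof.
apply/funext => i; have [<-|ki] := eqVneq k i; first by rewrite !jet_upd_in.
by rewrite !jet_upd_out.
Qed.

Lemma jet_updC v i j s t : i != j ->
  jet_upd (jet_upd v i s) j t = jet_upd (jet_upd v j t) i s.
Proof.
move=> ij; apply/funext => k; have [<-|jk] := eqVneq j k.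
  by rewrite jet_upd_in jet_upd_out // jet_upd_in.
rewrite jet_upd_out //; have [<-|ik] := eqVneq i k; first by rewrite !jet_upd_in.
by rewrite !jet_upd_out.
Qed.

Lemma jet_upd_continuous v k : continuous (jet_upd v k : R -> jet R).
Proof. exact: (@dfwith_continuous _ (fun=> R)). Qed.

(** The sets that contain such a box form a filter, so it suffices to treat subbasic neighbourhoods,
    which restrict one coordinate. *)
Lemma nbhs_box v U : nbhs v U -> exists n (e : R), 0 < e /\
  forall w, (forall i, (i < n)%N -> `|v i - w i| < e) -> U w.
Proof.
pose box (A : set (jet R)) := exists n (e : R), 0 < e /\
  forall w, (forall i, (i < n)%N -> `|v i - w i| < e) -> A w.
have boxF : Filter box.
  split.
  - by exists 0%N, 1; split.
  - move=> A B [n [e [e0 hA]]] [m [d [d0 hB]]].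
    exists (maxn n m), (Num.min e d); split; first by rewrite lt_min e0.
    move=> w hw; split; [apply: hA|apply: hB] => i lt_i.
      by have := hw i; rewrite leq_max lt_i lt_min => /(_ isT)/andP[].
    by have := hw i; rewrite leq_max lt_i orbT lt_min => /(_ isT)/andP[].
  - move=> A B AB [n [e [e0 hA]]]; exists n, e; split=> // w hw; exact/AB/hA.
case=> P [] [] Q QfinP <- [] V JV Vv PU; change (box U); apply: (filterS PU).
apply: (@filterS _ _ _ V); first by exists V.
have [L Lsub /[dup] VL <-] := QfinP _ JV.
apply: filter_bigI => /= M /[dup] LM /Lsub /set_mem [] k _ [+] + /[dup] + <-.
move=> N oN NM; have Nv : N (v k) by move: Vv; rewrite -VL => /(_ _ LM); rewrite -NM.
have /nbhs_ballP[e /= e0 eN] : nbhs (v k) N by exact: open_nbhs_nbhs.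
exists k.+1, e; split=> // w /(_ k (ltnSn k)) vw.
exact: (eN (w k)).
Qed.

Lemma jet_upd_near U v k : open U -> U v -> \forall t \near v k, U (jet_upd v k t).
Proof.
move=> oU Uv; have h : nbhs (jet_upd v k (v k)) U.
  by rewrite jet_upd_id; exact: open_nbhs_nbhs.
exact: (@jet_upd_continuous v k (v k) U h).
Qed.

End JetTopology.

(** * Closure properties of smooth functions *)

Section SmoothFunctions.
Context {R : realType}.
Variable U : set (jet R).
Hypothesis oU : open U.
Implicit Types (v w : jet R) (f g : jet R -> R) (k n : nat) (t : R).

Definition regular f := forall v, U v ->
  {for v, continuous f} /\ forall k, derivable (fun t : R => f (jet_upd v k t)) (v k) 1.

Definition eq_on f g := forall v, U v -> f v = g v.

Lemma smoothP f : smooth U f <-> regular f /\ forall k, smooth U (partial k f).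
Proof.
split=> [h|[h0 h] s].
  split=> [v Uv|k s v Uv]; first exact: (h [::] v Uv).
  by have := h (rcons s k) v Uv; rewrite foldr_rcons.
elim/last_ind: s => [|s k _] v Uv; first exact: h0.
by rewrite foldr_rcons; exact: h.
Qed.

Lemma eq_on_sym f g : eq_on f g -> eq_on g f.
Proof. by move=> h v Uv; rewrite h. Qed.

Lemma near_upd_eq f g v k : U v -> eq_on f g ->
  \forall t \near v k, f (jet_upd v k t) = g (jet_upd v k t).
Proof. by move=> Uv fg; apply: filterS (jet_upd_near k oU Uv) => t; exact: fg. Qed.

Lemma eq_partial k f g : eq_on f g -> eq_on (partial k f) (partial k g).
Proof.
move=> fg v Uv; rewrite /partial !derive1E; apply: near_eq_derive.
exact: near_upd_eq.
Qed.

Lemma eq_regular f g : eq_on f g -> regular f -> regular g.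
Proof.
move=> fg rf v Uv; have [cf df] := rf v Uv; split=> [|k].
  rewrite /prop_for /continuous_at -(fg v Uv); apply: cvg_trans cf.
  have h : \forall w \near v, f w = g w.
    by have := @open_nbhs_nbhs _ v U (conj oU Uv); apply: filterS => w; exact: fg.
  exact: near_eq_cvg h.
by apply: near_eq_derivable (df k); exact: near_upd_eq.
Qed.

(** Smoothness graded by the number of derivatives. Derivatives of products and inverses contain the
    functions themselves, so closure is proved by induction on n together with [CnW]. *)
Fixpoint Cn n f : Prop :=
  regular f /\ if n is m.+1 then forall k, Cn m (partial k f) else True.

Lemma Cn_regular n f : Cn n f -> regular f.
Proof. by case: n => [|n] []. Qed.

Lemma smooth_Cn f : smooth U f <-> forall n, Cn n f.
Proof.
split=> [+ n|h s].
  elim: n f => [|n IHn] f /smoothP[rf sf]; first by split.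
  by split=> // k; apply: IHn.
elim/last_ind: s f h => [|s k IHs] f h v Uv.
  exact: (Cn_regular (h 0%N)).
rewrite foldr_rcons; apply: IHs => // n; by have [_] := h n.+1; apply.
Qed.

Lemma eq_Cn n f g : eq_on f g -> Cn n f -> Cn n g.
Proof.
elim: n f g => [|n IHn] f g fg [rf cf]; first by split; first exact: eq_regular rf.
split; first exact: eq_regular rf.
by move=> k; apply: IHn (eq_partial k fg) (cf k).
Qed.

Lemma CnW n f : Cn n.+1 f -> Cn n f.
Proof.
elim: n f => [|n IHn] f [rf cf]; split=> // k.
exact: IHn.
Qed.

Lemma partialD k f g : regular f -> regular g ->
  eq_on (partial k (f + g)) (partial k f + partial k g).
Proof.
move=> rf rg v Uv; have [_ /(_ k) df] := rf v Uv; have [_ /(_ k) dg] := rg v Uv.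
by have := deriveD df dg; rewrite -!derive1E.
Qed.

Lemma partialN k f : regular f -> eq_on (partial k (- f)) (- partial k f).
Proof.
move=> rf v Uv; have [_ /(_ k) df] := rf v Uv.
by have := deriveN df; rewrite -!derive1E.
Qed.

Lemma partialM k f g : regular f -> regular g ->
  eq_on (partial k (f * g)) (partial k f * g + f * partial k g).
Proof.
move=> rf rg v Uv; have [_ /(_ k) df] := rf v Uv; have [_ /(_ k) dg] := rg v Uv.
have := deriveM df dg; rewrite -!derive1E !jet_upd_id => h.
by apply: etrans h _; rewrite addrC; congr (_ + _); exact: mulrC.
Qed.

Lemma partialV k f : regular f -> (forall v, U v -> f v != 0) ->
  eq_on (partial k (fun v => (f v)^-1))
    (- ((fun v => (f v)^-1) * (fun v => (f v)^-1) * partial k f)).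
Proof.
move=> rf f0 v Uv; have [_ /(_ k) df] := rf v Uv.
have f0' : f (jet_upd v k (v k)) != 0 by rewrite jet_upd_id f0.
have := deriveV f0' df; rewrite -!derive1E jet_upd_id => h.
apply: etrans h _; rewrite scaleNr; congr (- _).
by rewrite -exprVn expr2.
Qed.

Lemma regularD f g : regular f -> regular g -> regular (f + g).
Proof.
move=> rf rg v Uv; have [cf df] := rf v Uv; have [cg dg] := rg v Uv.
split=> [|k]; first exact: (cvgD cf cg).
exact: derivableD (df k) (dg k).
Qed.

Lemma regularN f : regular f -> regular (- f).
Proof.
move=> rf v Uv; have [cf df] := rf v Uv.
split=> [|k]; first exact: (cvgN cf).
exact: derivableN (df k).
Qed.

Lemma regularM f g : regular f -> regular g -> regular (f * g).
Proof.
move=> rf rg v Uv; have [cf df] := rf v Uv; have [cg dg] := rg v Uv.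
split=> [|k]; first exact: (cvgM cf cg).
exact: derivableM (df k) (dg k).
Qed.

Lemma regularV f : regular f -> (forall v, U v -> f v != 0) -> regular (fun v => (f v)^-1).
Proof.
move=> rf f0 v Uv; have [cf df] := rf v Uv.
split=> [|k]; first exact: (cvgV (f0 v Uv) cf).
by apply: derivableV (df k); rewrite jet_upd_id f0.
Qed.

Lemma regular_cst c : regular (fun=> c).
Proof.
move=> v Uv; split=> [|k]; first exact: (@cst_continuous (jet R) R c v).
exact: (derivable_cst c).
Qed.

Lemma partial_cst k c : partial k (fun=> c) = fun=> 0 :> R.
Proof. by apply/funext => v; exact: derive1_cst. Qed.

Lemma regular_coord i : regular (fun v => v i).
Proof.
move=> v Uv; split=> [|k]; first exact: (@proj_continuous _ (fun=> R) i v).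
have [<-|ki] := eqVneq k i.
  rewrite (_ : (fun _ => _) = id) //; apply/funext => t; exact: jet_upd_in.
rewrite (_ : (fun _ => _) = cst (v i)) //.
by apply/funext => t; exact: jet_upd_out.
Qed.

Lemma partial_coord k i : partial k (fun v : jet R => v i) = fun=> (k == i)%:R.
Proof.
apply/funext => v; rewrite /partial; have [<-|ki] := eqVneq k i.
  rewrite (_ : (fun _ => _) = id) ?derive1_id //; apply/funext => t; exact: jet_upd_in.
rewrite (_ : (fun _ => _) = cst (v i)) ?derive1_cst //.
by apply/funext => t; exact: jet_upd_out.
Qed.

Lemma CnD n f g : Cn n f -> Cn n g -> Cn n (f + g).
Proof.
elim: n f g => [|n IHn] f g [rf cf] [rg cg].
  by split; first exact: regularD.
split; first exact: regularD.
move=> k; apply: eq_Cn (eq_on_sym (partialD k rf rg)) _; exact: IHn (cf k) (cg k).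
Qed.

Lemma CnN n f : Cn n f -> Cn n (- f).
Proof.
elim: n f => [|n IHn] f [rf cf]; first by split; first exact: regularN.
split; first exact: regularN.
move=> k; apply: eq_Cn (eq_on_sym (partialN k rf)) _; exact: IHn (cf k).
Qed.

Lemma CnM n f g : Cn n f -> Cn n g -> Cn n (f * g).
Proof.
elim: n f g => [|n IHn] f g cf cg.
  by split; first exact: regularM (Cn_regular cf) (Cn_regular cg).
have [rf cf'] := cf; have [rg cg'] := cg; split; first exact: regularM.
move=> k; apply: eq_Cn (eq_on_sym (partialM k rf rg)) _; apply: CnD.
  exact: IHn (cf' k) (CnW cg).
exact: IHn (CnW cf) (cg' k).
Qed.

Lemma CnV n f : (forall v, U v -> f v != 0) -> Cn n f -> Cn n (fun v => (f v)^-1).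
Proof.
move=> f0; elim: n f f0 => [|n IHn] f f0 cf.
  by split; first exact: regularV (Cn_regular cf) f0.
have [rf cf'] := cf; split; first exact: regularV.
move=> k; apply: eq_Cn (eq_on_sym (partialV k rf f0)) _; apply: CnN.
by apply: CnM (cf' k); apply: CnM; apply: IHn (CnW cf).
Qed.

Lemma Cn_cst n c : Cn n (fun=> c).
Proof.
elim: n c => [|n IHn] c; split=> //; try exact: regular_cst.
by move=> k; rewrite partial_cst.
Qed.

Lemma Cn_coord n i : Cn n (fun v => v i).
Proof.
case: n => [|n]; split=> //; try exact: regular_coord.
by move=> k; rewrite partial_coord; exact: Cn_cst.
Qed.

Lemma smooth_regular f : smooth U f -> regular f.
Proof. by case/smoothP. Qed.

End SmoothFunctions.

Lemma MVT_closed (R : realType) (phi dphi : R -> R) (a h : R) : 0 <= h ->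
  (forall t, a <= t <= a + h -> is_derive t 1 phi (dphi t)) ->
  exists2 t, a <= t <= a + h & phi (a + h) - phi a = dphi t * h.
Proof.
move=> h0 der.
have derc : {in `[a, a + h]%R, forall t, derivable phi t 1}.
  by move=> t; rewrite in_itv /= => /der [].
have hle : a <= a + h by rewrite lerDl.
have dero t : t \in `]a, a + h[%R -> is_derive t 1 phi (dphi t).
  by move=> /subset_itv_oo_cc; rewrite in_itv /=; exact: der.
have [t tin tE] := MVT_segment hle dero (derivable_within_continuous derc).
exists t; first by rewrite in_itv in tin.
by rewrite tE [a + h]addrC addrK.
Qed.

Lemma half_distance_absurd (R : realType) (x y b : R) :
  `|x - b| < `|x - y| / 2 -> `|y - b| < `|x - y| / 2 -> False.
Proof.
move=> h1 h2; have := le_lt_trans (ler_normB (x - b) (y - b)) (ltrD h1 h2).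
by rewrite -splitr (_ : x - b - (y - b) = x - y) ?ltxx //; ring.
Qed.

(** * Mean values, constancy and symmetry of second derivatives *)

Section DifferentialCalculus.
Context {R : realType}.
Variable U : set (jet R).
Hypothesis oU : open U.
Implicit Types (v w z : jet R) (f g : jet R -> R) (i j k n : nat) (t : R).

Lemma is_derive_upd f z k t : regular U f -> U (jet_upd z k t) ->
  is_derive t 1 (fun s : R => f (jet_upd z k s)) (partial k f (jet_upd z k t)).
Proof.
move=> rf Uz; have [_ /(_ k)] := rf _ Uz; rewrite jet_upd_in.
have E : (fun s : R => f (jet_upd (jet_upd z k t) k s)) = (fun s : R => f (jet_upd z k s)).
  by apply/funext => s; rewrite jet_updK.
rewrite E => df; apply: DeriveDef => //.
by rewrite /partial -/(jet_upd _ _) derive1E jet_upd_in; congr ('D_1 _ t); rewrite -E.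
Qed.

Lemma MVT_upd f z k (a h : R) : regular U f -> 0 <= h ->
  (forall t, a <= t <= a + h -> U (jet_upd z k t)) ->
  exists2 t, a <= t <= a + h &
    f (jet_upd z k (a + h)) - f (jet_upd z k a) = partial k f (jet_upd z k t) * h.
Proof.
move=> rf h0 Uz.
apply: (@MVT_closed _ (fun s : R => f (jet_upd z k s))
  (fun t => partial k f (jet_upd z k t)) a h h0) => t /Uz.
exact: is_derive_upd.
Qed.

Lemma partial0_eq_upd f z k (a b : R) : regular U f ->
  eq_on U (partial k f) (fun=> 0) ->
  (forall t, Num.min a b <= t <= Num.max a b -> U (jet_upd z k t)) ->
  f (jet_upd z k a) = f (jet_upd z k b).
Proof.
move=> rf f0; wlog le_ab : a b / a <= b.
  move=> IH; case/orP: (le_total a b) => [/IH//|ba h].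
  by symmetry; apply: IH => // t; rewrite minC maxC; exact: h.
rewrite min_l // max_r // => Uz.
have [|t|t tin] := @MVT_upd f z k a (b - a) rf; first by rewrite subr_ge0.
  by rewrite addrC subrK; exact: Uz.
rewrite addrC subrK in tin *; rewrite f0; last exact: Uz.
by rewrite mul0r => /eqP; rewrite subr_eq0 => /eqP.
Qed.

Definition has_order n f := forall v w, U v -> U w ->
  (forall k, (k < n)%N -> v k = w k) -> f v = f w.

Lemma has_order_partial0 n k f : has_order n f -> (n <= k)%N ->
  eq_on U (partial k f) (fun=> 0).
Proof.
move=> hf nk v Uv; rewrite /partial derive1E -[RHS](derive_cst (f v) (v k) 1).
apply: near_eq_derive; apply: filterS (jet_upd_near k oU Uv) => t Ut.
apply: hf => // i lt_in; apply: jet_upd_out.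
by rewrite gtn_eqF // (leq_trans lt_in).
Qed.

Lemma has_order_partial n k f : has_order n f -> has_order n (partial k f).
Proof.
move=> hf v w Uv Uw vw; case: (leqP n k) => [nk|kn].
  by rewrite !(has_order_partial0 hf nk).
rewrite /partial !derive1E -(vw k kn); apply: near_eq_derive.
have Nw := jet_upd_near k oU Uw; rewrite -(vw k kn) in Nw.
have Nv := jet_upd_near k oU Uv.
apply: filterS2 Nv Nw => t Uvt Uwt; apply: hf => // i lt_in.
have [<-|ki] := eqVneq k i.
  by rewrite [LHS](jet_upd_in v k t) [RHS](jet_upd_in w k t).
by rewrite [LHS](jet_upd_out v t ki) [RHS](jet_upd_out w t ki) vw.
Qed.

(** Inside a box around v, the coordinates of v are replaced one by one by those of w. By the mean
    value theorem no replacement changes f, and after n of them f cannot tell the point from w. *)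
Lemma locally_constant n f v : has_order n f -> regular U f ->
  (forall k, eq_on U (partial k f) (fun=> 0)) -> U v -> nbhs v [set w : jet R | f w = f v].
Proof.
move=> hf rf f0 Uv.
have [m [e [e0 hb]]] := nbhs_box (@open_nbhs_nbhs _ v U (conj oU Uv)).
have nW l : nbhs v [set w : jet R | forall i, (i < l)%N -> `|v i - w i| < e].
  elim: l => [|l IHl].
    rewrite (_ : [set _ | _] = setT); first exact: filterT.
    by apply/seteqP; split=> // w _ i; rewrite ltn0.
  have hl : nbhs v [set w : jet R | `|v l - w l| < e].
    have cl : {for v, continuous (fun w : jet R => w l)}.
      exact: (@proj_continuous _ (fun=> R) l v).
    by have /(_ (nbhs_filter v) e e0) :=
      (@cvgrPdist_lt _ _ _ (nbhs v) _ (fun w : jet R => w l) (v l)).1 cl.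
  rewrite (_ : [set _ | _] = [set w : jet R | forall i, (i < l)%N -> `|v i - w i| < e]
    `&` [set w : jet R | `|v l - w l| < e]); first exact: filterI IHl hl.
  apply/seteqP; split=> [w h|w [h1 h2] i] /=.
    by split=> [i il|]; apply: h; rewrite ltnS // ltnW.
  rewrite ltnS leq_eqVlt => /orP[/eqP ->//|]; exact: h1.
suff h : [set w : jet R | forall i, (i < m)%N -> `|v i - w i| < e] `<=` [set w | f w = f v].
  exact: (@filterS _ (nbhs v) (nbhs_filter v) _ _ h (nW m)).
move=> w Ww; pose z i : jet R := fun j => if (j < i)%N then w j else v j.
have Uz i : U (z i).
  apply: hb => j lt_jm; rewrite /z; case: ifP => _; first exact: Ww.
  by rewrite subrr normr0.
have zS i : z i.+1 = jet_upd (z i) i (w i).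
  apply/funext => j; have [<-|ij] := eqVneq i j.
    by rewrite jet_upd_in /z ltnSn.
  by rewrite jet_upd_out // /z ltnS leq_eqVlt eq_sym (negPf ij).
have fz i : f (z i) = f v.
  elim: i => [|i <-]; first by congr f; apply/funext.
  have -> : z i = jet_upd (z i) i (v i).
    by rewrite -[in LHS](jet_upd_id (z i) i) {2}/z ltnn.
  rewrite zS; symmetry; apply: partial0_eq_upd => // t tin.
  apply: hb => j; have [<-|ij] := eqVneq i j => lt_jm; last first.
    rewrite jet_upd_out // /z; case: ifP => _; first exact: Ww.
    by rewrite subrr normr0.
  rewrite jet_upd_in; have := Ww i lt_jm; rewrite !ltr_norml => /andP[h1 h2].
  case/andP: tin; case: (leP (v i) (w i)) => vw tv tw; apply/andP; split; lra.
change (f w = f v); rewrite -(fz n); apply: hf => //; first exact: hb.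
by move=> k kn; rewrite /z kn.
Qed.

(** Local constancy makes both the level set of f through v and its complement in U open. *)
Lemma constant_on n f : connected U -> has_order n f -> regular U f ->
  (forall k, eq_on U (partial k f) (fun=> 0)) -> forall v w, U v -> U w -> f v = f w.
Proof.
move=> cU hf rf f0 v w Uv Uw.
have opn (P : R -> Prop) : open (U `&` [set z | P (f z)]).
  rewrite openE => z [Uz Pz]; have := locally_constant hf rf f0 Uz => h.
  have hU := @filterI _ _ (nbhs_filter z) _ _ h (@open_nbhs_nbhs _ z U (conj oU Uz)).
  suff sub : [set w | f w = f z] `&` U `<=` U `&` [set y | P (f y)].
    exact: (@filterS _ (nbhs z) (nbhs_filter z) _ _ sub hU).
  by move=> y [yz Uy]; split=> //=; rewrite yz.
suff E : U `&` [set z | f z = f v] = U by have [] : (U `&` [set z | f z = f v]) w by rewrite E.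
apply: cU; first by exists v.
  exists (U `&` [set z | f z = f v]); first exact: (opn (fun c => c = f v)).
  by rewrite setIA setIid.
exists (~` (U `&` [set z | f z <> f v])); first exact/open_closedC/(opn (fun c => c <> f v)).
apply/seteqP; split=> z [Uz] h; split=> //=.
  by move=> [_]; exact.
by apply: contrapT => h'; apply: h; split.
Qed.

Lemma second_difference f v i j (h : R) : i != j -> 0 <= h ->
  regular U f -> regular U (partial i f) ->
  (forall s t, v i <= s <= v i + h -> v j <= t <= v j + h ->
     U (jet_upd (jet_upd v i s) j t)) ->
  exists s t, [/\ v i <= s <= v i + h, v j <= t <= v j + h &
    f (jet_upd (jet_upd v i (v i + h)) j (v j + h)) - f (jet_upd (jet_upd v i (v i)) j (v j + h))
    - (f (jet_upd (jet_upd v i (v i + h)) j (v j)) - f (jet_upd (jet_upd v i (v i)) j (v j)))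
    = partial j (partial i f) (jet_upd (jet_upd v i s) j t) * h * h].
Proof.
move=> ij h0 rf rif Uh.
have vj : v j <= v j <= v j + h by rewrite lexx lerDl.
have vjh : v j <= v j + h <= v j + h by rewrite lexx lerDl h0.
have der y (s : R) : v i <= s <= v i + h -> v j <= y <= v j + h ->
    is_derive s 1 (fun x : R => f (jet_upd (jet_upd v i x) j y))
      (partial i f (jet_upd (jet_upd v i s) j y)).
  move=> hs hy; have := Uh s y hs hy.
  have -> : (fun x : R => f (jet_upd (jet_upd v i x) j y)) =
      (fun x : R => f (jet_upd (jet_upd v j y) i x)).
    by apply/funext => x; rewrite jet_updC.
  by rewrite (jet_updC v s y ij); exact: is_derive_upd.
have [s hs sE] := @MVT_closed _ (fun x => f (jet_upd (jet_upd v i x) j (v j + h))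
     - f (jet_upd (jet_upd v i x) j (v j)))
   (fun x => partial i f (jet_upd (jet_upd v i x) j (v j + h))
     - partial i f (jet_upd (jet_upd v i x) j (v j))) (v i) h h0
   (fun s hs => is_deriveB (der _ s hs vjh) (der _ s hs vj)).
have [t ht tE] := @MVT_upd (partial i f) (jet_upd v i s) j (v j) h rif h0
  (fun t ht => Uh s t hs ht).
by exists s, t; split=> //; rewrite -tE -sE; ring.
Qed.

(** The second difference over a small square is symmetric in i and j, and two mean value arguments
    equate it to h^2 times either mixed derivative. So these agree at two points near v, which
    contradicts continuity if they differ at v. *)
Lemma partialC f i j : smooth U f ->
  eq_on U (partial i (partial j f)) (partial j (partial i f)).
Proof.
move=> /smoothP [rf sf] v Uv; have [->//|ij] := eqVneq i j.
have [ri _] := (smoothP _ _).1 (sf i); have [rj _] := (smoothP _ _).1 (sf j).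
have cij := (((smoothP _ _).1 ((((smoothP _ _).1 (sf j)).2) i)).1 v Uv).1.
have cji := (((smoothP _ _).1 ((((smoothP _ _).1 (sf i)).2) j)).1 v Uv).1.
apply/eqP/negPn/negP; rewrite -subr_eq0 -normr_gt0.
set A := partial i (partial j f) in cij *; set B := partial j (partial i f) in cji *.
move=> AB0; pose eps := `|A v - B v| / 2.
have eps0 : 0 < eps by rewrite divr_gt0.
have nA : nbhs v [set w : jet R | `|A v - A w| < eps].
  by have /(_ (nbhs_filter v) eps eps0) := (@cvgrPdist_lt _ _ _ (nbhs v) _ A (A v)).1 cij.
have nB : nbhs v [set w : jet R | `|B v - B w| < eps].
  by have /(_ (nbhs_filter v) eps eps0) := (@cvgrPdist_lt _ _ _ (nbhs v) _ B (B v)).1 cji.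
have nU := @open_nbhs_nbhs _ v U (conj oU Uv).
have hI := @filterI _ _ (nbhs_filter v) _ _ nU (@filterI _ _ (nbhs_filter v) _ _ nA nB).
have [n [e [e0 he]]] := nbhs_box hI.
pose h := e / 2; have h0 : 0 < h by rewrite divr_gt0.
have near_v s t : v i <= s <= v i + h -> v j <= t <= v j + h ->
    (U `&` ([set w | `|A v - A w| < eps] `&` [set w | `|B v - B w| < eps]))
      (jet_upd (jet_upd v i s) j t).
  have small x y : x <= y <= x + h -> `|x - y| < e.
    move=> /andP[xy yx]; rewrite distrC ger0_norm ?subr_ge0 //; rewrite /h in yx; lra.
  move=> hs ht; apply: he => k _; have [<-|jk] := eqVneq j k.
    by rewrite jet_upd_in small.
  rewrite jet_upd_out //; have [<-|ik] := eqVneq i k; first by rewrite jet_upd_in small.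
  by rewrite jet_upd_out // subrr normr0.
have [s [t [hs ht E1]]] := second_difference ij (ltW h0) rf ri
  (fun s t hs ht => (near_v s t hs ht).1).
have ji : j != i by rewrite eq_sym.
have near_v' t' s' : v j <= t' <= v j + h -> v i <= s' <= v i + h ->
    U (jet_upd (jet_upd v j t') i s').
  by move=> ht' hs'; rewrite jet_updC //; exact: (near_v s' t' hs' ht').1.
have [t' [s' [ht' hs' E2]]] := second_difference ji (ltW h0) rf rj near_v'.
have {}E2 : A (jet_upd (jet_upd v i s') j t') = B (jet_upd (jet_upd v i s) j t).
  have hn0 := lt0r_neq0 h0.
  suff key : A (jet_upd (jet_upd v i s') j t') * h * h
      = B (jet_upd (jet_upd v i s) j t) * h * h by exact: (mulIf hn0 (mulIf hn0 key)).
  have diffC (a b c d x y : R) : a - b - (c - d) = x -> a - c - (b - d) = y -> x = y.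
    by move=> <- <-; ring.
  rewrite !(jet_updC v _ _ ji) in E2; exact: diffC E2 E1.
have [_ [h1 _]] := near_v s' t' hs' ht'; have [_ [_ h2]] := near_v s t hs ht.
move: h1 h2 => /=; rewrite E2 => h1 h2.
exact: (half_distance_absurd h1 h2).
Qed.

End DifferentialCalculus.

(** * Differential functions as a jet algebra *)

Section DiffFunctions.
Context {R : realType}.
Variable U : set (jet R).
Hypothesis oU : open U.
Implicit Types (v w : jet R) (f g : jet R -> R) (k n : nat).

Lemma diffD f g : diff_function U f -> diff_function U g ->
  diff_function U (fun v => f v + g v).
Proof.
move=> [[n hf] sf] [[m hg] sg]; split.
  exists (maxn n m) => v w Uv Uw vw.
  by rewrite (hf v w) ?(hg v w) // => k hk; apply: vw; rewrite leq_max hk ?orbT.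
apply/smooth_Cn => l; exact: (CnD oU ((smooth_Cn U f).1 sf l) ((smooth_Cn U g).1 sg l)).
Qed.

Lemma diffN f : diff_function U f -> diff_function U (fun v => - f v).
Proof.
move=> [[n hf] sf]; split; first by exists n => v w Uv Uw vw; rewrite (hf v w).
by apply/smooth_Cn => l; exact: (CnN oU ((smooth_Cn U f).1 sf l)).
Qed.

Lemma diffM f g : diff_function U f -> diff_function U g ->
  diff_function U (fun v => f v * g v).
Proof.
move=> [[n hf] sf] [[m hg] sg]; split.
  exists (maxn n m) => v w Uv Uw vw.
  by rewrite (hf v w) ?(hg v w) // => k hk; apply: vw; rewrite leq_max hk ?orbT.
apply/smooth_Cn => l; exact: (CnM oU ((smooth_Cn U f).1 sf l) ((smooth_Cn U g).1 sg l)).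
Qed.

Lemma diffV f : (forall v, U v -> f v != 0) -> diff_function U f ->
  diff_function U (fun v => (f v)^-1).
Proof.
move=> f0 [[n hf] sf]; split; first by exists n => v w Uv Uw vw; rewrite (hf v w).
by apply/smooth_Cn => l; exact: (CnV oU f0 ((smooth_Cn U f).1 sf l)).
Qed.

Lemma diff_cst c : diff_function U (fun=> c).
Proof.
split; first by exists 0%N.
by apply/smooth_Cn => l; exact: Cn_cst.
Qed.

Lemma diff_coord i : diff_function U (fun v => v i).
Proof.
split; first by exists i.+1 => v w _ _; apply.
by apply/smooth_Cn => l; exact: Cn_coord.
Qed.

Lemma diff_partial k f : diff_function U f -> diff_function U (partial k f).
Proof.
move=> [[n hf] sf]; split; first by exists n; exact: (has_order_partial oU).
exact: ((smoothP _ _).1 sf).2.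
Qed.

Lemma eq_diff f g : eq_on U f g -> diff_function U f -> diff_function U g.
Proof.
move=> fg [[n hf] sf]; split.
  by exists n => v w Uv Uw vw; rewrite -!fg // (hf v w).
by apply/smooth_Cn => l; exact: (eq_Cn oU fg ((smooth_Cn U f).1 sf l)).
Qed.

Lemma diff_sum n (F : nat -> jet R -> R) : (forall k, diff_function U (F k)) ->
  diff_function U (fun v => \sum_(k < n) F k v).
Proof.
move=> hF; elim: n => [|n IHn].
  by apply: eq_diff (diff_cst 0) => v _; rewrite big_ord0.
by apply: eq_diff (diffD IHn (hF n)) => v _; rewrite big_ord_recr.
Qed.

Lemma fsum_ord n (F : nat -> R) : (forall k, (n <= k)%N -> F k = 0) ->
  \sum_(k \in [set: nat]) F k = \sum_(k < n) F k.
Proof.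
move=> F0; rewrite fsbig_ord; symmetry; apply: fsbig_widen => // k [_ /=].
by move/negP; rewrite -leqNgt => /F0.
Qed.

Lemma DxE n f v : has_order U n f -> U v ->
  Dx f v = \sum_(k < n) v k.+1 * partial k f v.
Proof.
move=> hf Uv; apply: (fsum_ord (F := fun k => v k.+1 * partial k f v)) => k nk.
by rewrite (has_order_partial0 oU hf nk) // mulr0.
Qed.

Lemma eq_Dx f g : eq_on U f g -> eq_on U (Dx f) (Dx g).
Proof.
by move=> fg v Uv; apply: eq_fsbigr => k _; rewrite (eq_partial oU k fg).
Qed.

Lemma diff_Dx f : diff_function U f -> diff_function U (Dx f).
Proof.
move=> df; have [[n hf] _] := df.
apply: (eq_diff (f := fun v => \sum_(k < n) v k.+1 * partial k f v)).
  by move=> v Uv; rewrite (DxE hf).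
apply: (@diff_sum n (fun k v => v k.+1 * partial k f v)) => k.
by apply: diffM; [exact: diff_coord|exact: diff_partial].
Qed.

End DiffFunctions.

Record domain (R : realType) := Domain {
  dset :> set (jet R);
  dsetP : jet_domain dset }.

Arguments dset {R} d.

(* Differential functions on a domain, normalized to vanish outside of it so
   that equality on the domain is Leibniz equality. *)
Record dfun (R : realType) (U : domain R) := DFun {
  dval : jet R -> R;
  dvalP : diff_function U dval;
  dval_out : forall v, ~ dset U v -> dval v = 0 }.

Section DfunRing.
Context {R : realType} {U : domain R}.
Implicit Types (v : jet R) (f g h : dfun U) (F G : jet R -> R).

Lemma domain_open : open (U : set (jet R)). Proof. by case: (dsetP U). Qed.
Let oU := domain_open.

Lemma dfun_eq f g : eq_on U (dval f) (dval g) -> f = g.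
Proof.
case: f g => [f fP f0] [g gP g0] /= fg.
have E : f = g.
  apply/funext => v; case: (pselect (dset U v)) => [/fg//|nU]; by rewrite f0 // g0.
by subst g; congr DFun; exact: Prop_irrelevance.
Qed.

Definition restrict F v := if pselect (dset U v) then F v else 0.

Lemma restrict_in F v : dset U v -> restrict F v = F v.
Proof. by rewrite /restrict; case: pselect. Qed.

Lemma restrict_out F v : ~ dset U v -> restrict F v = 0.
Proof. by rewrite /restrict; case: pselect. Qed.

Lemma restrictP F : diff_function U F -> diff_function U (restrict F).
Proof. by apply: (eq_diff oU) => v Uv; rewrite restrict_in. Qed.

Definition mkd F (hF : diff_function U F) : dfun U := DFun (restrictP hF) (@restrict_out F).

Lemma mkdE F (hF : diff_function U F) v : dset U v -> dval (mkd hF) v = F v.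
Proof. exact: restrict_in. Qed.

HB.instance Definition _ := gen_eqMixin (dfun U).
HB.instance Definition _ := gen_choiceMixin (dfun U).

Definition dadd f g := mkd (diffD oU (dvalP f) (dvalP g)).
Definition dopp f := mkd (diffN oU (dvalP f)).
Definition dmul f g := mkd (diffM oU (dvalP f) (dvalP g)).
Definition dcst c : dfun U := mkd (diff_cst U c).

Lemma daddA : associative dadd.
Proof. by move=> f g h; apply: dfun_eq => v Uv; rewrite !mkdE // addrA. Qed.

Lemma daddC : commutative dadd.
Proof. by move=> f g; apply: dfun_eq => v Uv; rewrite !mkdE // addrC. Qed.

Lemma dadd0 : left_id (dcst 0) dadd.
Proof. by move=> f; apply: dfun_eq => v Uv; rewrite !mkdE // add0r. Qed.

Lemma daddN : left_inverse (dcst 0) dopp dadd.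
Proof. by move=> f; apply: dfun_eq => v Uv; rewrite !mkdE // addNr. Qed.

HB.instance Definition _ := GRing.isZmodule.Build (dfun U) daddA daddC dadd0 daddN.

Lemma dmulA : associative dmul.
Proof. by move=> f g h; apply: dfun_eq => v Uv; rewrite !mkdE // mulrA. Qed.

Lemma dmulC : commutative dmul.
Proof. by move=> f g; apply: dfun_eq => v Uv; rewrite !mkdE // mulrC. Qed.

Lemma dmul1 : left_id (dcst 1) dmul.
Proof. by move=> f; apply: dfun_eq => v Uv; rewrite !mkdE // mul1r. Qed.

Lemma dmulDl : left_distributive dmul dadd.
Proof. by move=> f g h; apply: dfun_eq => v Uv; rewrite !mkdE // mulrDl. Qed.

HB.instance Definition _ :=
  GRing.Zmodule_isComPzRing.Build (dfun U) dmulA dmulC dmul1 dmulDl.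

Lemma dvalD f g v : dset U v -> dval (f + g) v = dval f v + dval g v.
Proof. exact: mkdE. Qed.

Lemma dvalN f v : dset U v -> dval (- f) v = - dval f v.
Proof. exact: mkdE. Qed.

Lemma dvalM f g v : dset U v -> dval (f * g) v = dval f v * dval g v.
Proof. exact: mkdE. Qed.

Lemma dval_cst c v : dset U v -> dval (dcst c) v = c.
Proof. exact: mkdE. Qed.

Lemma dcst_zmod_morphism : zmod_morphism dcst.
Proof. by move=> c d; apply: dfun_eq => v Uv; rewrite dvalD // dvalN // !dval_cst. Qed.

HB.instance Definition _ := GRing.isZmodMorphism.Build R (dfun U) dcst dcst_zmod_morphism.

Lemma dcst_monoid_morphism : monoid_morphism dcst.
Proof.
by split=> // c d; apply: dfun_eq => v Uv; rewrite dvalM // !dval_cst.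
Qed.

HB.instance Definition _ := GRing.isMonoidMorphism.Build R (dfun U) dcst dcst_monoid_morphism.

Definition dpoint := {v : jet R | dset U v}.
Definition deval (t : dpoint) f : R := dval f (projT1 t).

Lemma deval_zmod_morphism t : zmod_morphism (deval t).
Proof.
case: t => v Uv f g; change (dval (f - g) v = dval f v - dval g v).
by rewrite dvalD // dvalN.
Qed.

HB.instance Definition _ t :=
  GRing.isZmodMorphism.Build (dfun U) R (deval t) (deval_zmod_morphism t).

Lemma deval_monoid_morphism t : monoid_morphism (deval t).
Proof.
case: t => v Uv; split; first exact: (dval_cst 1 Uv).
by move=> f g; exact: (dvalM f g Uv).
Qed.

HB.instance Definition _ t :=
  GRing.isMonoidMorphism.Build (dfun U) R (deval t) (deval_monoid_morphism t).

End DfunRing.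

Section DfunJets.
Context {R : realType} {U : domain R}.
Implicit Types (v : jet R) (f g h : dfun U) (i j k n : nat).
Let oU := @domain_open R U.

Lemma dval_smooth f : smooth U (dval f).
Proof. by case: (dvalP f). Qed.

Lemma dval_regular f : regular U (dval f).
Proof. exact: smooth_regular (dval_smooth f). Qed.

Definition dpd k f := mkd (diff_partial oU k (dvalP f)).

Lemma dval_pd k f v : dset U v -> dval (dpd k f) v = partial k (dval f) v.
Proof. exact: mkdE. Qed.

Lemma dpdD k f g : dpd k (f + g) = dpd k f + dpd k g.
Proof.
apply: dfun_eq => v Uv; rewrite dvalD // !dval_pd //.
rewrite -[RHS](partialD k (dval_regular f) (dval_regular g) Uv).
by apply: (eq_partial oU _ _ Uv) => w Uw; exact: dvalD.
Qed.

Lemma dpdM k f g : dpd k (f * g) = dpd k f * g + f * dpd k g.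
Proof.
apply: dfun_eq => v Uv; rewrite dvalD // !dvalM // !dval_pd //.
rewrite -[RHS](partialM k (dval_regular f) (dval_regular g) Uv).
by apply: (eq_partial oU _ _ Uv) => w Uw; exact: dvalM.
Qed.

Lemma dpd_cst k c : dpd k (dcst c) = 0.
Proof.
apply: dfun_eq => v Uv; rewrite dval_pd // -[RHS]/(dval (dcst 0) v) dval_cst //.
have := partial_cst k c => /(congr1 (fun F => F v)) <-.
by apply: (eq_partial oU _ _ Uv) => w Uw; exact: dval_cst.
Qed.

Definition dpd_derivation k : derivation (@dcst R U) := Derivation (dpdD k) (dpdM k) (dpd_cst k).

Lemma dval_pd2 i j f v : dset U v ->
  dval (dpd i (dpd j f)) v = partial i (partial j (dval f)) v.
Proof.
move=> Uv; apply: etrans (dval_pd i (dpd j f) Uv) _.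
by apply: (eq_partial oU _ _ Uv) => w Uw; exact: dval_pd.
Qed.

Lemma dpdC i j f : dpd i (dpd j f) = dpd j (dpd i f).
Proof.
apply: dfun_eq => v Uv; apply: etrans (dval_pd2 i j f Uv) _.
apply: etrans _ (esym (dval_pd2 j i f Uv)).
exact: (@partialC R U oU (dval f) i j (dval_smooth f) v Uv).
Qed.

Lemma dpd_fin f : exists n, forall k, (n <= k)%N -> dpd k f = 0.
Proof.
have [[n hf] _] := dvalP f; exists n => k nk; apply: dfun_eq => v Uv.
by rewrite dval_pd // (has_order_partial0 oU hf nk) // -[RHS]/(dval (dcst 0) v) dval_cst.
Qed.

Definition djv i : dfun U := mkd (diff_coord U i).

Lemma dpd_jv i j : dpd i (djv j) = (i == j)%:R.
Proof.
have -> : (i == j)%:R = dcst (i == j)%:R :> dfun U by rewrite rmorph_nat.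
apply: dfun_eq => v Uv; rewrite (dval_pd _ _ Uv) (dval_cst _ Uv).
transitivity (partial i (fun w : jet R => w j) v); last by rewrite partial_coord.
by apply: (eq_partial oU _ _ Uv) => w Uw; exact: mkdE.
Qed.

Definition dDt f := mkd (diff_Dx oU (dvalP f)).

Lemma dval_Dt f v : dset U v -> dval (dDt f) v = Dx (dval f) v.
Proof. exact: mkdE. Qed.

Lemma dval_sum n (F : 'I_n -> dfun U) v : dset U v ->
  dval (\sum_(k < n) F k) v = \sum_(k < n) dval (F k) v.
Proof.
by move=> Uv; exact: (rmorph_sum (deval (exist _ v Uv : dpoint))).
Qed.

Lemma dDtE f n : (forall k, (n <= k)%N -> dpd k f = 0) ->
  dDt f = \sum_(k < n) djv k.+1 * dpd k f.
Proof.
move=> hn; apply: dfun_eq => v Uv; rewrite dval_Dt // dval_sum //.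
rewrite /Dx (fsum_ord (n := n)) => [|k nk].
  by apply: eq_bigr => k _; rewrite dvalM // dval_pd // mkdE.
by rewrite -dval_pd // hn // -[0]/(dcst 0) dval_cst // mulr0.
Qed.
End DfunJets.

Section DfunJetAlgebra.
Context {R : realType} {U : domain R}.
Implicit Types (v : jet R) (f g h : dfun U) (i j k n : nat).
Let oU := @domain_open R U.

Lemma dpd_fin2 f g : exists n, forall k, (n <= k)%N -> dpd k f = 0 /\ dpd k g = 0.
Proof.
have [n hn] := dpd_fin f; have [m hm] := dpd_fin g; exists (maxn n m) => k.
by rewrite geq_max => /andP[/hn -> /hm ->].
Qed.

Lemma dDtD f g : dDt (f + g) = dDt f + dDt g.
Proof.
have [n hn] := dpd_fin2 f g.
rewrite (dDtE (n := n) (f := f)); last by move=> k /hn[].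
rewrite (dDtE (n := n) (f := g)); last by move=> k /hn[].
rewrite (dDtE (n := n)); last by move=> k /hn[hf hg]; rewrite dpdD hf hg addr0.
by rewrite -big_split; apply: eq_bigr => k _; rewrite dpdD mulrDr.
Qed.

Lemma dDtM f g : dDt (f * g) = dDt f * g + f * dDt g.
Proof.
have [n hn] := dpd_fin2 f g.
rewrite (dDtE (n := n) (f := f)); last by move=> k /hn[].
rewrite (dDtE (n := n) (f := g)); last by move=> k /hn[].
rewrite (dDtE (n := n)); last first.
  by move=> k /hn[hf hg]; rewrite dpdM hf hg mulr0 mul0r addr0.
rewrite mulr_suml mulr_sumr -big_split; apply: eq_bigr => k _.
by rewrite dpdM /=; ring.
Qed.

Lemma dDt_cst c : dDt (@dcst R U c) = 0.
Proof. by rewrite (dDtE (n := 0)) ?big_ord0 // => k _; exact: dpd_cst. Qed.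

Definition dDt_derivation : derivation (@dcst R U) := Derivation dDtD dDtM dDt_cst.

Lemma dpd0 k : dpd k (0 : dfun U) = 0.
Proof. exact: der0 (dpd_derivation k). Qed.

(** If the partial derivatives beyond k vanish, that of D f in u_(k+1) is the k-th one of f; hence
    all vanish, from the top down. Connectedness of the domain then makes f constant. *)
Lemma dDt_ker f : dDt f = 0 -> exists c, f = dcst c.
Proof.
move=> Df0; have pd0 k : dpd k f = 0.
  have [n hn] := dpd_fin f.
  have [d] : exists d, (n <= k + d)%N by exists n; exact: leq_addl.
  elim: d k => [|d IHd] k hk; first by apply: hn; rewrite -(addn0 k).
  have hS j : (k.+1 <= j)%N -> dpd j f = 0.
    by move=> kj; apply: IHd; rewrite (leq_trans hk) // addnS -addSn leq_add2r.
  have := congr1 (dpd_derivation k.+1) Df0.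
  rewrite der0 (dDtE hS) der_sum big_ord_recr big1 /= => [|i _].
    by rewrite add0r dpdM dpd_jv eqxx mul1r dpdC (hS k.+1) // dpd0 mulr0 addr0.
  by rewrite dpdM dpd_jv eqSS gtn_eqF // mul0r add0r dpdC (hS k.+1) // dpd0 mulr0.
(* The domain may be empty; the ring is then trivial and any constant will do. *)
case: (pselect (exists v, dset U v)) => [[v0 Uv0]|nU].
  exists (dval f v0); apply: dfun_eq => v Uv; rewrite dval_cst //.
  have [[n hf] _] := dvalP f.
  apply: (constant_on oU (dsetP U).2 hf (dval_regular f)) => // k w Uw.
  by rewrite -dval_pd // pd0 -[0]/(dcst 0) dval_cst.
by exists 0; apply: dfun_eq => v Uv; case: nU; exists v.
Qed.

Definition djets : jetAlgebra R :=
  @JetAlgebra R (dfun U) dcst dpoint (fun t => deval t)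
    (fun t c => dval_cst c (projT2 t))
    (fun f g e => dfun_eq (fun v Uv => e (exist _ v Uv)))
    dpd_derivation dpdC dpd_fin djv dpd_jv dDt_derivation dDtE dDt_ker.

End DfunJetAlgebra.

(** * From the jet algebra back to functions on jets *)

Section Translation.
Context {R : realType} {U : domain R}.
Implicit Types (v : jet R) (i j k n : nat) (f g : jet R -> R).
Let oU := @domain_open R U.

Local Notation A := (@djets R U).
Implicit Types x y X Y : A.

Lemma eq_iterDx n f g : eq_on U f g -> eq_on U (iter n Dx f) (iter n Dx g).
Proof. by move=> fg; elim: n => //= n IHn; exact: eq_Dx. Qed.

Lemma eq_iterNDx n f g : eq_on U f g ->
  eq_on U (iter n (fun h => - Dx h) f) (iter n (fun h => - Dx h) g).
Proof.
move=> fg; elim: n => //= n IHn v Uv; congr (- _); exact: eq_Dx IHn v Uv.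
Qed.

Lemma dval_iterDt n X : eq_on U (dval (iter n Dt X)) (iter n Dx (dval X)).
Proof.
elim: n => //= n IHn v Uv; apply: etrans (dval_Dt (iter n Dt X) Uv) _.
exact: eq_Dx IHn v Uv.
Qed.

Lemma dval_iterND n X :
  eq_on U (dval (iter n (@negD _ A) X)) (iter n (fun h => - Dx h) (dval X)).
Proof.
elim: n => //= n IHn v Uv.
apply: etrans (dvalN (Dt (iter n (@negD _ A) X)) Uv) _; congr (- _).
apply: etrans (dval_Dt (iter n (@negD _ A) X) Uv) _.
exact: eq_Dx IHn v Uv.
Qed.

Lemma eq_frechet f f' g g' : eq_on U f f' -> eq_on U g g' ->
  eq_on U (frechet f g) (frechet f' g').
Proof.
move=> ff gg v Uv; apply: eq_fsbigr => k _.
by rewrite (eq_partial oU k ff Uv) (eq_iterDx k gg Uv).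
Qed.

Lemma eq_frechet_adj f f' g g' : eq_on U f f' -> eq_on U g g' ->
  eq_on U (frechet_adj f g) (frechet_adj f' g').
Proof.
move=> ff gg v Uv; apply: eq_fsbigr => k _; apply: eq_iterNDx (Uv) => w Uw.
by change (partial k f w * g w = partial k f' w * g' w);
  rewrite (eq_partial oU k ff Uw) gg.
Qed.

Lemma frechetE x X : eq_on U (frechet (dval x) (dval X)) (dval (evo X x)).
Proof.
move=> v Uv; rewrite /frechet /diff_op (fsum_ord (n := jord x)) => [|k hk].
  rewrite [RHS](dval_sum _ Uv); apply: eq_bigr => k _.
  apply: esym; apply: etrans (dvalM _ _ Uv) _; rewrite mulrC; congr (_ * _).
    exact: dval_pd.
  exact: dval_iterDt.
have := dval_pd k x Uv; rewrite [dpd k x](jordP hk) => <-.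
by rewrite -[(0 : A)]/(dcst 0) dval_cst // mul0r.
Qed.

Lemma iterND0 k : iter k (@negD _ A) 0 = 0.
Proof. by elim: k => //= k ->; rewrite /negD der0 oppr0. Qed.

Lemma frechet_adjE x X : eq_on U (frechet_adj (dval x) (dval X)) (dval (adj x X)).
Proof.
move=> v Uv.
have E k : iter k (fun h => - Dx h) (partial k (dval x) * dval X) v
    = dval (iter k (@negD _ A) (pd k x * X)) v.
  rewrite (dval_iterND k (pd k x * X) Uv); apply: eq_iterNDx (Uv) => w Uw.
  by apply: esym; apply: etrans (dvalM _ _ Uw) _; congr (_ * _); exact: dval_pd.
rewrite /frechet_adj /diff_op_adj (fsum_ord (n := jord x)) => [|k hk].
  by rewrite [RHS](dval_sum _ Uv); apply: eq_bigr => k _; rewrite E.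
by rewrite E jordP // mul0r iterND0 -[(0 : A)]/(dcst 0) dval_cst.
Qed.

Lemma variationalE x : eq_on U (variational (dval x)) (dval (adj x 1)).
Proof.
move=> v Uv; have E k : iter k (fun h => - Dx h) (partial k (dval x)) v
    = dval (iter k (@negD _ A) (pd k x * 1)) v.
  rewrite mulr1 (dval_iterND k (pd k x) Uv); apply: eq_iterNDx (Uv) => w Uw.
  by apply: esym; exact: dval_pd.
rewrite /variational (fsum_ord (n := jord x)) => [|k hk].
  by rewrite [RHS](dval_sum _ Uv); apply: eq_bigr => k _; rewrite E.
by rewrite E jordP // mul0r iterND0 -[(0 : A)]/(dcst 0) dval_cst.
Qed.

Lemma closed_dval x : is_closed x -> closed_form U (dval x).
Proof.
move=> cx g dg v /set_mem Uv; pose X : A := mkd dg.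
have gX : eq_on U g (dval X) by move=> w Uw; rewrite mkdE.
rewrite (eq_frechet (fun w _ => erefl) gX Uv) (eq_frechet_adj (fun w _ => erefl) gX Uv).
by rewrite frechetE // frechet_adjE // cx.
Qed.

(** [HOp] lifts a value of H, whatever its primitives, to a value of [Op]. By induction on j every
    iterate agrees on U with an element of [S], and every flow with an element of [F]. *)
Lemma lenard_translation (H : (jet R -> R) -> set (jet R -> R)) (Op : A -> A -> Prop)
    (xi0 : jet R -> R) (x0 : A) :
  lenard_property Op x0 -> eq_on U xi0 (dval x0) ->
  (forall f f' P, eq_on U f f' -> H f P -> H f' P) ->
  (forall x P, H (dval x) P -> exists2 y, Op x y & eq_on U P (dval y)) ->
  (forall x y, Op x y -> H (dval x) (dval y)) ->
  local_closed_forms U H xi0 /\ commuting_flows U H xi0.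
Proof.
move=> [S [F [Sx0 SP SF FS FC]]] xi0E eqH HOp OpH.
have it j xi : Rstar_iter U H xi0 j xi -> exists2 x, S x & eq_on U xi (dval x).
  elim: j xi => [|j IHj] xi.
    by move=> h; exists x0 => // v Uv; rewrite h ?mem_set // xi0E.
  move=> [f /IHj[x Sx fx] [P HP xiE]].
  have [y Oxy Py] := HOp x P (eqH _ _ _ fx HP).
  exists (Dt y); first exact/FS/(SF x).
  move=> v Uv; rewrite xiE ?mem_set // (eq_Dx oU Py) //.
  by apply: esym; exact: dval_Dt.
split=> [j xi /it[x Sx xix]|j k xi zeta P Q /it[x Sx xix] /it[z Sz zetaz] HP HQ].
  have [cx [y Oxy]] := SP x Sx; split.
  - by apply: (eq_diff oU (eq_on_sym xix)); exact: dvalP.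
  - move=> g dg v Uv; have Uv' := set_mem Uv.
    rewrite (eq_frechet xix (fun w _ => erefl) Uv').
    rewrite (eq_frechet_adj xix (fun w _ => erefl) Uv').
    exact: closed_dval.
  - by exists (dval y); apply: eqH (eq_on_sym xix) (OpH _ _ Oxy).
have [y Oxy Py] := HOp x P (eqH _ _ _ xix HP).
have [t Ozt Qt] := HOp z Q (eqH _ _ _ zetaz HQ).
move=> v /set_mem Uv; change (frechet Q P v - frechet P Q v = 0).
rewrite (eq_frechet Qt Py Uv) (eq_frechet Py Qt Uv) !frechetE //.
by rewrite (FC y t) ?subrr //; [exact: SF Oxy|exact: SF Ozt].
Qed.

End Translation.

Section SymbolEvaluation.
Context {R : realType} {U : domain R}.
Implicit Types (v : jet R) (b P g : jet R -> R).
Let oU := @domain_open R U.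

Local Notation A := (@djets R U).
Implicit Types x y B G : A.

Lemma dvalX x n v : dset U v -> dval (x ^+ n) v = dval x v ^+ n.
Proof. by move=> Uv; exact: (rmorphXn (deval (exist _ v Uv : dpoint)) n x). Qed.

Lemma dval_nat n v : dset U v -> dval (n%:R : A) v = n%:R.
Proof. by move=> Uv; exact: (rmorph_nat (deval (exist _ v Uv : dpoint)) n). Qed.

Lemma dval_jv n v : dset U v -> dval (jv n : A) v = v n.
Proof. exact: mkdE. Qed.

Lemma eq_variational f g : eq_on U f g -> eq_on U (variational f) (variational g).
Proof.
move=> fg v Uv; apply: eq_fsbigr => k _.
exact: eq_iterNDx (eq_partial oU k fg) v Uv.
Qed.

Lemma eq_primitive b b' g : eq_on U b b' -> primitive U b g -> primitive U b' g.
Proof. by move=> bb [dg Eg]; split=> // v Uv; rewrite Eg // bb //; exact: set_mem. Qed.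

Lemma primitive_mkd b g B x : eq_on U b (dval B) -> primitive U (b * dval x) g ->
  exists2 G : A, eq_on U g (dval G) & Dt G = B * x.
Proof.
move=> bB [dg Dg]; have gG : eq_on U g (dval (mkd dg)) by move=> v Uv; rewrite mkdE.
exists (mkd dg : A) => //; apply: dfun_eq => v Uv.
apply: etrans (dval_Dt _ Uv) _; apply: etrans (esym (eq_Dx oU gG Uv)) _.
apply: etrans (Dg v (mem_set Uv)) _; apply: esym; apply: etrans (dvalM _ _ Uv) _.
by rewrite -bB.
Qed.

Lemma primitive_dval b B x G : eq_on U b (dval B) -> Dt G = B * x ->
  primitive U (b * dval x) (dval G).
Proof.
move=> bB DG; split; first exact: dvalP.
move=> v /set_mem Uv; apply: etrans (esym (dval_Dt G Uv)) _.
rewrite [dDt G]DG; apply: etrans (dvalM _ _ Uv) _.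
by rewrite -bB.
Qed.

Lemma dval_symbol b B x : eq_on U b (dval B) ->
  eq_on U (b * Dx (dval x) + Dx (b * dval x)) (dval (2 * B * Dt x + Dt B * x)).
Proof.
move=> bB v Uv; have -> : 2 * B * Dt x + Dt B * x = B * Dt x + Dt (B * x).
  by rewrite derM; ring.
apply: esym; apply: etrans (dvalD _ _ Uv) _; congr (_ + _).
  apply: etrans (dvalM _ _ Uv) _; rewrite -bB //; congr (_ * _); exact: dval_Dt.
apply: etrans (dval_Dt _ Uv) _; apply: (eq_Dx oU) (Uv) => w Uw.
by apply: etrans (dvalM _ _ Uw) _; rewrite -bB.
Qed.

End SymbolEvaluation.

(** * The three hierarchies on a domain *)

Section Hierarchies.
Context {R : realType} {U : domain R}.
Implicit Types (v : jet R) (f g xi P : jet R -> R).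
Let oU := @domain_open R U.

Local Notation A := (@djets R U).
Local Notation half := (kcst 2^-1 : A).

Lemma eq_Dx_mul b f f' : eq_on U f f' -> eq_on U (Dx (b * f)) (Dx (b * f')).
Proof. by move=> ff; apply: (eq_Dx oU) => v Uv; congr (_ * _); exact: ff. Qed.

Lemma eq_H1 s f f' P : eq_on U f f' -> H1 U s f P -> H1 U s f' P.
Proof.
move=> ff [g pg PE]; exists g.
  by apply: eq_primitive pg => v Uv; congr (_ * _); exact: ff.
move=> v Uv; apply: etrans (PE v Uv) _; move/set_mem: Uv => Uv.
by rewrite !fctE (eq_Dx oU ff Uv) (eq_Dx_mul _ ff Uv).
Qed.

Lemma eq_H2 f f' P : eq_on U f f' -> H2 U f P -> H2 U f' P.
Proof.
move=> ff [g pg PE]; exists g.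
  by apply: eq_primitive pg => v Uv; congr (_ * _); exact: ff.
move=> v Uv; apply: etrans (PE v Uv) _; move/set_mem: Uv => Uv.
by rewrite !fctE (eq_Dx oU ff Uv) (eq_Dx_mul _ ff Uv).
Qed.

Lemma eq_H3 f f' P : eq_on U f f' -> H3 U f P -> H3 U f' P.
Proof.
move=> ff [g [h [pg ph PE]]]; exists g, h; split.
- by apply: eq_primitive pg => v Uv; congr (_ * _); exact: ff.
- by apply: eq_primitive ph => v Uv; congr (_ * _); exact: ff.
move=> v Uv; apply: etrans (PE v Uv) _; move/set_mem: Uv => Uv.
by rewrite !fctE (eq_Dx oU ff Uv) (eq_Dx_mul _ ff Uv).
Qed.

Lemma dym_hierarchy s : sqrt_branch U s ->
  local_closed_forms U (H1 U s) (xi1 s) /\ commuting_flows U (H1 U s) (xi1 s).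
Proof.
move=> [ds sP].
have s0 v : dset U v -> s v != 0.
  by move=> /sP[v2 sv]; apply: contra_neq v2 => s0; rewrite -sv s0 expr0n.
(* The given branch s is u_2^(1/2); its inverse [sA] is the generator used in the algebra. *)
pose u2r : A := mkd ds; pose sA : A := mkd (diffV oU s0 ds).
have u2rE : u2r ^+ 2 = jv 2.
  apply: dfun_eq => v Uv; apply: etrans (dvalX _ _ Uv) _.
  by rewrite mkdE // (sP v Uv).2 dval_jv.
have sE : sA * u2r = 1.
  apply: dfun_eq => v Uv; apply: etrans (dvalM _ _ Uv) _.
  rewrite (mkdE ds Uv) (mkdE (diffV oU s0 ds) Uv) (mulVf (s0 v Uv)).
  exact: esym (dval_nat 1 Uv).
have aE : eq_on U (fun v => (v 2%N)^-1) (dval (sA ^+ 2 : A)).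
  move=> v Uv; apply: esym; apply: etrans (dvalX _ _ Uv) _.
  by rewrite mkdE // exprVn (sP v Uv).2.
have bE : eq_on U (fun v => v 3%N * s v ^- 3) (dval (- (2 * Dt sA) : A)).
  have -> : - (2 * Dt sA) = jv 3 * sA ^+ 3 :> A.
    have -> : jv 3 = Dt (jv 2) :> A by exact: esym (iter_jv 1 2).
    rewrite (der_dym u2rE sE) -[RHS]halfK; ring.
  move=> v Uv; apply: esym; apply: etrans (dvalM _ _ Uv) _.
  rewrite (dval_jv _ Uv); congr (_ * _); apply: etrans (dvalX _ _ Uv) _.
  by rewrite mkdE // exprVn.
have HE (x G : A) v : dset U v ->
  (2 *: ((fun v => (v 2%N)^-1) * Dx (dval x)) +
   2 *: Dx ((fun v => (v 2%N)^-1) * dval x) -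
   (fun v => v 3%N * s v ^- 3) * dval G : jet R -> R) v =
  dval (2 * (2 * sA ^+ 2 * Dt x + Dt (sA ^+ 2) * x) - - (2 * Dt sA) * G : A) v.
  move=> Uv; apply: esym; apply: etrans (dvalD _ _ Uv) _.
  rewrite (dvalN _ Uv) (dvalM _ _ Uv) (dval_nat 2 Uv) -(dval_symbol x aE Uv).
  by rewrite [dval (_ * _) v](dvalM _ _ Uv) -(bE v Uv) mulrDr.
apply: (lenard_translation (dym_scheme u2rE sE)).
- rewrite -(dym_density u2rE sE) => v Uv; rewrite -variationalE //.
  by apply: (eq_variational (U := U)) (Uv) => w Uw; rewrite mkdE.
- by move=> f f' P; exact: eq_H1.
- move=> x P [g pg PE]; have [G gG DG] := primitive_mkd bE pg.
  (* The single primitive of the statement yields both potentials, G and G / 2, whose combination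
     [half * cpf c + cpg c] gives G back. *)
  have DG' : Dt (half * G) = - Dt sA * x.
    by rewrite derM der_cst mul0r add0r DG -[RHS]halfK; ring.
  pose c := Covector DG DG'; exists (Hop (2 * sA ^+ 2) c); first by exists c.
  have cE : half * cpf c + cpg c = G by rewrite -[RHS]halfK /c; cbn [cpf cpg]; ring.
  move=> v Uv; rewrite dym_HopE cE -(HE x G v Uv).
  by apply: etrans (PE _ (mem_set Uv)) _; rewrite !fctE (gG v Uv).
move=> x y [c <- ->]; exists (dval (half * cpf c + cpg c)).
  exact: primitive_dval bE (dym_covector c).
by move=> v /set_mem Uv; rewrite dym_HopE -HE.
Qed.

Lemma second_hierarchy : (forall v, dset U v -> v 2%N != 0) ->
  local_closed_forms U (H2 U) xi2 /\ commuting_flows U (H2 U) xi2.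
Proof.
move=> u2_neq0; pose vA : A := mkd (diffV oU u2_neq0 (diff_coord U 2)).
have vE : vA * jv 2 = 1.
  apply: dfun_eq => v Uv; apply: etrans (dvalM _ _ Uv) _.
  rewrite (mkdE (diffV oU u2_neq0 (diff_coord U 2)) Uv) (dval_jv 2 Uv).
  rewrite (mulVf (u2_neq0 v Uv)); exact: esym (dval_nat 1 Uv).
have aE : eq_on U (fun v => v 1%N ^+ 4 * v 2%N ^- 2) (dval (jv 1 ^+ 4 * vA ^+ 2 : A)).
  move=> v Uv; apply: esym; apply: etrans (dvalM _ _ Uv) _.
  by rewrite !(dvalX _ _ Uv) (dval_jv 1 Uv) mkdE // exprVn.
have wE : eq_on U (fun v => v 1%N) (dval (jv 1 : A)).
  by move=> v Uv; rewrite dval_jv.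
have HE (x G : A) v : dset U v ->
  ((fun v => v 1%N ^+ 4 * v 2%N ^- 2) * Dx (dval x) +
   Dx ((fun v => v 1%N ^+ 4 * v 2%N ^- 2) * dval x) -
   8 *: ((fun v => v 1%N) * dval G) : jet R -> R) v =
  dval (2 * (jv 1 ^+ 4 * vA ^+ 2) * Dt x + Dt (jv 1 ^+ 4 * vA ^+ 2) * x
    - 8 * (jv 1 * G) : A) v.
  move=> Uv; apply: esym; apply: etrans (dvalD _ _ Uv) _.
  rewrite (dvalN _ Uv) (dvalM _ _ Uv) (dval_nat 8 Uv) -(dval_symbol x aE Uv).
  by rewrite [dval (_ * _) v](dvalM _ _ Uv) -(wE v Uv).
apply: (lenard_translation (second_scheme vE)).
- rewrite -(second_density vE) => v Uv; rewrite -variationalE //.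
  apply: (eq_variational (U := U)) (Uv) => w Uw; apply: esym.
  apply: etrans (dvalM _ _ Uw) _; rewrite (dvalM _ _ Uw) (dvalX _ _ Uw).
  rewrite (dval_jv 1 Uw) (dval_cst _ Uw) mkdE // invfM; ring.
- by move=> f f' P; exact: eq_H2.
- move=> x P [g pg PE]; have [G gG DG] := primitive_mkd wE pg.
  (* Potentials G and 4 G come from the same primitive, so their weighted mean is again G. *)
  have DG' : Dt (4 * G) = 4 * jv 1 * x by rewrite derM der_nat DG; ring.
  pose c := Covector DG DG'; exists (Hop (jv 1 ^+ 4 * vA ^+ 2) c); first by exists c.
  have cE : half * (cpf c + half * (half * cpg c)) = G.
    by rewrite /c; cbn [cpf cpg]; rewrite quarterK -[RHS]halfK; ring.
  move=> v Uv; rewrite second_HopE cE -(HE x G v Uv).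
  by apply: etrans (PE _ (mem_set Uv)) _; rewrite !fctE (gG v Uv).
move=> x y [c <- ->]; exists (dval (half * (cpf c + half * (half * cpg c)))).
  exact: primitive_dval wE (second_covector c).
by move=> v /set_mem Uv; rewrite second_HopE -HE.
Qed.

Lemma third_hierarchy : (forall v, dset U v -> v 1%N != 0) ->
  local_closed_forms U (H3 U) xi3 /\ commuting_flows U (H3 U) xi3.
Proof.
move=> u1_neq0; pose t : A := mkd (diffV oU u1_neq0 (diff_coord U 1)).
have dt v : dset U v -> dval t v = (v 1%N)^-1 by exact: mkdE.
have tw : t * jv 1 = 1.
  apply: dfun_eq => v Uv; apply: etrans (dvalM _ _ Uv) _.
  rewrite (dt v Uv) (dval_jv 1 Uv) (mulVf (u1_neq0 v Uv)).
  exact: esym (dval_nat 1 Uv).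
have aE : eq_on U (fun v => v 1%N ^- 4) (dval (t ^+ 4 : A)).
  by move=> v Uv; rewrite (dvalX _ _ Uv) (dt v Uv) exprVn.
have bE : eq_on U (fun v => v 3%N * v 1%N ^- 6 - 3 * v 2%N ^+ 2 * v 1%N ^- 7)
    (dval (third_b t)).
  move=> v Uv; rewrite (third_bE tw); apply: esym; apply: etrans (dvalD _ _ Uv) _.
  rewrite (dvalN _ Uv) [dval (_ * _) v](dvalM _ _ Uv) [dval (3 * _ * _) v](dvalM _ _ Uv).
  rewrite (dvalM _ _ Uv) !(dvalX _ _ Uv) (dval_nat 3 Uv) (dval_jv 2 Uv) (dval_jv 3 Uv).
  by rewrite (dt v Uv) !exprVn.
have wE : eq_on U (fun v => v 1%N) (dval (jv 1 : A)).
  by move=> v Uv; rewrite dval_jv.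
have HE (x G H : A) v : dset U v ->
  ((fun v => v 1%N ^- 4) * Dx (dval x) + Dx ((fun v => v 1%N ^- 4) * dval x) -
   4 *: ((fun v => v 3%N * v 1%N ^- 6 - 3 * v 2%N ^+ 2 * v 1%N ^- 7) * dval G) -
   4 *: ((fun v => v 1%N) * dval H) : jet R -> R) v =
  dval (2 * t ^+ 4 * Dt x + Dt (t ^+ 4) * x - 4 * (third_b t * G) - 4 * (jv 1 * H) : A) v.
  move=> Uv; apply: esym; apply: etrans (dvalD _ _ Uv) _; rewrite (dvalD _ _ Uv).
  rewrite !(dvalN _ Uv) ![dval (4 * _) v](dvalM _ _ Uv) (dval_nat 4 Uv).
  rewrite -(dval_symbol x aE Uv) (dvalM _ _ Uv) -(bE v Uv).
  by rewrite (dvalM _ _ Uv) -(wE v Uv).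
apply: (lenard_translation (third_scheme tw)).
- rewrite -(third_density tw) => v Uv; rewrite -variationalE //.
  apply: (eq_variational (U := U)) (Uv) => w Uw; apply: esym.
  apply: etrans (dvalM _ _ Uw) _; rewrite (dvalM _ _ Uw) !(dvalX _ _ Uw).
  by rewrite (dval_jv 2 Uw) (dval_cst _ Uw) (dt w Uw) invfM exprVn; ring.
- by move=> f f' P; exact: eq_H3.
- move=> x P [g [h [pg ph PE]]]; have [G gG DG] := primitive_mkd wE pg.
  have [H hH DH] := primitive_mkd bE ph.
  have DG' : Dt (4 * G) = 4 * jv 1 * x by rewrite derM der_nat DG; ring.
  pose c := Covector DH DG'; exists (Hop (t ^+ 4) c); first by exists c.
  move=> v Uv; rewrite third_HopE.
  have -> : half * (half * cpg c) = G by exact: quarterK.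
  rewrite -(HE x G H v Uv).
  by apply: etrans (PE _ (mem_set Uv)) _; rewrite !fctE (gG v Uv) (hH v Uv).
move=> x y [c <- ->]; exists (dval (half * (half * cpg c))), (dval (cpf c)); split.
- exact: primitive_dval wE (third_covector c).
- exact: primitive_dval bE (cpfE c).
by move=> v /set_mem Uv; rewrite third_HopE -HE.
Qed.

End Hierarchies.

Theorem theorem6 (R : realType) (U : set (jet R)) (hU : jet_domain U) :
  [/\ forall s : jet R -> R, sqrt_branch U s ->
        local_closed_forms U (H1 U s) (xi1 s) /\
        commuting_flows U (H1 U s) (xi1 s),
      (forall v : jet R, U v -> v 2%N != 0) ->
        local_closed_forms U (H2 U) xi2 /\
        commuting_flows U (H2 U) xi2
    & (forall v : jet R, U v -> v 1%N != 0) ->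
        local_closed_forms U (H3 U) xi3 /\
        commuting_flows U (H3 U) xi3].
Proof.
split=> [s|h|h].
- exact: (@dym_hierarchy R (Domain hU)).
- exact: (@second_hierarchy R (Domain hU)).
- exact: (@third_hierarchy R (Domain hU)).
Qed.
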